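(* Let $k$ be a field of characteristic $p>2$. Let $\mathfrak g$ be a Lie $k$-superalgebra and $\mathfrak h$ a Lie subsuperalgebra of $\mathfrak g$. Let $(\pi,V)$ be a representation of $\mathfrak h$. Denote by $I_\pi\subset U(\mathfrak g)$ the kernel of the representation $\mathrm{Coind}_{\mathfrak h}^{\mathfrak g}(\pi)$. Assume that the $k$-vector space $\mathfrak g/\mathfrak h$ is finite dimensional with odd dimension $m$ (i.e. $m=\dim(\mathfrak g/\mathfrak h)_{\overline 1}$). Then $$I_\pi=\check I_{\pi^*\otimes\Pi^m k_{-\mathrm{strad}_{\mathfrak g/\mathfrak h}}}=\check I_{\pi^*\otimes k_{-\mathrm{strad}_{\mathfrak g/\mathfrak h}}},$$ where $k_{-\mathrm{strad}_{\mathfrak g/\mathfrak h}}$ is the one-dimensional representation of $\mathfrak h$ defined by the character $-\mathrm{strad}_{\mathfrak g/\mathfrak h}$.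
   Context: Lie superalgebra has the usual meaning (in characteristic $3$ including $[x,[x,x]]=0$ for odd $x$, so that the Poincaré–Birkhoff–Witt theorem holds). $U(\mathfrak g)$ is the enveloping superalgebra. $\check{(-)}$ denotes the antipode of the Hopf superalgebra $U(\mathfrak g)$ ($\check X=-X$ for $X\in\mathfrak g$, $(uw)\check{}=(-1)^{|u||w|}\check w\check u$), and for $I\subset U(\mathfrak g)$, $\check I$ is its image under the antipode. $\Pi$ is the change of parity functor on superspaces. For a representation $(\pi,V)$ of $\mathfrak h$ on a superspace $V$, $\mathrm{Coind}_{\mathfrak h}^{\mathfrak g}(\pi)$ is the superspace of linear maps $\mu:U(\mathfrak g)\to V$ (value at $u$ written $\langle u,\mu\rangle$) such that $\langle Hu,\mu\rangle=\pi(H)\langle u,\mu\rangle$ for all $H\in\mathfrak h$, $u\in U(\mathfrak g)$, with the left $U(\mathfrak g)$-action $\langle w,u\cdot\mu\rangle=\langle wu,\mu\rangle$. Its kernel $I_\pi$ is the set of $u\in U(\mathfrak g)$ acting by zero. $\pi^*$ is the contragredient representation of $\pi$ on $V^*=\mathrm{Hom}_k(V,k)$. $\mathrm{strad}_{\mathfrak g/\mathfrak h}=\mathrm{str}\circ\mathrm{ad}_{\mathfrak g/\mathfrak h}$ is the supertrace of the representation $\mathrm{ad}_{\mathfrak g/\mathfrak h}$ of $\mathfrak h$ on $\mathfrak g/\mathfrak h$ induced by the adjoint action. *)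

(* Defs.v *)
From HB Require Import structures.
From mathcomp Require Import all_boot all_order all_algebra.
From mathcomp Require Import generic_quotient ring_quotient.
From mathcomp Require Import ring.
From mathcomp Require Import boolp classical_sets functions.

Set Implicit Arguments.
Unset Strict Implicit.
Unset Printing Implicit Defensive.

Import GRing.Theory.
Local Open Scope ring_scope.
Local Open Scope quotient_scope.

Lemma linear_fun0 (k : fieldType) (U Z : lmodType k) (f : U -> Z) :
  linear f -> f 0 = 0.
Proof.
by move=> hf; have := hf (-1) 0 0; rewrite !scaleN1r oppr0 addr0 addNr.
Qed.

(* A Z/2-graded vector space V = V_0 (+) V_1 is given by the two
   projections part false (even) and part true (odd); parities are added
   with addb. *)

Record superspace (k : fieldType) := Superspace {
  superspace_sort :> lmodType k;
  part : bool -> superspace_sort -> superspace_sort;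
  part_linear : forall a, linear (part a);
  part_part : forall a b v, part a (part b v) = if a == b then part b v else 0;
  part_sum : forall v, part false v + part true v = v }.
Arguments part {k s} a v.

HB.instance Definition _ (k : fieldType) (V : superspace k) (a : bool) :=
  GRing.isLinear.Build k V V *:%R (@part k V a) (@part_linear k V a).

Definition homog (k : fieldType) (V : superspace k) (a : bool) (v : V) : Prop :=
  part a v = v.

Section SuperspaceTheory.
Variable k : fieldType.
Implicit Types V W : superspace k.

Lemma homog_part V a (v : V) : homog a (part a v).
Proof. by rewrite /homog part_part eqxx. Qed.

Lemma part_homog V a b (v : V) : homog b v -> part a v = if a == b then v else 0.
Proof. by move=> <-; rewrite part_part. Qed.

Lemma homog0 V a : homog a (0 : V).
Proof. exact: linear0. Qed.

Lemma homogP V a c (u v : V) : homog a u -> homog a v -> homog a (c *: u + v).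
Proof. by rewrite /homog part_linear => -> ->. Qed.

Lemma homogD V a (u v : V) : homog a u -> homog a v -> homog a (u + v).
Proof. by rewrite -{2}[u]scale1r; exact: homogP. Qed.

Lemma homogZ V a c (u : V) : homog a u -> homog a (c *: u).
Proof. by move=> hu; rewrite -[c *: u]addr0; exact: homogP hu (homog0 _ _). Qed.

Lemma homogN V a (u : V) : homog a u -> homog a (- u).
Proof. by rewrite -scaleN1r; exact: homogZ. Qed.

Lemma linear_homog_ext V (Z : lmodType k) (F G : V -> Z) :
  linear F -> linear G -> (forall a v, homog a v -> F v = G v) -> F =1 G.
Proof.
move=> lF lG FG v.
have aF u w : F (u + w) = F u + F w by have := lF 1 u w; rewrite !scale1r.
have aG u w : G (u + w) = G u + G w by have := lG 1 u w; rewrite !scale1r.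
by rewrite -(part_sum v) aF aG !(FG _ _ (homog_part _ _)).
Qed.

(* The sum over the homogeneous components of x and y of
   (-1)^{|x||y|} F(x, y): the extension to all x, y of a formula with
   this sign, given on homogeneous elements. *)
Definition koszul V W (Z : lmodType k) (F : V -> W -> Z) (x : V) (y : W) : Z :=
  \sum_(a : bool) \sum_(b : bool) (-1) ^+ (a && b) *: F (part a x) (part b y).

Section Koszul.
Variables (V W : superspace k) (Z : lmodType k) (F : V -> W -> Z).
Hypothesis linF : forall x, linear (F x).
Hypothesis linF' : forall y, linear (F^~ y).

Lemma koszul_linear x : linear (koszul F x).
Proof.
move=> c y z; rewrite /koszul scaler_sumr -big_split; apply: eq_bigr => a _ /=.
rewrite scaler_sumr -big_split; apply: eq_bigr => b _ /=.
by rewrite linearP linF scalerDr !scalerA [c * _]mulrC.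
Qed.

Lemma koszul_linearl y : linear ((koszul F)^~ y).
Proof.
move=> c x z; rewrite /koszul scaler_sumr -big_split; apply: eq_bigr => a _ /=.
rewrite scaler_sumr -big_split; apply: eq_bigr => b _ /=.
by rewrite linearP linF' scalerDr !scalerA [c * _]mulrC.
Qed.

Lemma koszulE a b x y : homog a x -> homog b y ->
  koszul F x y = (-1) ^+ (a && b) *: F x y.
Proof.
move=> hx hy.
have F0 z : F z 0 = 0.
  by have := linF z (-1) 0 0; rewrite scaleN1r oppr0 addr0 scaleN1r addNr.
have F0' z : F 0 z = 0.
  by have := linF' z (-1) 0 0; rewrite scaleN1r oppr0 addr0 scaleN1r addNr.
rewrite /koszul !big_bool.
rewrite !(part_homog _ hx) !(part_homog _ hy).
by case: a b {hx hy} => -[]; rewrite /= ?F0 ?F0' ?scaler0 ?addr0 ?add0r.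
Qed.

End Koszul.
End SuperspaceTheory.

Record lie_superalgebra (k : fieldType) := LieSuperalgebra {
  lie_space :> superspace k;
  br : lie_space -> lie_space -> lie_space;
  br_linearl : forall y, linear (br^~ y);
  br_linearr : forall x, linear (br x);
  br_homog : forall a b x y,
    homog a x -> homog b y -> homog (a (+) b) (br x y);
  br_skew : forall a b x y, homog a x -> homog b y ->
    br x y = - ((-1) ^+ (a && b) *: br y x);
  br_jacobi : forall a b x y z, homog a x -> homog b y ->
    br x (br y z) = br (br x y) z + (-1) ^+ (a && b) *: br y (br x z);
  br_cube : forall x, homog true x -> br x (br x x) = 0 }.
Arguments br {k l} x y.

Record lie_subsuperalgebra (k : fieldType) (g : lie_superalgebra k) :=
  LieSubsuperalgebra {
  lie_sub_mem :> {pred g};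
  lie_sub_submod : subsemimod_closed lie_sub_mem;
  lie_sub_part : forall a x, x \in lie_sub_mem -> part a x \in lie_sub_mem;
  lie_sub_br : {in lie_sub_mem &, forall x y, br x y \in lie_sub_mem} }.

HB.instance Definition _ (k : fieldType) (g : lie_superalgebra k)
    (h : lie_subsuperalgebra g) :=
  GRing.isSubmodClosed.Build k g (lie_sub_mem h) (lie_sub_submod h).

Section SubLie.
Variables (k : fieldType) (g : lie_superalgebra k) (h : lie_subsuperalgebra g).

Definition sub_lie_sort := {x : g | x \in lie_sub_mem h}.
HB.instance Definition _ := SubChoice.on sub_lie_sort.
HB.instance Definition _ :=
  GRing.SubChoice_isSubLmodule.Build k g (lie_sub_mem h) sub_lie_sort
    (lie_sub_submod h).

Definition sub_lie_part (a : bool) (x : sub_lie_sort) : sub_lie_sort :=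
  Sub (part a (val x)) (lie_sub_part a (valP x)).

Definition sub_lie_br (x y : sub_lie_sort) : sub_lie_sort :=
  Sub (br (val x) (val y)) (lie_sub_br (valP x) (valP y)).

Lemma sub_lie_part_linear a : linear (sub_lie_part a).
Proof. by move=> c x y; apply: val_inj; rewrite !linearP /= linearP. Qed.

Lemma sub_lie_part_part a b v : sub_lie_part a (sub_lie_part b v) =
  if a == b then sub_lie_part b v else 0.
Proof.
by apply: val_inj; rewrite /= part_part; case: eqP => //= _; rewrite linear0.
Qed.

Lemma sub_lie_part_sum v : sub_lie_part false v + sub_lie_part true v = v.
Proof. by apply: val_inj; rewrite linearD /= part_sum. Qed.

Definition sub_lie_space : superspace k :=
  Superspace sub_lie_part_linear sub_lie_part_part sub_lie_part_sum.

Lemma sub_lie_homog a (x : sub_lie_space) : homog a x <-> homog a (val x).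
Proof. by split=> [<-|hx]; [exact: homog_part | exact: val_inj]. Qed.

Definition sub_lie : lie_superalgebra k.
Proof.
apply: (@LieSuperalgebra k sub_lie_space sub_lie_br).
- by move=> y c x z; apply: val_inj; rewrite /= br_linearl.
- by move=> y c x z; apply: val_inj; rewrite /= br_linearr.
- by move=> a b x y /sub_lie_homog hx /sub_lie_homog hy; apply/sub_lie_homog;
     exact: br_homog.
- move=> a b x y /sub_lie_homog hx /sub_lie_homog hy; apply: val_inj.
  by rewrite /= (br_skew hx hy).
- move=> a b x y z /sub_lie_homog hx /sub_lie_homog hy; apply: val_inj.
  by rewrite /= (br_jacobi _ hx hy).
- move=> x /sub_lie_homog hx; apply: val_inj.
  by rewrite /= br_cube.
Defined.

End SubLie.

Record rep (k : fieldType) (L : lie_superalgebra k) := Rep {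
  rep_space :> superspace k;
  act : L -> rep_space -> rep_space;
  act_linearl : forall v, linear (act^~ v);
  act_linearr : forall x, linear (act x);
  act_homog : forall a b x v,
    homog a x -> homog b v -> homog (a (+) b) (act x v);
  act_br : forall a b x y v, homog a x -> homog b y ->
    act (br x y) v = act x (act y v) - (-1) ^+ (a && b) *: act y (act x v) }.
Arguments act {k L r} x v.

HB.instance Definition _ (k : fieldType) (L : lie_superalgebra k) (V : rep L)
    (x : L) :=
  GRing.isLinear.Build k V V *:%R (@act k L V x) (@act_linearr k L V x).

(* The change of parity functor.  The operators of the representation
   are unchanged; the other usual choice, with the sign (-1)^{|x|},
   gives an isomorphic representation. *)
Section Parity.
Variable k : fieldType.

Section Space.
Variable V : superspace k.
Definition parity_part (a : bool) : V -> V := part (~~ a).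

Lemma parity_part_part a b v :
  parity_part a (parity_part b v) = if a == b then parity_part b v else 0.
Proof. by rewrite /parity_part part_part (inj_eq negb_inj). Qed.

Lemma parity_part_sum v : parity_part false v + parity_part true v = v.
Proof. by rewrite addrC part_sum. Qed.

Definition parity_space : superspace k :=
  Superspace (fun a => part_linear (~~ a)) parity_part_part parity_part_sum.
End Space.

Lemma parity_homog (V : superspace k) a (v : V) :
  @homog k (parity_space V) a v <-> homog (~~ a) v.
Proof. by []. Qed.

Variables (L : lie_superalgebra k) (V : rep L).

Lemma parity_act_homog a b x (v : parity_space V) :
  homog a x -> homog b v -> homog (a (+) b) (act x (v : V) : parity_space V).
Proof.
by move=> hx hv; apply/parity_homog; rewrite -addbN; exact: act_homog.
Qed.

Definition parity_rep : rep L :=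
  @Rep k L (parity_space V) (fun x v => act x (v : V))
    (@act_linearl k L V) (@act_linearr k L V) parity_act_homog (@act_br k L V).
End Parity.

Record lie_character (k : fieldType) (L : lie_superalgebra k) := LieCharacter {
  character_fun :> L -> k;
  character_linear : linear (character_fun : L -> k^o);
  character_odd : forall x, homog true x -> character_fun x = 0;
  character_br : forall x y, character_fun (br x y) = 0 }.

Section CharacterRep.
Variable k : fieldType.

Definition line_part (a : bool) (v : k^o) : k^o := if a then 0 else v.

Lemma line_part_linear a : linear (line_part a).
Proof. by case: a => c u v //=; rewrite scaler0 addr0. Qed.

Lemma line_part_part a b v :
  line_part a (line_part b v) = if a == b then line_part b v else 0.
Proof. by case: a; case: b. Qed.

Lemma line_part_sum v : line_part false v + line_part true v = v.
Proof. exact: addr0. Qed.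

Definition line : superspace k :=
  Superspace line_part_linear line_part_part line_part_sum.

Variables (L : lie_superalgebra k) (chi : lie_character L).

Definition character_act (x : L) (v : line) : line := chi x *: v.

Lemma character_act_homog a b x v :
  homog a x -> homog b v -> homog (a (+) b) (character_act x v).
Proof.
case: a => hx hv; last exact: homogZ.
by rewrite /character_act (character_odd chi hx) scale0r; exact: homog0.
Qed.

Lemma character_act_br a b x y v : homog a x -> homog b y ->
  character_act (br x y) v = character_act x (character_act y v) -
    (-1) ^+ (a && b) *: character_act y (character_act x v).
Proof.
rewrite /character_act character_br scale0r => hx hy.
case: a hx => hx.
  by rewrite (character_odd chi hx) !scale0r !scaler0 subr0.
by rewrite /= expr0 scale1r !scalerA [chi y * _]mulrC subrr.
Qed.

Definition character_rep : rep L.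
Proof.
apply: (@Rep k L line character_act) character_act_homog character_act_br.
- by move=> v c x y; rewrite /character_act character_linear scalerDl scalerA.
- by move=> x c u v; rewrite /character_act scalerDr !scalerA [c * _]mulrC.
Defined.

End CharacterRep.

(* The contragredient representation: (x . f)(v) = - (-1)^{|x||f|} f (x . v). *)
Section Contragredient.
Variable k : fieldType.

Section DualSpace.
Variable V : superspace k.

Definition is_linear_form : {pred (V -> k^o)} :=
  fun f => `[< linear f >].

Lemma is_linear_formP (f : V -> k^o) : reflect (linear f) (f \in is_linear_form).
Proof. exact: asboolP. Qed.

Lemma is_linear_form_closed : subsemimod_closed is_linear_form.
Proof.
apply: GRing.submod_closed_semi; split.
  by apply/is_linear_formP => c u v; rewrite /= scaler0 addr0.
move=> a f g /is_linear_formP hf /is_linear_formP hg.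
apply/is_linear_formP => c u v /=.
rewrite [LHS]/(a *: f (c *: u + v) + g (c *: u + v)) hf hg.
rewrite [RHS]/(c *: (a *: f u + g u) + (a *: f v + g v)).
rewrite !scalerDr !scalerA [a * c]mulrC; exact: addrACA.
Qed.

HB.instance Definition _ :=
  GRing.isSubmodClosed.Build k (V -> k^o) is_linear_form is_linear_form_closed.

Definition dual_sort := {f : V -> k^o | f \in is_linear_form}.
HB.instance Definition _ := SubChoice.on dual_sort.
HB.instance Definition _ :=
  GRing.SubChoice_isSubLmodule.Build k (V -> k^o) is_linear_form dual_sort
    is_linear_form_closed.

Definition dual_fun (f : dual_sort) : V -> k^o := val f.
Coercion dual_fun : dual_sort >-> Funclass.

Lemma dual_linear (f : dual_sort) : linear f.
Proof. exact/is_linear_formP/valP. Qed.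
HB.instance Definition _ (f : dual_sort) :=
  GRing.isLinear.Build k V k^o *:%R (dual_fun f) (dual_linear f).

Lemma dual_eqP (f g : dual_sort) : f =1 g -> f = g.
Proof. by move=> fg; apply/val_inj/funext. Qed.

Lemma dual_precomp_subproof (f : dual_sort) (phi : V -> V) : linear phi ->
  (f \o phi) \in is_linear_form.
Proof.
by move=> hphi; apply/is_linear_formP => c u v; rewrite /= hphi dual_linear.
Qed.

Definition dual_precomp (phi : V -> V) (hphi : linear phi) (f : dual_sort) :
  dual_sort := Sub (f \o phi) (dual_precomp_subproof f hphi).

Lemma dual_precompE phi (hphi : linear phi) f v :
  dual_precomp hphi f v = f (phi v).
Proof. by []. Qed.

Definition dual_part (a : bool) : dual_sort -> dual_sort :=
  dual_precomp (part_linear a).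

Lemma dual_part_linear a : linear (dual_part a).
Proof. by move=> c f g; exact: dual_eqP. Qed.

Lemma dual_part_part a b f :
  dual_part a (dual_part b f) = if a == b then dual_part b f else 0.
Proof.
apply: dual_eqP => v; rewrite !dual_precompE part_part eq_sym.
by case: eqP => [<-|_]; rewrite ?dual_precompE ?linear0.
Qed.

Lemma dual_part_sum f : dual_part false f + dual_part true f = f.
Proof.
apply: dual_eqP => v; rewrite -[in RHS](part_sum v).
by rewrite [RHS]linearD.
Qed.

Definition dual_space : superspace k :=
  Superspace dual_part_linear dual_part_part dual_part_sum.
End DualSpace.

Variables (L : lie_superalgebra k) (V : rep L).

Definition dual_act : L -> dual_space V -> dual_space V :=
  koszul (fun x (f : dual_space V) =>
            - dual_precomp (act_linearr x) f : dual_space V).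

Let dual_act1_linear x :
  linear (fun f : dual_space V => - dual_precomp (act_linearr x) f : dual_space V).
Proof. by move=> c f g; rewrite scalerN -opprD; congr (- _); exact: dual_eqP. Qed.

Let dual_act1_linearl (f : dual_space V) :
  linear (fun x => - dual_precomp (act_linearr x) f : dual_space V).
Proof.
move=> c x y; rewrite scalerN -opprD; congr (- _); apply: dual_eqP => v.
by rewrite dual_precompE act_linearl dual_linear.
Qed.

Local Notation ev f := (dual_fun (f : dual_sort V)).

Lemma dual_actE a b x (f : dual_space V) v : homog a x -> homog b f ->
  ev (dual_act x f) v = - (-1) ^+ (a && b) * ev f (act x v).
Proof.
move=> hx hf.
rewrite /dual_act (koszulE dual_act1_linear dual_act1_linearl hx hf).
by rewrite scalerN mulNr.
Qed.

Lemma dual_homogP a (f : dual_space V) :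
  homog a f <-> forall b v, homog b v -> a != b -> ev f v = 0.
Proof.
split=> [<- b v hv ab|hf].
  by rewrite dual_precompE (part_homog _ hv) (negPf ab) linear0.
apply: dual_eqP => v; rewrite [LHS]/(ev f (part a v)).
have -> : ev f v = ev f (part false v) + ev f (part true v).
  by rewrite -linearD part_sum.
case: a hf => hf.
  by rewrite (hf false (part false v) (homog_part _ _)) ?add0r.
by rewrite (hf true (part true v) (homog_part _ _)) ?addr0.
Qed.

Lemma dual_act_homog a b x f :
  homog a x -> homog b f -> homog (a (+) b) (dual_act x f).
Proof.
move=> hx hf; apply/dual_homogP => c v hv.
rewrite (dual_actE _ hx hf) => ne.
rewrite (proj1 (dual_homogP _ _) hf (a (+) c)) ?mulr0 //.
  exact: act_homog.
by apply: contraNneq ne => ->; rewrite addbA addbb.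
Qed.

Lemma dual_act_br a b x y f : homog a x -> homog b y ->
  dual_act (br x y) f =
    dual_act x (dual_act y f) - (-1) ^+ (a && b) *: dual_act y (dual_act x f).
Proof.
move=> hx hy; move: f.
have lin := koszul_linear dual_act1_linear.
apply: linear_homog_ext => [||c f hf]; first exact: lin.
  move=> c f g; rewrite /dual_act !lin.
  rewrite !scalerDr !scalerN !scalerA opprD [c * _]mulrC; exact: addrACA.
apply: dual_eqP => v; rewrite (dual_actE _ (br_homog hx hy) hf).
rewrite [RHS]/(ev (dual_act x (dual_act y f)) v -
   (-1) ^+ (a && b) * ev (dual_act y (dual_act x f)) v).
rewrite (dual_actE _ hx (dual_act_homog hy hf)).
rewrite (dual_actE _ hy (dual_act_homog hx hf)).
rewrite (dual_actE _ hx hf) (dual_actE _ hy hf) (act_br _ hx hy).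
have -> u w : ev f (u - (-1) ^+ (a && b) *: w) =
    ev f u - (-1) ^+ (a && b) * ev f w by rewrite linearB linearZ.
suff signs (s t : k) : - (-1) ^+ ((a (+) b) && c) * (s - (-1) ^+ (a && b) * t) =
    - (-1) ^+ (a && (b (+) c)) * (- (-1) ^+ (b && c) * t) -
    (-1) ^+ (a && b) * (- (-1) ^+ (b && (a (+) c)) * (- (-1) ^+ (a && c) * s)).
  exact: signs.
by clear; case: a b c => [] [] []; rewrite /= ?expr0 ?expr1; ring.
Qed.

Definition contragredient : rep L :=
  @Rep k L (dual_space V) dual_act
    (koszul_linearl dual_act1_linearl)
    (koszul_linear dual_act1_linear)
    dual_act_homog dual_act_br.

End Contragredient.

Section Quotient.
Variables (k : fieldType) (g : lie_superalgebra k) (h : lie_subsuperalgebra g).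

Definition lie_quot_sort := Quotient.quot (lie_sub_mem h).
HB.instance Definition _ := GRing.Zmodule.on lie_quot_sort.

Definition lie_quot_pi (x : g) : lie_quot_sort := \pi x.

Lemma lie_quot_eqP x y : lie_quot_pi x = lie_quot_pi y <-> x - y \in lie_sub_mem h.
Proof.
split=> [e|e]; first by rewrite Quotient.idealrBE; apply/eqP.
by apply/eqP; rewrite -[_ == _]Quotient.idealrBE.
Qed.

Lemma lie_quot_piD x y : lie_quot_pi (x + y) = lie_quot_pi x + lie_quot_pi y.
Proof. exact: (raddfD (\pi_(Quotient.quot (lie_sub_mem h)))). Qed.

Lemma lie_quot_ind (P : lie_quot_sort -> Prop) :
  (forall x, P (lie_quot_pi x)) -> forall q, P q.
Proof. by move=> hP q; rewrite -[q]reprK; exact: hP. Qed.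

(* Maps induced on g/h by the linear endomorphisms of g which preserve h. *)
Definition lie_quot_map (phi : g -> g) (q : lie_quot_sort) : lie_quot_sort :=
  lie_quot_pi (phi (repr q)).

Lemma lie_quot_mapE (phi : g -> g) : linear phi ->
  (forall x, x \in lie_sub_mem h -> phi x \in lie_sub_mem h) ->
  forall x, lie_quot_map phi (lie_quot_pi x) = lie_quot_pi (phi x).
Proof.
move=> hphi hh x; apply/lie_quot_eqP.
have := hphi (-1) x (repr (lie_quot_pi x)); rewrite !scaleN1r addrC => e.
have {}e : phi (repr (lie_quot_pi x)) - phi x = phi (repr (lie_quot_pi x) - x).
  by rewrite [in RHS]addrC e.
by rewrite e; apply: hh; apply/lie_quot_eqP; exact: reprK.
Qed.

Definition lie_quot_scale (c : k) := lie_quot_map ( *:%R c).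

Lemma lie_quot_scaleE c x : lie_quot_scale c (lie_quot_pi x) = lie_quot_pi (c *: x).
Proof.
apply: lie_quot_mapE => [a u v|y hy]; last exact: rpredZ.
by rewrite scalerDr !scalerA mulrC.
Qed.

Fact lie_quot_scaleA a b v :
  lie_quot_scale a (lie_quot_scale b v) = lie_quot_scale (a * b) v.
Proof. by elim/lie_quot_ind: v => x; rewrite !lie_quot_scaleE scalerA. Qed.
Fact lie_quot_scale1 : left_id 1 lie_quot_scale.
Proof. by elim/lie_quot_ind=> x; rewrite lie_quot_scaleE scale1r. Qed.
Fact lie_quot_scaleDr : right_distributive lie_quot_scale +%R.
Proof.
move=> c; elim/lie_quot_ind=> x; elim/lie_quot_ind=> y.
by rewrite -lie_quot_piD !lie_quot_scaleE scalerDr lie_quot_piD.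
Qed.
Fact lie_quot_scaleDl v : {morph lie_quot_scale^~ v : a b / a + b}.
Proof.
elim/lie_quot_ind: v => x a b.
by rewrite !lie_quot_scaleE scalerDl lie_quot_piD.
Qed.
HB.instance Definition _ := GRing.Zmodule_isLmodule.Build k lie_quot_sort
  lie_quot_scaleA lie_quot_scale1 lie_quot_scaleDr lie_quot_scaleDl.

Lemma lie_quot_pi_linear : linear lie_quot_pi.
Proof. by move=> c x y; rewrite lie_quot_piD -lie_quot_scaleE. Qed.
HB.instance Definition _ :=
  GRing.isLinear.Build k g lie_quot_sort *:%R lie_quot_pi lie_quot_pi_linear.

Lemma lie_quot_map_linear (phi : g -> g) : linear phi ->
  (forall x, x \in lie_sub_mem h -> phi x \in lie_sub_mem h) ->
  linear (lie_quot_map phi).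
Proof.
move=> hphi hh c; elim/lie_quot_ind=> x; elim/lie_quot_ind=> y.
by rewrite -lie_quot_pi_linear !lie_quot_mapE // hphi lie_quot_pi_linear.
Qed.

Definition lie_quot_part (a : bool) := lie_quot_map (part a).

Lemma lie_quot_partE a x : lie_quot_part a (lie_quot_pi x) = lie_quot_pi (part a x).
Proof. exact: lie_quot_mapE (part_linear a) (lie_sub_part a) x. Qed.

Lemma lie_quot_part_linear a : linear (lie_quot_part a).
Proof. exact: lie_quot_map_linear (part_linear a) (lie_sub_part a). Qed.

Lemma lie_quot_part_part a b v : lie_quot_part a (lie_quot_part b v) =
  if a == b then lie_quot_part b v else 0.
Proof.
elim/lie_quot_ind: v => x; rewrite !lie_quot_partE part_part.
by case: eqP => // _; rewrite linear0.
Qed.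

Lemma lie_quot_part_sum v : lie_quot_part false v + lie_quot_part true v = v.
Proof.
by elim/lie_quot_ind: v => x; rewrite !lie_quot_partE -linearD part_sum.
Qed.

Definition lie_quot : superspace k :=
  Superspace lie_quot_part_linear lie_quot_part_part lie_quot_part_sum.

Lemma lie_quot_homogP a (q : lie_quot) :
  homog a q -> exists2 x, homog a x & q = lie_quot_pi x.
Proof.
move: q; elim/lie_quot_ind => x hx; exists (part a x); first exact: homog_part.
by rewrite -lie_quot_partE; exact/esym.
Qed.

Definition ad_quot_act (x : sub_lie h) : lie_quot -> lie_quot :=
  lie_quot_map (br (val x)).

Lemma ad_quot_actE (x : sub_lie h) y :
  ad_quot_act x (lie_quot_pi y) = lie_quot_pi (br (val x) y).
Proof.
by apply: lie_quot_mapE (br_linearr _) _ y => y hy; exact: lie_sub_br (valP x) hy.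
Qed.

Lemma ad_quot_act_homog a b x v :
  homog a x -> homog b v -> homog (a (+) b) (ad_quot_act x v).
Proof.
move=> /sub_lie_homog hx /lie_quot_homogP[y hy ->].
rewrite ad_quot_actE /homog /= lie_quot_partE; congr lie_quot_pi.
exact: br_homog.
Qed.

Lemma ad_quot_act_br a b x y v : homog a x -> homog b y ->
  ad_quot_act (br x y) v = ad_quot_act x (ad_quot_act y v) -
    (-1) ^+ (a && b) *: ad_quot_act y (ad_quot_act x v).
Proof.
move=> /sub_lie_homog hx /sub_lie_homog hy; elim/lie_quot_ind: v => z.
rewrite !ad_quot_actE -linearZ -linearB (br_jacobi _ hx hy) addrK.
by [].
Qed.

Definition ad_quot : rep (sub_lie h).
Proof.
apply: (@Rep k _ lie_quot ad_quot_act) ad_quot_act_homog ad_quot_act_br.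
- move=> v c x y; elim/lie_quot_ind: v => z.
  by rewrite !ad_quot_actE -linearP /= br_linearl.
- move=> x; apply: lie_quot_map_linear (br_linearr _) _ => y hy.
  exact: lie_sub_br (valP x) hy.
Defined.

End Quotient.

Definition has_dim (k : fieldType) (W : lmodType k) (n : nat) : Prop :=
  inhabited (Vector.axiom n W).

Definition finite_dim (k : fieldType) (W : lmodType k) : Prop :=
  exists n, has_dim W n.

Section Component.
Variables (k : fieldType) (V : superspace k) (a : bool).

Definition is_homog : {pred V} := fun v => part a v == v.

Lemma is_homog_closed : subsemimod_closed is_homog.
Proof.
apply: GRing.submod_closed_semi; split; first exact/eqP/homog0.
by move=> c u v /eqP hu /eqP hv; exact/eqP/homogP.
Qed.
HB.instance Definition _ :=
  GRing.isSubmodClosed.Build k V is_homog is_homog_closed.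

Definition component := {v : V | v \in is_homog}.
HB.instance Definition _ := SubChoice.on component.
HB.instance Definition _ :=
  GRing.SubChoice_isSubLmodule.Build k V is_homog component is_homog_closed.
End Component.
Arguments component {k} V a.

Lemma mul_rV_linear (k : fieldType) n (F : 'rV[k]_n -> 'rV[k]_n) u :
  linear F -> u *m lin1_mx F = F u.
Proof.
move=> hF; pose mF := GRing.isLinear.Build k _ _ *:%R F hF.
pose lF : {linear 'rV[k]_n -> 'rV[k]_n} :=
  HB.pack_for {linear 'rV[k]_n -> 'rV[k]_n} F mF.
exact: (mul_rV_lin1 lF).
Qed.

Section Trace.
Variables (k : fieldType) (W : lmodType k).

Definition coordinates := {n : nat & Vector.axiom n W}.

Lemma coordinates_inverse (e : coordinates) :
  exists r2v, cancel (s2val (projT2 e)) r2v /\ cancel r2v (s2val (projT2 e)).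
Proof. by case: e => n [v2r lin [r2v h1 h2]]; exists r2v. Qed.

Definition trace_in (e : coordinates) (f : W -> W) : k :=
  \tr (lin1_mx (s2val (projT2 e) \o f \o sval (cid (coordinates_inverse e)))).

(* The trace of a linear endomorphism, computed in some coordinates; it
   is 0 by convention when W is not finite dimensional. *)
Definition trace (f : W -> W) : k :=
  if pselect (exists e : coordinates, True) is left ex
  then trace_in (sval (cid ex)) f else 0.

Lemma trace_linear_comb c (f f1 f2 : W -> W) :
  (forall v, f v = c *: f1 v + f2 v) -> trace f = c * trace f1 + trace f2.
Proof.
move=> hf; rewrite /trace; case: pselect => [ex|_]; last by rewrite mulr0 addr0.
rewrite /trace_in; move: (sval (cid ex)) => e; move: (cid _) => [r2v /= _].
rewrite -mxtraceZ -mxtraceD; congr (\tr _); apply/matrixP => i j.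
rewrite !mxE /= hf (s2valP (projT2 e)).
by rewrite !mxE.
Qed.

Lemma trace_comm (f1 f2 : W -> W) : linear f1 -> linear f2 ->
  trace (f1 \o f2) = trace (f2 \o f1).
Proof.
move=> h1 h2; rewrite /trace; case: pselect => // ex.
rewrite /trace_in; move: (sval (cid ex)) => e; move: (cid _) => [r2v /= [K1 K2]].
case: e r2v K1 K2 => n [v2r lin bij] /= r2v K1 K2.
have linr : linear r2v.
  by move=> c u v; rewrite -[u in LHS]K2 -[v in LHS]K2 -lin K1.
pose F (f : W -> W) := v2r \o f \o r2v.
have linF f : linear f -> linear (F f).
  by move=> hf c u v; rewrite /F /= linr hf lin.
have mulF f f' : linear f -> linear f' ->
    lin1_mx (F (f \o f')) = lin1_mx (F f') *m lin1_mx (F f).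
  move=> hf hf'; apply/row_matrixP => i; rewrite row_mul !rowE.
  rewrite !mul_rV_linear; first by rewrite /= /F /= K1.
  - exact: linF.
  - exact: linF.
  by apply: linF => c u v; rewrite /= hf' hf.
rewrite -/(F (f1 \o f2)) -/(F (f2 \o f1)) (mulF _ _ h1 h2) (mulF _ _ h2 h1).
exact: mxtrace_mulC.
Qed.

End Trace.

Definition supertrace (k : fieldType) (W : superspace k) (f : W -> W) : k :=
  trace (part false \o f) - trace (part true \o f).

Section Strad.
Variables (k : fieldType) (L : lie_superalgebra k) (W : rep L).

Definition rep_str (x : L) : k := supertrace (@act k L W x).

Lemma act_part a b (x : L) (w : W) :
  homog a x -> part b (act x w) = act x (part (a (+) b) w).
Proof.
move=> hx; move: w; apply: linear_homog_ext => [c u v|c u v|c w hw].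
- by rewrite !act_linearr part_linear.
- by rewrite part_linear act_linearr.
rewrite (part_homog _ hw) (part_homog _ (act_homog hx hw)).
have -> : (b == a (+) c) = (a (+) b == c) by case: a b c {hx hw} => [] [] [].
by case: eqP => // _; rewrite linear0.
Qed.

Lemma rep_str_linear : linear (rep_str : L -> k^o).
Proof.
move=> c x y; rewrite /rep_str /supertrace.
have E a : trace (part a \o @act k L W (c *: x + y)) =
    c * trace (part a \o @act k L W x) + trace (part a \o @act k L W y).
  by apply: trace_linear_comb => v; rewrite /= act_linearl part_linear.
rewrite !E opprD addrACA; congr (_ + _); exact/esym/mulrBr.
Qed.

Lemma trace_part_comm a b x (f : W -> W) : linear f -> homog a x ->
  trace (part b \o (@act k L W x) \o f) = trace (part (a (+) b) \o f \o act x).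
Proof.
move=> hf hx.
have -> : part b \o act x \o f = act x \o (part (a (+) b) \o f).
  by apply/funext => v; rewrite /= (act_part _ _ hx).
rewrite trace_comm //; first exact: act_linearr.
by move=> c u v; rewrite /= hf part_linear.
Qed.

Lemma rep_str_odd x : homog true x -> rep_str x = 0.
Proof.
move=> hx; suff tr0 a : trace (part a \o @act k L W x) = 0.
  by rewrite /rep_str /supertrace !tr0 subr0.
have -> : part a \o @act k L W x = part a \o (part a \o act x).
  by apply/funext => v; rewrite /= part_part eqxx.
rewrite trace_comm; first last.
- by move=> c u v; rewrite /= act_linearr part_linear.
- exact: part_linear.
set z := (X in trace X); have z0 v : z v = 0.
  by rewrite /z /= (act_part _ _ hx) part_part; case: (a); rewrite linear0.
rewrite (@trace_linear_comb _ _ (-1) z z z) ?mulN1r ?addNr // => v.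
by rewrite z0 scaler0 addr0.
Qed.

Lemma rep_str_br x y : rep_str (br x y) = 0.
Proof.
have lin0 (Z : superspace k) : linear (fun _ : Z => 0 : k^o).
  by move=> c u v; rewrite scaler0 addr0.
move: x; apply: (@linear_homog_ext _ _ k^o (fun x => rep_str (br x y)) (fun=> 0)).
- by move=> c u v; rewrite br_linearl rep_str_linear.
- exact: lin0.
move=> a x hx; move: y.
apply: (@linear_homog_ext _ _ k^o (fun y => rep_str (br x y)) (fun=> 0)).
- by move=> c u v; rewrite br_linearr rep_str_linear.
- exact: lin0.
move=> b y hy.
have [ab|nab] := eqVneq a b; last first.
  apply: rep_str_odd; have := br_homog hx hy.
  by have -> : a (+) b = true by case: a b nab {hx hy} => [] [].
pose T c := trace (part c \o @act k L W y \o act x).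
have E c : trace (part c \o @act k L W (br x y)) =
    - (-1) ^+ (a && b) * T c + T (a (+) c).
  rewrite -[T (a (+) c)](trace_part_comm c (act_linearr y) hx).
  apply: trace_linear_comb => v /=.
  by rewrite (act_br _ hx hy) addrC linearD linearN linearZ /= scaleNr.
rewrite /rep_str /supertrace !E -ab.
by case: a {ab hx hy E} => /=; rewrite ?expr0 ?expr1; ring.
Qed.

(* The character x |-> - str (act x). *)
Definition neg_str_character : lie_character L.
Proof.
apply: (@LieCharacter k L (fun x => - rep_str x)).
- move=> c x y; rewrite rep_str_linear opprD; congr (_ + _); exact/esym/scalerN.
- by move=> x hx; rewrite rep_str_odd ?oppr0.
- by move=> x y; rewrite rep_str_br oppr0.
Defined.

End Strad.

(* V (x) W is the k-vector space generated by the symbols v (x) w,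
   subject to bilinearity: formal linear combinations of symbols,
   modulo the congruence generated by the vector space axioms and by
   bilinearity. *)
Section Tensor.
Variable k : fieldType.

Inductive tensor_term (V W : lmodType k) : Type :=
  | TPure of V & W
  | TZero
  | TAdd of tensor_term V W & tensor_term V W
  | TScale of k & tensor_term V W.
Arguments TZero {V W}.

Inductive tensor_eq (V W : lmodType k) :
    tensor_term V W -> tensor_term V W -> Prop :=
  | tensor_refl s : tensor_eq s s
  | tensor_sym s t : tensor_eq s t -> tensor_eq t s
  | tensor_trans s t u : tensor_eq s t -> tensor_eq t u -> tensor_eq s u
  | tensor_congD s s' t t' : tensor_eq s s' -> tensor_eq t t' ->
      tensor_eq (TAdd s t) (TAdd s' t')
  | tensor_congZ c s s' : tensor_eq s s' ->
      tensor_eq (TScale c s) (TScale c s')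
  | tensor_addA s t u :
      tensor_eq (TAdd s (TAdd t u)) (TAdd (TAdd s t) u)
  | tensor_addC s t : tensor_eq (TAdd s t) (TAdd t s)
  | tensor_add0 s : tensor_eq (TAdd TZero s) s
  | tensor_scale0 s : tensor_eq (TScale 0 s) TZero
  | tensor_scale1 s : tensor_eq (TScale 1 s) s
  | tensor_scaleA a b s :
      tensor_eq (TScale a (TScale b s)) (TScale (a * b) s)
  | tensor_scaleDr a s t :
      tensor_eq (TScale a (TAdd s t)) (TAdd (TScale a s) (TScale a t))
  | tensor_scaleDl a b s :
      tensor_eq (TScale (a + b) s) (TAdd (TScale a s) (TScale b s))
  | tensor_linl c v v' w :
      tensor_eq (TPure (c *: v + v') w) (TAdd (TScale c (TPure v w)) (TPure v' w))
  | tensor_linr c v w w' :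
      tensor_eq (TPure v (c *: w + w')) (TAdd (TScale c (TPure v w)) (TPure v w')).

HB.instance Definition _ (V W : lmodType k) := gen_eqMixin (tensor_term V W).
HB.instance Definition _ (V W : lmodType k) := gen_choiceMixin (tensor_term V W).

Section Quotient.
Variables V W : lmodType k.

Definition tensor_rel : rel (tensor_term V W) := fun s t => `[< tensor_eq s t >].

Lemma tensor_rel_equiv : equiv_class_of tensor_rel.
Proof.
split=> [s|s t|t s u].
- exact/asboolP/tensor_refl.
- by apply/asboolP/asboolP; exact: tensor_sym.
- by move=> /asboolP st /asboolP tu; apply/asboolP; exact: tensor_trans st tu.
Qed.
Canonical tensor_rel_canonical := EquivRelPack tensor_rel_equiv.

Definition tensor_sort := {eq_quot tensor_rel}.
HB.instance Definition _ := Choice.on tensor_sort.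

Definition tensor_pi (s : tensor_term V W) : tensor_sort := \pi s.

Lemma tensor_piP s t : tensor_pi s = tensor_pi t <-> tensor_eq s t.
Proof.
split=> [st|st]; first by apply/asboolP; move/eqmodP: st.
by apply/eqmodP/asboolP.
Qed.

Lemma tensor_repr s : tensor_eq (repr (tensor_pi s)) s.
Proof. by apply/tensor_piP; exact: reprK. Qed.

Lemma tensor_sort_ind (P : tensor_sort -> Prop) :
  (forall s, P (tensor_pi s)) -> forall t, P t.
Proof. by move=> hP t; rewrite -[t]reprK; exact: hP. Qed.

Definition tensor_add (s t : tensor_sort) := tensor_pi (TAdd (repr s) (repr t)).
Definition tensor_scale c (s : tensor_sort) := tensor_pi (TScale c (repr s)).

Lemma tensor_addE s t :
  tensor_add (tensor_pi s) (tensor_pi t) = tensor_pi (TAdd s t).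
Proof. by apply/tensor_piP/tensor_congD; exact: tensor_repr. Qed.

Lemma tensor_scaleE c s : tensor_scale c (tensor_pi s) = tensor_pi (TScale c s).
Proof. by apply/tensor_piP/tensor_congZ; exact: tensor_repr. Qed.

Fact tensor_addqA : associative tensor_add.
Proof.
elim/tensor_sort_ind=> s; elim/tensor_sort_ind=> t; elim/tensor_sort_ind=> u.
by rewrite !tensor_addE; exact/tensor_piP/tensor_addA.
Qed.
Fact tensor_addqC : commutative tensor_add.
Proof.
elim/tensor_sort_ind=> s; elim/tensor_sort_ind=> t.
by rewrite !tensor_addE; exact/tensor_piP/tensor_addC.
Qed.
Fact tensor_addq0 : left_id (tensor_pi TZero) tensor_add.
Proof. by elim/tensor_sort_ind=> s; rewrite tensor_addE; exact/tensor_piP/tensor_add0. Qed.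
HB.instance Definition _ :=
  GRing.isNmodule.Build tensor_sort tensor_addqA tensor_addqC tensor_addq0.

Fact tensor_scaleqA a b s :
  tensor_scale a (tensor_scale b s) = tensor_scale (a * b) s.
Proof.
by elim/tensor_sort_ind: s => s; rewrite !tensor_scaleE; exact/tensor_piP/tensor_scaleA.
Qed.
Fact tensor_scaleq0 s : tensor_scale 0 s = 0.
Proof.
by elim/tensor_sort_ind: s => s; rewrite !tensor_scaleE; exact/tensor_piP/tensor_scale0.
Qed.
Fact tensor_scaleq1 : left_id 1 tensor_scale.
Proof.
by elim/tensor_sort_ind=> s; rewrite !tensor_scaleE; exact/tensor_piP/tensor_scale1.
Qed.
Fact tensor_scaleqDr : right_distributive tensor_scale +%R.
Proof.
move=> a; elim/tensor_sort_ind=> s; elim/tensor_sort_ind=> t.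
rewrite -[_ + _]/(tensor_add _ _) -[RHS]/(tensor_add _ _).
by rewrite !(tensor_addE, tensor_scaleE); exact/tensor_piP/tensor_scaleDr.
Qed.
Fact tensor_scaleqDl s : {morph tensor_scale^~ s : a b / a + b}.
Proof.
elim/tensor_sort_ind: s => s a b; rewrite -[RHS]/(tensor_add _ _).
by rewrite !(tensor_addE, tensor_scaleE); exact/tensor_piP/tensor_scaleDl.
Qed.
HB.instance Definition _ := GRing.Nmodule_isLSemiModule.Build k tensor_sort
  tensor_scaleqA tensor_scaleq0 tensor_scaleq1 tensor_scaleqDr tensor_scaleqDl.
HB.instance Definition _ := GRing.LSemiModule_isLmodule.Build k tensor_sort.

Definition pure (v : V) (w : W) : tensor_sort := tensor_pi (TPure v w).

Lemma tensor_piD s t : tensor_pi (TAdd s t) = tensor_pi s + tensor_pi t.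
Proof. by rewrite -tensor_addE. Qed.
Lemma tensor_piZ c s : tensor_pi (TScale c s) = c *: tensor_pi s.
Proof. by rewrite -tensor_scaleE. Qed.

Lemma pure_linearl w : linear (pure^~ w).
Proof.
by move=> c v v'; rewrite -tensor_piZ -tensor_piD; exact/tensor_piP/tensor_linl.
Qed.
Lemma pure_linearr v : linear (pure v).
Proof.
by move=> c w w'; rewrite -tensor_piZ -tensor_piD; exact/tensor_piP/tensor_linr.
Qed.

Section Lift.
Variables (Z : lmodType k) (F : V -> W -> Z).

Fixpoint tensor_term_lift (s : tensor_term V W) : Z :=
  match s with
  | TPure v w => F v w
  | TZero => 0
  | TAdd s t => tensor_term_lift s + tensor_term_lift t
  | TScale c s => c *: tensor_term_lift s
  end.

Definition tensor_lift (t : tensor_sort) : Z := tensor_term_lift (repr t).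

Hypothesis linFl : forall w, linear (F^~ w).
Hypothesis linFr : forall v, linear (F v).

Lemma tensor_term_lift_eq s t :
  tensor_eq s t -> tensor_term_lift s = tensor_term_lift t.
Proof.
elim=> //= {s t}.
- by move=> ? ? ? _ -> _ ->.
- by move=> ? ? ? ? _ -> _ ->.
- by move=> ? ? ? _ ->.
- by move=> *; rewrite addrA.
- by move=> *; rewrite addrC.
- by move=> *; rewrite add0r.
- by move=> *; rewrite scale0r.
- by move=> *; rewrite scale1r.
- by move=> *; rewrite scalerA.
- by move=> *; rewrite scalerDr.
- by move=> *; rewrite scalerDl.
- by move=> *; rewrite linFl.
- by move=> *; rewrite linFr.
Qed.

Lemma tensor_liftE s : tensor_lift (tensor_pi s) = tensor_term_lift s.
Proof. exact/tensor_term_lift_eq/tensor_repr. Qed.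

Lemma tensor_lift_pure v w : tensor_lift (pure v w) = F v w.
Proof. exact: tensor_liftE. Qed.

Lemma tensor_lift_linear : linear tensor_lift.
Proof.
move=> c; elim/tensor_sort_ind=> s; elim/tensor_sort_ind=> t.
by rewrite -tensor_piZ -tensor_piD !tensor_liftE.
Qed.
End Lift.

Lemma tensor_ext (Z : lmodType k) (f f' : tensor_sort -> Z) :
  linear f -> linear f' -> (forall v w, f (pure v w) = f' (pure v w)) -> f =1 f'.
Proof.
move=> lf lf' ff'; have f0 := linear_fun0 lf; have f'0 := linear_fun0 lf'.
elim/tensor_sort_ind; elim=> [v w||s es t et|c s es].
- exact: ff'.
- by rewrite -[tensor_pi _]/(0 : tensor_sort) f0 f'0.
- by rewrite tensor_piD -[tensor_pi s]scale1r lf lf' es et.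
- have {}lf := lf c (tensor_pi s) 0; have {}lf' := lf' c (tensor_pi s) 0.
  by rewrite tensor_piZ; move: lf lf'; rewrite addr0 f0 f'0 es => -> ->.
Qed.
End Quotient.

Section TensorSpace.
Variables V W : superspace k.

(* |v (x) w| = |v| + |w| *)
Definition tensor_part (a : bool) : tensor_sort V W -> tensor_sort V W :=
  tensor_lift (fun v w =>
    \sum_(b : bool) pure (part b v) (part (a (+) b) w)).

Let tensor_part1 a (v : V) (w : W) : tensor_sort V W :=
  \sum_(b : bool) pure (part b v) (part (a (+) b) w).

Let tensor_part1_linearl a w : linear ((tensor_part1 a)^~ w).
Proof.
move=> c v v'; rewrite /tensor_part1 scaler_sumr -big_split.
by apply: eq_bigr => b _; rewrite /= part_linear pure_linearl.
Qed.

Let tensor_part1_linearr a v : linear (tensor_part1 a v).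
Proof.
move=> c w w'; rewrite /tensor_part1 scaler_sumr -big_split.
by apply: eq_bigr => b _; rewrite /= part_linear pure_linearr.
Qed.

Lemma tensor_part_linear a : linear (tensor_part a).
Proof. exact: tensor_lift_linear (tensor_part1_linearl a) (tensor_part1_linearr a). Qed.

Lemma pure0l w : pure (0 : V) w = 0 :> tensor_sort V W.
Proof. exact: linear_fun0 (pure_linearl w). Qed.
Lemma pure0r v : pure v (0 : W) = 0 :> tensor_sort V W.
Proof. exact: linear_fun0 (pure_linearr v). Qed.

Lemma tensor_part_pure c a b v w : homog a v -> homog b w ->
  tensor_part c (pure v w) = if c == a (+) b then pure v w else 0.
Proof.
move=> hv hw.
rewrite [LHS](tensor_lift_pure (tensor_part1_linearl c) (tensor_part1_linearr c)).
rewrite /tensor_part1 big_bool !(part_homog _ hv) !(part_homog _ hw).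
by case: a b c {hv hw} => [] [] []; rewrite /= ?pure0l ?pure0r ?addr0 ?add0r.
Qed.

Lemma tensor_homog_ext (Z : lmodType k) (f f' : tensor_sort V W -> Z) :
  linear f -> linear f' ->
  (forall a b v w, homog a v -> homog b w -> f (pure v w) = f' (pure v w)) ->
  f =1 f'.
Proof.
move=> lf lf' ff'; apply: tensor_ext => // v w; move: v.
apply: linear_homog_ext => [c u v|c u v|a v hv].
- by rewrite pure_linearl lf.
- by rewrite pure_linearl lf'.
move: w; apply: linear_homog_ext => [c u w|c u w|b w hw].
- by rewrite pure_linearr lf.
- by rewrite pure_linearr lf'.
exact: ff' hv hw.
Qed.

Lemma tensor_part_part a b t :
  tensor_part a (tensor_part b t) = if a == b then tensor_part b t else 0.
Proof.
move: t; apply: tensor_homog_ext => [c u v|c u v|a' b' v w hv hw].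
- by rewrite !tensor_part_linear.
- by case: eqP => // _; rewrite ?tensor_part_linear // scaler0 addr0.
rewrite (tensor_part_pure b hv hw) [b == _]eq_sym.
case: eqP => [<-|_].
  by rewrite (tensor_part_pure a hv hw).
by rewrite (linear_fun0 (tensor_part_linear a)); case: ifP.
Qed.

Lemma tensor_part_sum t : tensor_part false t + tensor_part true t = t.
Proof.
move: t; apply: tensor_homog_ext => [c u v|c u v //|a b v w hv hw].
  by rewrite !tensor_part_linear scalerDr addrACA.
rewrite !(tensor_part_pure _ hv hw).
by case: (a (+) b); rewrite /= ?addr0 ?add0r.
Qed.

Definition tensor_space : superspace k :=
  Superspace tensor_part_linear tensor_part_part tensor_part_sum.
End TensorSpace.

(* x . (v (x) w) = (x . v) (x) w + (-1)^{|x||v|} v (x) (x . w) *)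
Section TensorRep.
Variables (L : lie_superalgebra k) (V W : rep L).

Definition tensor_act1 (x : L) (v : V) (w : W) : tensor_sort V W :=
  pure (act x v) w + koszul (fun x v => pure v (act x w)) x v.

Definition tensor_act (x : L) : tensor_space V W -> tensor_space V W :=
  tensor_lift (tensor_act1 x).

Let kz (w : W) := koszul (fun (x : L) (v : V) => pure v (act x w)).

Let kz_linear w x : linear (kz w x).
Proof. by apply: koszul_linear => y; exact: pure_linearl. Qed.

Let kz_linearl w v : linear ((kz w)^~ v).
Proof.
by apply: koszul_linearl => u c x y; rewrite act_linearl pure_linearr.
Qed.

Let kz_linear3 x v : linear (fun w => kz w x v).
Proof.
move=> c u w; rewrite /kz /koszul scaler_sumr -big_split.
apply: eq_bigr => a _; rewrite /= scaler_sumr -big_split; apply: eq_bigr => b _ /=.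
by rewrite act_linearr pure_linearr scalerDr !scalerA [c * _]mulrC.
Qed.

Let kzE a b x v w : homog a x -> homog b v ->
  kz w x v = (-1) ^+ (a && b) *: pure v (act x w).
Proof.
apply: koszulE => [y|u c y z]; first exact: pure_linearl.
by rewrite act_linearl pure_linearr.
Qed.

Let tensor_act1_linearl x w : linear ((tensor_act1 x)^~ w).
Proof.
move=> c u v; rewrite /tensor_act1 act_linearr pure_linearl -!/(kz w) kz_linear.
by rewrite scalerDr addrACA.
Qed.

Let tensor_act1_linearr x v : linear (tensor_act1 x v).
Proof.
move=> c u w; rewrite /tensor_act1 pure_linearr -!/(kz _) kz_linear3.
by rewrite scalerDr addrACA.
Qed.

Lemma tensor_act_linearr x : linear (tensor_act x).
Proof. exact: tensor_lift_linear (tensor_act1_linearl x) (tensor_act1_linearr x). Qed.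

Lemma tensor_act_pure a b x v w : homog a x -> homog b v ->
  tensor_act x (pure v w) =
    pure (act x v) w + (-1) ^+ (a && b) *: pure v (act x w).
Proof.
move=> hx hv.
rewrite [LHS](tensor_lift_pure (tensor_act1_linearl x) (tensor_act1_linearr x)).
by rewrite /tensor_act1 -/(kz _) (kzE _ hx hv).
Qed.

Lemma tensor_act_linearl t : linear (tensor_act^~ t).
Proof.
move=> c x y; move: t; apply: tensor_ext => [d u v|d u v|v w].
- exact: tensor_act_linearr.
- rewrite !tensor_act_linearr !scalerDr !scalerA [c * d]mulrC; exact: addrACA.
rewrite /tensor_act.
rewrite !(tensor_lift_pure (tensor_act1_linearl _) (tensor_act1_linearr _)).
rewrite /tensor_act1 act_linearl pure_linearl -!/(kz w) kz_linearl.
by rewrite scalerDr addrACA.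
Qed.

Lemma tensor_act_homog a b x t :
  homog a x -> homog b t -> homog (a (+) b) (tensor_act x t).
Proof.
move=> hx; rewrite /homog => <-.
have : (fun t => part (a (+) b) (tensor_act x (part b t))) =1
    (fun t => tensor_act x (part b t)); last by apply.
apply: tensor_homog_ext => [c u v|c u v|c d v w hv hw].
- by rewrite part_linear tensor_act_linearr part_linear.
- by rewrite part_linear tensor_act_linearr.
rewrite [part b _](tensor_part_pure b hv hw).
case: eqP => [->|_]; last first.
  by rewrite (linear_fun0 (tensor_act_linearr x)) linear0.
rewrite (tensor_act_pure _ hx hv) linearD linearZ /=.
rewrite (tensor_part_pure _ (act_homog hx hv) hw).
rewrite (tensor_part_pure _ hv (act_homog hx hw)).
by rewrite addbA eqxx [a (+) c]addbC -addbA eqxx.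
Qed.

Lemma tensor_act_br a b x y t : homog a x -> homog b y ->
  tensor_act (br x y) t = tensor_act x (tensor_act y t) -
    (-1) ^+ (a && b) *: tensor_act y (tensor_act x t).
Proof.
move=> hx hy; move: t.
apply: tensor_homog_ext => [c u v|c u v|c d v w hv hw].
- exact: tensor_act_linearr.
- rewrite !tensor_act_linearr scalerDr scalerBr !scalerA [c * _]mulrC opprD.
  exact: addrACA.
rewrite (tensor_act_pure _ (br_homog hx hy) hv).
rewrite (tensor_act_pure _ hx hv) (tensor_act_pure _ hy hv).
have aD u s t : tensor_act u (s + t) = tensor_act u s + tensor_act u t.
  by have := tensor_act_linearr u 1 s t; rewrite !scale1r.
have aZ u e s : tensor_act u (e *: s) = e *: tensor_act u s.
  have := tensor_act_linearr u e s 0.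
  by rewrite (linear_fun0 (tensor_act_linearr u)) !addr0.
rewrite !aD !aZ (tensor_act_pure _ hx (act_homog hy hv)).
rewrite (tensor_act_pure _ hx hv) (tensor_act_pure _ hy (act_homog hx hv)).
rewrite (tensor_act_pure _ hy hv).
rewrite (act_br _ hx hy) (act_br _ hx hy).
have pl e s t : pure (s - e *: t) w = pure s w - e *: pure t w.
  rewrite addrC -scaleNr (pure_linearl w (- e)) addrC scaleNr.
  by [].
have pr e s t : pure v (s - e *: t) = pure v s - e *: pure v t.
  rewrite addrC -scaleNr (pure_linearr v (- e)) addrC scaleNr.
  by [].
rewrite pl pr; clear.
move: (pure _ _) (pure _ _) (pure _ _) (pure _ _) (pure _ _) (pure _ _).
have sD d e f : (-1) ^+ (d && (e (+) f)) = (-1) ^+ (d && e) * (-1) ^+ (d && f) :> k.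
  by case: d e f => [] [] []; rewrite ?mulr1 ?mul1r ?mulrNN ?mulr1.
rewrite !sD [_ && c]andbC sD [c && a]andbC [c && b]andbC [b && a]andbC.
have : (-1) ^+ (a && b) * (-1) ^+ (a && b) = 1 :> k by rewrite -expr2 sqrr_sign.
move: ((-1) ^+ (a && b)) ((-1) ^+ (a && c)) ((-1) ^+ (b && c)) => s1 s2 s3 ss.
move=> p0 p1 p2 p3 p4 p5.
rewrite !scalerDr !scalerN !opprD !scalerA !addrA mulrA ss mul1r.
rewrite [RHS](ACl ((1 * 5) * (4 * 8) * ((2 * 7) * (3 * 6)))%AC) /=.
rewrite !subrr !addr0 !addrA [s2 * s3]mulrC; congr (_ + _ - _ *: _).
by clear; move: (s1 : k) (s2 : k) (s3 : k) => *; ring.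
Qed.

Definition tensor : rep L :=
  @Rep k L (tensor_space V W) tensor_act
    tensor_act_linearl tensor_act_linearr tensor_act_homog tensor_act_br.
End TensorRep.
End Tensor.

(* U(g) is the associative unital k-algebra generated by the vector
   space g, subject to xy - (-1)^{|x||y|} yx = [x, y] for homogeneous
   x, y in g: the noncommutative polynomial expressions in elements of
   g, modulo the congruence generated by the axioms of k-algebras and
   these relations. *)
Section Enveloping.
Variables (k : fieldType) (g : lie_superalgebra k).

Inductive env_term : Type :=
  | UGen of g
  | UScal of k
  | UAdd of env_term & env_term
  | UMul of env_term & env_term.

Inductive env_eq : env_term -> env_term -> Prop :=
  | env_refl s : env_eq s s
  | env_sym s t : env_eq s t -> env_eq t s
  | env_trans s t u : env_eq s t -> env_eq t u -> env_eq s u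
  | env_congD s s' t t' : env_eq s s' -> env_eq t t' ->
      env_eq (UAdd s t) (UAdd s' t')
  | env_congM s s' t t' : env_eq s s' -> env_eq t t' ->
      env_eq (UMul s t) (UMul s' t')
  | env_addA s t u : env_eq (UAdd s (UAdd t u)) (UAdd (UAdd s t) u)
  | env_addC s t : env_eq (UAdd s t) (UAdd t s)
  | env_add0 s : env_eq (UAdd (UScal 0) s) s
  | env_mulA s t u : env_eq (UMul s (UMul t u)) (UMul (UMul s t) u)
  | env_mulDl s t u : env_eq (UMul (UAdd s t) u) (UAdd (UMul s u) (UMul t u))
  | env_mulDr s t u : env_eq (UMul s (UAdd t u)) (UAdd (UMul s t) (UMul s u))
  | env_mul0 s : env_eq (UMul (UScal 0) s) (UScal 0)
  | env_mul1 s : env_eq (UMul (UScal 1) s) s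
  | env_scalD a b : env_eq (UScal (a + b)) (UAdd (UScal a) (UScal b))
  | env_scalM a b : env_eq (UScal (a * b)) (UMul (UScal a) (UScal b))
  | env_scalC a s : env_eq (UMul (UScal a) s) (UMul s (UScal a))
  | env_gen c x y :
      env_eq (UGen (c *: x + y)) (UAdd (UMul (UScal c) (UGen x)) (UGen y))
  | env_br a b x y : homog a x -> homog b y ->
      env_eq (UMul (UGen x) (UGen y))
        (UAdd (UGen (br x y))
           (UMul (UScal ((-1) ^+ (a && b))) (UMul (UGen y) (UGen x)))).

HB.instance Definition _ := gen_eqMixin env_term.
HB.instance Definition _ := gen_choiceMixin env_term.

Definition env_rel : rel env_term := fun s t => `[< env_eq s t >].

Lemma env_rel_equiv : equiv_class_of env_rel.
Proof.
split=> [s|s t|t s u].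
- exact/asboolP/env_refl.
- by apply/asboolP/asboolP; exact: env_sym.
- by move=> /asboolP st /asboolP tu; apply/asboolP; exact: env_trans st tu.
Qed.
Canonical env_rel_canonical := EquivRelPack env_rel_equiv.

Definition U := {eq_quot env_rel}.
HB.instance Definition _ := Choice.on U.

Definition env_pi (s : env_term) : U := \pi s.

Lemma env_piP s t : env_pi s = env_pi t <-> env_eq s t.
Proof.
split=> [st|st]; first by apply/asboolP; move/eqmodP: st.
by apply/eqmodP/asboolP.
Qed.

Lemma env_repr s : env_eq (repr (env_pi s)) s.
Proof. by apply/env_piP; exact: reprK. Qed.

Lemma env_ind (P : U -> Prop) : (forall s, P (env_pi s)) -> forall u, P u.
Proof. by move=> hP u; rewrite -[u]reprK; exact: hP. Qed.

Definition env_add (u w : U) := env_pi (UAdd (repr u) (repr w)).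
Definition env_mul (u w : U) := env_pi (UMul (repr u) (repr w)).
Definition env_scale c (u : U) := env_mul (env_pi (UScal c)) u.
Definition env_opp (u : U) := env_scale (-1) u.

Lemma env_addE s t : env_add (env_pi s) (env_pi t) = env_pi (UAdd s t).
Proof. by apply/env_piP/env_congD; exact: env_repr. Qed.
Lemma env_mulE s t : env_mul (env_pi s) (env_pi t) = env_pi (UMul s t).
Proof. by apply/env_piP/env_congM; exact: env_repr. Qed.
Let envE := (env_addE, env_mulE).

Fact env_qaddA : associative env_add.
Proof.
elim/env_ind=> s; elim/env_ind=> t; elim/env_ind=> u.
by rewrite !envE; exact/env_piP/env_addA.
Qed.
Fact env_qaddC : commutative env_add.
Proof.
by elim/env_ind=> s; elim/env_ind=> t; rewrite !envE; exact/env_piP/env_addC.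
Qed.
Fact env_qadd0 : left_id (env_pi (UScal 0)) env_add.
Proof. by elim/env_ind=> s; rewrite !envE; exact/env_piP/env_add0. Qed.
Fact env_qmulA : associative env_mul.
Proof.
elim/env_ind=> s; elim/env_ind=> t; elim/env_ind=> u.
by rewrite !envE; exact/env_piP/env_mulA.
Qed.
Fact env_qmul1 : left_id (env_pi (UScal 1)) env_mul.
Proof. by elim/env_ind=> s; rewrite !envE; exact/env_piP/env_mul1. Qed.
Fact env_qscalC c : env_mul (env_pi (UScal c)) =1 env_mul^~ (env_pi (UScal c)).
Proof. by elim/env_ind=> s; rewrite !envE; exact/env_piP/env_scalC. Qed.
Fact env_qmul1r : right_id (env_pi (UScal 1)) env_mul.
Proof. by move=> u; rewrite -env_qscalC env_qmul1. Qed.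
Fact env_qmulDl : left_distributive env_mul env_add.
Proof.
elim/env_ind=> s; elim/env_ind=> t; elim/env_ind=> u.
by rewrite !envE; exact/env_piP/env_mulDl.
Qed.
Fact env_qmulDr : right_distributive env_mul env_add.
Proof.
elim/env_ind=> s; elim/env_ind=> t; elim/env_ind=> u.
by rewrite !envE; exact/env_piP/env_mulDr.
Qed.
Fact env_qmul0 u : env_mul (env_pi (UScal 0)) u = env_pi (UScal 0).
Proof. by elim/env_ind: u => s; rewrite !envE; exact/env_piP/env_mul0. Qed.
Fact env_qscalD a b :
  env_pi (UScal (a + b)) = env_add (env_pi (UScal a)) (env_pi (UScal b)).
Proof. by rewrite env_addE; exact/env_piP/env_scalD. Qed.
Fact env_qscalM a b :
  env_pi (UScal (a * b)) = env_mul (env_pi (UScal a)) (env_pi (UScal b)).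
Proof. by rewrite env_mulE; exact/env_piP/env_scalM. Qed.
Fact env_qaddN : left_inverse (env_pi (UScal 0)) env_opp env_add.
Proof.
move=> u; rewrite /env_opp /env_scale -[in X in env_add _ X](env_qmul1 u).
by rewrite -env_qmulDl -env_qscalD addNr env_qmul0.
Qed.

(* The augmentation, which shows that 1 <> 0 in U(g). *)
Fixpoint env_aug (s : env_term) : k :=
  match s with
  | UGen _ => 0
  | UScal c => c
  | UAdd s t => env_aug s + env_aug t
  | UMul s t => env_aug s * env_aug t
  end.

Lemma env_aug_eq s t : env_eq s t -> env_aug s = env_aug t.
Proof.
elim=> //= {s t}; do ?by move=> *; ring.
- by move=> ? ? ? _ -> _ ->.
- by move=> ? ? ? ? _ -> _ ->.
- by move=> ? ? ? ? _ -> _ ->.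
Qed.

Fact env_one_neq0 : env_pi (UScal 1) != env_pi (UScal 0).
Proof. by apply/eqP => /env_piP /env_aug_eq /= /eqP; rewrite oner_eq0. Qed.

HB.instance Definition _ := GRing.isZmodule.Build U
  env_qaddA env_qaddC env_qadd0 env_qaddN.
HB.instance Definition _ := GRing.Zmodule_isNzRing.Build U
  env_qmulA env_qmul1 env_qmul1r env_qmulDl env_qmulDr env_one_neq0.

Fact env_qscaleA a b u : env_scale a (env_scale b u) = env_scale (a * b) u.
Proof. by rewrite /env_scale env_qscalM env_qmulA. Qed.
Fact env_qscale1 : left_id 1 env_scale.
Proof. exact: env_qmul1. Qed.
Fact env_qscaleDr : right_distributive env_scale +%R.
Proof. by move=> a u w; exact: env_qmulDr. Qed.
Fact env_qscaleDl u : {morph env_scale^~ u : a b / a + b}.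
Proof. by move=> a b; rewrite /env_scale env_qscalD; exact: env_qmulDl. Qed.
HB.instance Definition _ := GRing.Zmodule_isLmodule.Build k U
  env_qscaleA env_qscale1 env_qscaleDr env_qscaleDl.

Fact env_qscaleAl (a : k) (u w : U) : a *: (u * w) = (a *: u) * w.
Proof. exact: env_qmulA. Qed.
HB.instance Definition _ := GRing.Lmodule_isLalgebra.Build k U env_qscaleAl.
Fact env_qscaleAr (a : k) (u w : U) : a *: (u * w) = u * (a *: w).
Proof.
rewrite env_qscaleAl -[a *: u]/(env_mul _ u) env_qscalC.
exact/esym/env_qmulA.
Qed.
HB.instance Definition _ := GRing.Lalgebra_isAlgebra.Build k U env_qscaleAr.

Definition inU (x : g) : U := env_pi (UGen x).

Lemma env_piD s t : env_pi (UAdd s t) = env_pi s + env_pi t.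
Proof. by rewrite -env_addE. Qed.
Lemma env_piM s t : env_pi (UMul s t) = env_pi s * env_pi t.
Proof. by rewrite -env_mulE. Qed.
Lemma env_piS c : env_pi (UScal c) = c%:A.
Proof. exact/esym/env_qmul1r. Qed.

Lemma env_piZ c s : env_pi (UMul (UScal c) s) = c *: env_pi s.
Proof. by rewrite -env_mulE. Qed.

Lemma inU_linear : linear inU.
Proof.
by move=> c x y; rewrite /inU -env_piZ -env_piD; exact/env_piP/env_gen.
Qed.

Lemma inU_br a b x y : homog a x -> homog b y ->
  inU x * inU y - (-1) ^+ (a && b) *: (inU y * inU x) = inU (br x y).
Proof.
move=> hx hy; apply/eqP; rewrite subr_eq; apply/eqP.
by rewrite /inU -!env_piM -env_piZ -env_piD; exact/env_piP/env_br.
Qed.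

Lemma U_ind (P : U -> Prop) :
  (forall x, P (inU x)) -> (forall c, P c%:A) ->
  (forall u w, P u -> P w -> P (u + w)) ->
  (forall u w, P u -> P w -> P (u * w)) -> forall u, P u.
Proof.
move=> Pg Ps Pa Pm; elim/env_ind; elim=> [x|c|s es t et|s es t et].
- exact: Pg.
- by rewrite env_piS; exact: Ps.
- by rewrite env_piD; exact: Pa.
- by rewrite env_piM; exact: Pm.
Qed.

(* The grading of U(g): inU is even and |uw| = |u| + |w|. *)
Fixpoint env_term_part (s : env_term) (a : bool) : U :=
  match s with
  | UGen x => inU (part a x)
  | UScal c => if a then 0 else c%:A
  | UAdd s t => env_term_part s a + env_term_part t a
  | UMul s t => \sum_(b : bool) env_term_part s b * env_term_part t (a (+) b)
  end.

Lemma env_term_part_eq s t : env_eq s t -> env_term_part s =1 env_term_part t.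
Proof.
elim=> {s t} //=.
- by move=> s t _ e a; rewrite e.
- by move=> s t u _ e _ e' a; rewrite e e'.
- by move=> s s' t t' _ e _ e' a; rewrite e e'.
- by move=> s s' t t' _ e _ e' a; apply: eq_bigr => b _; rewrite e e'.
- by move=> s t u a; rewrite addrA.
- by move=> s t a; rewrite addrC.
- by move=> s a; rewrite scale0r; case: a; rewrite add0r.
- move=> s t u a; rewrite !big_bool /= !mulrDr !mulrDl !mulrA.
  by case: a => /=; rewrite [LHS](AC (2*2)%AC ((2*3)*(1*4))%AC).
- by move=> s t u a; rewrite -big_split; apply: eq_bigr => b _; rewrite mulrDl.
- by move=> s t u a; rewrite -big_split; apply: eq_bigr => b _; rewrite mulrDr.
- by move=> s a; rewrite big_bool /= scale0r !mul0r addr0; case: a.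
- by move=> s a; rewrite big_bool /= mul0r add0r scale1r mul1r addbF.
- by move=> a b c; rewrite scalerDl; case: c; rewrite ?addr0.
- move=> a b c; rewrite big_bool /= mul0r add0r -scalerAl mul1r.
  by case: c; rewrite /= ?scaler0 ?scalerA.
- move=> a s b; rewrite !big_bool /= mul0r add0r addbF.
  by case: b; rewrite /= mulr0 ?addr0 ?add0r -scalerAl -scalerAr mul1r mulr1.
- move=> c x y a; rewrite big_bool /= mul0r add0r -scalerAl mul1r addbF.
  by rewrite part_linear inU_linear.
- move=> a b x y hx hy c; rewrite !big_bool /= mul0r add0r -scalerAl mul1r.
  rewrite !(part_homog _ hx) !(part_homog _ hy) (part_homog _ (br_homog hx hy)).
  have E : inU x * inU y = inU (br x y) + (-1) ^+ (a && b) *: (inU y * inU x).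
    by rewrite -(inU_br hx hy) subrK.
  have i0 : inU 0 = 0 := linear_fun0 inU_linear.
  case: a b c {hx hy} E => [] [] [] /= E;
    by rewrite ?i0 ?mulr0 ?mul0r ?addr0 ?add0r ?scaler0 ?addr0.
Qed.

Definition env_part (a : bool) (u : U) : U := env_term_part (repr u) a.

Lemma env_partE a s : env_part a (env_pi s) = env_term_part s a.
Proof. by rewrite /env_part (env_term_part_eq (env_repr s)). Qed.

Lemma env_partD a u w : env_part a (u + w) = env_part a u + env_part a w.
Proof.
by elim/env_ind: u => s; elim/env_ind: w => t; rewrite -env_piD !env_partE.
Qed.

Lemma env_partM a u w :
  env_part a (u * w) = \sum_(b : bool) env_part b u * env_part (a (+) b) w.
Proof.
elim/env_ind: u => s; elim/env_ind: w => t; rewrite -env_piM !env_partE.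
by apply: eq_bigr => b _; rewrite !env_partE.
Qed.

Lemma env_part_scal a c : env_part a c%:A = if a then 0 else c%:A.
Proof. by rewrite -env_piS env_partE /= env_piS. Qed.

Lemma env_part_inU a x : env_part a (inU x) = inU (part a x).
Proof. by rewrite env_partE. Qed.

Lemma env_part_linear a : linear (env_part a).
Proof.
move=> c u w; rewrite -[c *: u]mul1r -scalerAr scalerAl env_partD env_partM.
rewrite big_bool !env_part_scal /= mul0r add0r addbF.
by rewrite -scalerAl mul1r.
Qed.

Lemma env_part_part a b u :
  env_part a (env_part b u) = if a == b then env_part b u else 0.
Proof.
have p0 c : env_part c 0 = 0 := linear_fun0 (env_part_linear c).
move: u a b; apply: U_ind => [x|c|u w hu hw|u w hu hw] a b.
- rewrite !env_part_inU part_part; case: eqP => // _.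
  exact: linear_fun0 inU_linear.
- by rewrite env_part_scal; case: a b => [] []; rewrite /= ?p0 ?env_part_scal.
- by rewrite !env_partD hu hw; case: eqP; rewrite ?addr0.
- rewrite env_partM !big_bool !env_partD !env_partM !big_bool !hu !hw.
  by case: a b => [] []; rewrite /= ?mulr0 ?mul0r ?add0r ?addr0.
Qed.

Lemma env_part_sum u : env_part false u + env_part true u = u.
Proof.
move: u; apply: U_ind => [x|c|u w hu hw|u w hu hw].
- have := inU_linear 1 (part false x) (part true x).
  by rewrite !scale1r part_sum !env_part_inU.
- by rewrite !env_part_scal addr0.
- by rewrite !env_partD addrACA hu hw.
- rewrite !env_partM !big_bool /= -[in RHS]hu -[in RHS]hw.
  by rewrite mulrDl !mulrDr [LHS](AC (2*2)%AC ((2*4)*(3*1))%AC).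
Qed.

Definition U_space : superspace k :=
  Superspace env_part_linear env_part_part env_part_sum.
End Enveloping.

Section Antipode.
Variables (k : fieldType) (g : lie_superalgebra k).
Local Notation Ug := (U_space g).

Lemma U_homogM a b (u w : Ug) : homog a u -> homog b w ->
  homog (a (+) b) ((u : U g) * w : Ug).
Proof.
move=> hu hw; rewrite /homog [LHS](env_partM _ (u : U g) (w : U g)) big_bool.
have pu c : env_part c u = if c == a then u else 0 := part_homog c hu.
have pw c : env_part c w = if c == b then w else 0 := part_homog c hw.
rewrite !pu !pw.
by case: a b {hu hw pu pw} => [] [] /=; rewrite ?mul0r ?mulr0 ?addr0 ?add0r.
Qed.

Lemma U_homog1 c : @homog k Ug false (c%:A : U g).
Proof. by rewrite /homog [LHS]env_part_scal. Qed.

Lemma inU_homog a (x : g) : homog a x -> @homog k Ug a (inU x).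
Proof. by move=> hx; rewrite /homog [LHS]env_part_inU hx. Qed.

(* (u, w) |-> (-1)^{|u||w|} w u *)
Definition super_opmul : Ug -> Ug -> U g :=
  koszul (fun u w : Ug => (w : U g) * u).

Let opmul_linr (u : Ug) : linear (fun w : Ug => (w : U g) * u).
Proof. by move=> c w w'; rewrite mulrDl scalerAl. Qed.
Let opmul_linl (w : Ug) : linear (fun u : Ug => (w : U g) * u).
Proof. by move=> c u u'; rewrite mulrDr scalerAr. Qed.

Lemma super_opmul_linear u : linear (super_opmul u).
Proof. exact: koszul_linear. Qed.
Lemma super_opmul_linearl w : linear (super_opmul^~ w).
Proof. exact: koszul_linearl. Qed.

Lemma super_opmulE a b (u w : Ug) : homog a u -> homog b w ->
  super_opmul u w = (-1) ^+ (a && b) *: ((w : U g) * u).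
Proof. exact: koszulE. Qed.

Lemma super_opmul_homog a b (u w : Ug) : homog a u -> homog b w ->
  homog (a (+) b) (super_opmul u w : Ug).
Proof.
move=> hu hw; rewrite (super_opmulE hu hw); apply: homogZ.
by rewrite addbC; exact: U_homogM.
Qed.

Lemma super_opmulA (u v w : Ug) :
  super_opmul u (super_opmul v w) = super_opmul (super_opmul u v) w.
Proof.
move: u; apply: linear_homog_ext => [c u u'|c u u'|a u hu].
- exact: super_opmul_linearl.
- by rewrite super_opmul_linearl (super_opmul_linearl w).
move: v; apply: linear_homog_ext => [c v v'|c v v'|b v hv].
- by rewrite super_opmul_linearl super_opmul_linear.
- by rewrite super_opmul_linear (super_opmul_linearl w).
move: w; apply: linear_homog_ext => [c w w'|c w w'|c w hw].
- by rewrite !super_opmul_linear.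
- by rewrite super_opmul_linear.
rewrite (super_opmulE hu (super_opmul_homog hv hw)).
rewrite (super_opmulE (super_opmul_homog hu hv) hw).
rewrite (super_opmulE hv hw) (super_opmulE hu hv).
rewrite -scalerAl -scalerAr !scalerA -mulrA; congr (_ *: _).
by case: a b c {hu hv hw} => [] [] []; rewrite /= ?expr0 ?expr1; ring.
Qed.

Fixpoint env_term_antipode (s : env_term g) : U g :=
  match s with
  | UGen x => - inU x
  | UScal c => c%:A
  | UAdd s t => env_term_antipode s + env_term_antipode t
  | UMul s t => super_opmul (env_term_antipode s) (env_term_antipode t)
  end.

Let opmul_scal c u : super_opmul c%:A u = c *: u.
Proof.
move: u; apply: linear_homog_ext => [d u u'|d u u'|a u hu].
- exact: super_opmul_linear.
- by rewrite scalerDr !scalerA mulrC.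
by rewrite (super_opmulE (U_homog1 c) hu) scale1r -scalerAr mulr1.
Qed.

Let opmul_scalr c u : super_opmul u c%:A = c *: u.
Proof.
move: u; apply: linear_homog_ext => [d u u'|d u u'|a u hu].
- exact: super_opmul_linearl.
- by rewrite scalerDr !scalerA mulrC.
by rewrite (super_opmulE hu (U_homog1 c)) andbF scale1r -scalerAl mul1r.
Qed.

Lemma env_term_antipode_eq s t :
  env_eq s t -> env_term_antipode s = env_term_antipode t.
Proof.
have opD u v w : super_opmul (u + v) w = super_opmul u w + super_opmul v w.
  by have := super_opmul_linearl w 1 u v; rewrite !scale1r.
have opDr u v w : super_opmul u (v + w) = super_opmul u v + super_opmul u w.
  by have := super_opmul_linear u 1 v w; rewrite !scale1r.
elim=> {s t} //=.
- by move=> s t u _ -> _ ->.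
- by move=> s s' t t' _ -> _ ->.
- by move=> s s' t t' _ -> _ ->.
- by move=> s t u; rewrite addrA.
- by move=> s t; rewrite addrC.
- by move=> s; rewrite scale0r add0r.
- by move=> s t u; exact: super_opmulA.
- by move=> s; rewrite opmul_scal !scale0r.
- by move=> s; rewrite opmul_scal scale1r.
- by move=> a b; rewrite scalerDl.
- by move=> a b; rewrite opmul_scal scalerA.
- by move=> a s; rewrite opmul_scal opmul_scalr.
- by move=> c x y; rewrite opmul_scal inU_linear opprD scalerN.
- move=> a b x y hx hy; rewrite opmul_scal.
  have [hx' hy'] := (homogN (inU_homog hx), homogN (inU_homog hy)).
  rewrite (super_opmulE hx' hy') (super_opmulE hy' hx') !mulrNN.
  rewrite -(inU_br hx hy) opprB scalerA [b && a]andbC.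
  by rewrite -expr2 sqrr_sign scale1r subrK.
Qed.

(* The antipode, determined by antipode_linear, antipode_scal,
   antipode_inU and antipodeM below. *)
Definition antipode (u : U g) : U g := env_term_antipode (repr u).

Lemma antipodeE s : antipode (env_pi s) = env_term_antipode s.
Proof. exact/env_term_antipode_eq/env_repr. Qed.

Lemma antipode_inU x : antipode (inU x) = - inU x.
Proof. exact: antipodeE. Qed.

Lemma antipode_scal c : antipode c%:A = c%:A.
Proof. by rewrite -env_piS antipodeE /= env_piS. Qed.

Lemma antipode_opmul u w : antipode (u * w) = super_opmul (antipode u) (antipode w).
Proof.
by elim/env_ind: u => s; elim/env_ind: w => t; rewrite -env_piM !antipodeE.
Qed.

Lemma antipode_linear : linear antipode.
Proof.
move=> c; elim/env_ind=> s; elim/env_ind=> t.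
by rewrite -env_piZ -env_piD !antipodeE /= opmul_scal.
Qed.

Lemma antipode_part a u : env_part a (antipode u) = antipode (env_part a u).
Proof.
have aD u1 u2 : antipode (u1 + u2) = antipode u1 + antipode u2.
  by have := antipode_linear 1 u1 u2; rewrite !scale1r.
have a0 : antipode 0 = 0 := linear_fun0 antipode_linear.
move: u a; apply: U_ind => [x|c|u w hu hw|u w hu hw] a.
- rewrite env_part_inU !antipode_inU -env_part_inU.
  exact: (linearN (@part k Ug a)).
- rewrite antipode_scal !env_part_scal.
  by case: a; rewrite ?a0 ?antipode_scal.
- by rewrite aD !env_partD aD hu hw.
have hS b v : (forall a, env_part a (antipode v) = antipode (env_part a v)) ->
    @homog k Ug b (antipode (env_part b v)).
  by move=> hv; rewrite -hv; exact: (@homog_part k Ug).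
have opD u1 u2 v1 v2 : super_opmul (u1 + u2) (v1 + v2) =
    super_opmul u1 v1 + super_opmul u1 v2 + (super_opmul u2 v1 + super_opmul u2 v2).
  have l u3 v3 v4 : super_opmul u3 (v3 + v4) = super_opmul u3 v3 + super_opmul u3 v4.
    by have := super_opmul_linear u3 1 v3 v4; rewrite !scale1r.
  have := super_opmul_linearl (v1 + v2) 1 u1 u2; rewrite !scale1r => ->.
  by rewrite !l.
have pop c b d : env_part c (super_opmul (antipode (env_part b u))
      (antipode (env_part d w))) =
    if c == b (+) d then antipode (env_part b u * env_part d w) else 0.
  rewrite antipode_opmul.
  exact: (part_homog c (super_opmul_homog (hS b u hu) (hS d w hw))).
rewrite antipode_opmul -[in LHS](env_part_sum u) -[in LHS](env_part_sum w) !aD opD.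
rewrite !env_partD !pop env_partM big_bool aD.
by case: a; rewrite /= ?add0r ?addr0 1?addrC.
Qed.

Lemma antipodeM a b (u w : Ug) : homog a u -> homog b w ->
  antipode ((u : U g) * w) = (-1) ^+ (a && b) *: (antipode w * antipode u).
Proof.
move=> hu hw; rewrite antipode_opmul; apply: super_opmulE.
  by rewrite /homog [LHS]antipode_part [env_part _ _]hu.
by rewrite /homog [LHS]antipode_part [env_part _ _]hw.
Qed.

End Antipode.

Section Coind.
Variables (k : fieldType) (g : lie_superalgebra k) (h : lie_subsuperalgebra g).
Variable V : rep (sub_lie h).

Local Open Scope classical_set_scope.

Definition coind : set (U g -> V) := [set mu | linear mu /\
  forall (x : sub_lie h) (u : U g), mu (inU (val x) * u) = act x (mu u)].

Definition coind_act (u : U g) (mu : U g -> V) : U g -> V :=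
  fun w => mu (w * u).

Lemma coind_act_coind u mu : coind mu -> coind (coind_act u mu).
Proof.
move=> [lin eqv]; split=> [c w w'|x w]; rewrite /coind_act.
  by rewrite mulrDl -scalerAl lin.
by rewrite -mulrA eqv.
Qed.

Definition coind_ker : set (U g) :=
  [set u | forall mu, coind mu -> coind_act u mu = 0].

End Coind.

Definition neg_strad (k : fieldType) (g : lie_superalgebra k)
    (h : lie_subsuperalgebra g) : lie_character (sub_lie h) :=
  neg_str_character (ad_quot h).

(* Main.v *)
Require Import Defs.
From HB Require Import structures.
From mathcomp Require Import all_boot all_order all_algebra.
From mathcomp Require Import boolp classical_sets functions.
From mathcomp Require Import ring zify.

Set Implicit Arguments.
Unset Strict Implicit.
Unset Printing Implicit Defensive.

Import GRing.Theory.
Local Open Scope classical_set_scope.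
Local Open Scope ring_scope.

(** The coinduced module is, as a vector space, the space of functions with values
    in V on the ordered monomials in a basis x_1, ..., x_r of g modulo h
    (Poincare-Birkhoff-Witt); [wact] writes down the action of g on these functions
    by straightening, and [commutes_at_ordered] checks that it is an action.  Hence
    every element of the coinduced module vanishes at u = sum e_s x^s, with
    coefficients e_s in U(h) on the left, exactly when all the e_s act as zero on V,
    and the annihilator is the largest two-sided ideal of U(g) made of such
    elements.  The antipode exchanges left and right coefficients, so that the
    theorem compares two-sided ideals with left coefficients in the kernel of V and
    two-sided ideals with right coefficients in the kernel of a twist of V.

    If U(g) were a Frobenius extension of U(h), a form theta : U(g) -> U(h), left
    linear, right linear up to an automorphism tau, and nondegenerate, would carry
    one description into the other.  In characteristic p such forms exist
    approximately.  Let q be a power of p, and take for theta the coefficient of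
    the top monomial, with exponents q - 1 at the even basis vectors and 1 at the
    odd ones; [top_coef] is this form followed by the action on a vector of V.  Its
    symbol is the top degree component of the quotient of the symmetric
    superalgebra S(g/h) by the q-th powers of even elements.  The ideal of these
    powers is h-stable and the top component of the quotient is a line, on which h
    acts through the supertrace, up to sign, since q - 1 = -1 in k; so theta (w y) =
    theta (w) tau (y) for y in h, where tau shifts y by its supertrace, together
    with a sign on odd y when the number of odd basis vectors is odd.  The identity
    remains true in degrees exceeding that of the top monomial by almost q
    ([top_coef_sub]), because the commutator of the q-th power of x_l with an
    element of g is again an element of g, of degree much smaller than q.

    Now let u in the annihilator of the module coinduced from V have degree at most
    N, and take q larger than N + 1.  Multiplying u on the left by the monomial
    complementary to a word s and applying theta isolates the right coefficient of
    u at s, up to terms of larger words, for which it is already known that the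
    coefficient is killed; so the right coefficients of u are killed by the twist of
    V by tau ([coind_ker_coef]).

    On the side of representations, the contragredient is related to V by the
    antipode ([uact_dual_ker], [dual_uact_ker]), and the supertrace character of the
    statement is the one of tau.  This gives one inclusion; since the twisted dual
    of the twisted dual is V up to bidual, and linear forms separate vectors, the
    same argument gives the other one.  As Pi leaves the operators of a
    representation unchanged, both forms of the dual have the same annihilator. *)

(** * Signs *)

Section Twist.
Variables (k : fieldType) (V : superspace k).
Implicit Types (a b : bool) (v : V).

(** The a-th power of the parity involution: every Koszul sign below is
    carried by these linear maps, which makes the sign rule available for
    one inhomogeneous argument. *)
Definition twist a v : V := if a then part false v - part true v else v.

Lemma twist_linear a : linear (twist a).
Proof.
case: a => // c u v; rewrite /twist !part_linear scalerBr opprD; exact: addrACA.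
Qed.
HB.instance Definition _ a :=
  GRing.isLinear.Build k V V *:%R (twist a) (twist_linear a).

Lemma twist_homog a b v : homog b v -> twist a v = (-1) ^+ (a && b) *: v.
Proof.
move=> hv; case: a; rewrite /twist ?scale1r // !(part_homog _ hv).
by case: b {hv}; rewrite /= ?expr0 ?expr1 ?scaleN1r ?scale1r ?sub0r ?subr0.
Qed.

Lemma homog_twist a b v : homog b v -> homog b (twist a v).
Proof. by move=> hv; rewrite (twist_homog a hv); exact: homogZ. Qed.

Lemma twist_add a b v : twist a (twist b v) = twist (a (+) b) v.
Proof.
move: v; apply: linear_homog_ext => [c u v|c u v|c v hv]; try by rewrite !linearP.
rewrite !(twist_homog _ hv) linearZ /= (twist_homog _ hv) scalerA -signr_addb.
by case: a b c {hv} => [] [] [].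
Qed.

Lemma twistK a : involutive (twist a).
Proof. by move=> v; rewrite twist_add addbb. Qed.

Lemma twistC a b v : twist a (twist b v) = twist b (twist a v).
Proof. by rewrite !twist_add addbC. Qed.
End Twist.

Lemma linear_twist (k : fieldType) (V W : superspace k) (f : V -> W) :
  linear f -> (forall a v, homog a v -> homog a (f v)) ->
  forall a v, f (twist a v) = twist a (f v).
Proof.
move=> lf hf a; apply: linear_homog_ext => [c u v|c u v|b v hv].
- by rewrite linearP lf.
- by rewrite lf linearP.
rewrite (twist_homog a hv) (twist_homog a (hf _ _ hv)).
by have := lf ((-1) ^+ (a && b)) v 0; rewrite (linear_fun0 lf) !addr0.
Qed.

Section LieSigns.
Variables (k : fieldType) (L : lie_superalgebra k).
Implicit Types (x y z : L) (a b : bool).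

HB.instance Definition _ x :=
  GRing.isLinear.Build k L L *:%R (br x) (br_linearr x).

Lemma brZl c x z : br (c *: x) z = c *: br x z.
Proof.
by have := br_linearl z c x 0; rewrite (linear_fun0 (br_linearl z)) !addr0.
Qed.

Lemma br_twist a x y : br (twist a x) (twist a y) = twist a (br x y).
Proof.
move: x; apply: linear_homog_ext => [c u v|c u v|b x hx].
- by rewrite linearP br_linearl.
- by rewrite br_linearl linearP.
move: y; apply: linear_homog_ext => [c u v|c u v|c y hy]; try by rewrite !linearP.
rewrite (twist_homog a hx) (twist_homog a hy) (twist_homog a (br_homog hx hy)).
rewrite brZl linearZ scalerA -signr_addb; congr (_ ^+ nat_of_bool _ *: _).
by case: a b c {hx hy} => [] [] [].
Qed.

Lemma br_anti a x y : homog a x -> br x y = - br (twist a y) x.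
Proof.
move=> hx; move: y; apply: linear_homog_ext => [c u v|c u v|b y hy].
- exact: linearP.
- by rewrite linearP br_linearl opprD scalerN.
by rewrite (twist_homog a hy) brZl; exact: br_skew.
Qed.

Lemma br_jacobi_twist a x y z : homog a x ->
  br x (br y z) = br (br x y) z + br (twist a y) (br x z).
Proof.
move=> hx; move: y; apply: linear_homog_ext => [c u v|c u v|b y hy].
- by rewrite br_linearl linearP.
- by rewrite !linearP !br_linearl scalerDr addrACA.
by rewrite (twist_homog a hy) brZl; exact: br_jacobi.
Qed.

Lemma br_xx x : (2%:R : k) != 0 -> homog false x -> br x x = 0.
Proof.
move=> k2 hx; have := br_anti x hx; rewrite /twist => /eqP.
rewrite -subr_eq0 opprK -mulr2n -scaler_nat scaler_eq0 (negPf k2) /=.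
by move/eqP.
Qed.

Lemma inU_comm a x y : homog a x ->
  inU x * inU y = inU (twist a y) * inU x + inU (br x y).
Proof.
have iZ c z : inU (c *: z) = c *: inU z :> U L.
  by have := inU_linear c z 0; rewrite (linear_fun0 (@inU_linear k L)) !addr0.
move=> hx; move: y; apply: linear_homog_ext => [c u v|c u v|b y hy].
- by rewrite inU_linear mulrDr scalerAr.
- rewrite !linearP !inU_linear mulrDl scalerDr -scalerAl; exact: addrACA.
by rewrite (twist_homog a hy) iZ -(inU_br hx hy) -scalerAl addrC subrK.
Qed.

HB.instance Definition _ :=
  GRing.isLinear.Build k L (U L) *:%R (@inU k L) (@inU_linear k L).
End LieSigns.

(** * Modules over the enveloping algebra *)

(** A representation without grading: the functions and linear maps to which
    the enveloping algebra is made to act below carry no useful parity. *)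
Record lie_module (k : fieldType) (L : lie_superalgebra k) := LieModule {
  lmod_space :> lmodType k;
  lact : L -> lmod_space -> lmod_space;
  lact_linearl : forall m, linear (lact^~ m);
  lact_linearr : forall x, linear (lact x);
  lact_br : forall a x y m, homog a x ->
    lact x (lact y m) = lact (twist a y) (lact x m) + lact (br x y) m }.
Arguments lact {k L l} x m.

Section EnvelopingAction.
Variables (k : fieldType) (L : lie_superalgebra k) (M : lie_module L).

Fixpoint env_term_act (s : env_term L) (m : M) : M :=
  match s with
  | UGen x => lact x m
  | UScal c => c *: m
  | UAdd s t => env_term_act s m + env_term_act t m
  | UMul s t => env_term_act s (env_term_act t m)
  end.

Lemma env_term_act_linear s : linear (env_term_act s).
Proof.
elim: s => [x|d|s es t et|s es t et] c u v /=.
- exact: lact_linearr.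
- by rewrite scalerDr !scalerA mulrC.
- rewrite es et scalerDr; exact: addrACA.
- by rewrite et es.
Qed.

Lemma env_term_act_eq s t : env_eq s t -> env_term_act s =1 env_term_act t.
Proof.
have tD s' u v : env_term_act s' (u + v) = env_term_act s' u + env_term_act s' v.
  by have := env_term_act_linear s' 1 u v; rewrite !scale1r.
have tZ s' c u : env_term_act s' (c *: u) = c *: env_term_act s' u.
  have := env_term_act_linear s' c u 0.
  by rewrite (linear_fun0 (env_term_act_linear s')) !addr0.
elim=> {s t} //=.
- by move=> s t _ e m; rewrite e.
- by move=> s t u _ e _ e' m; rewrite e e'.
- by move=> s s' t t' _ e _ e' m; rewrite e e'.
- by move=> s s' t t' _ e _ e' m; rewrite e' e.
- by move=> s t u m; rewrite addrA.
- by move=> s t m; rewrite addrC.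
- by move=> s m; rewrite scale0r add0r.
- by move=> s t u m; rewrite tD.
- by move=> s m; rewrite !scale0r.
- by move=> s m; rewrite scale1r.
- by move=> a b m; rewrite scalerDl.
- by move=> a b m; rewrite scalerA.
- by move=> a s m; rewrite tZ.
- by move=> c x y m; rewrite lact_linearl.
- move=> a b x y hx hy m; rewrite (lact_br _ _ hx) (twist_homog a hy) addrC.
  congr (_ + _).
  have := lact_linearl (lact x m) ((-1) ^+ (a && b)) y 0.
  by rewrite (linear_fun0 (lact_linearl _)) !addr0.
Qed.

Definition uact (u : U L) (m : M) : M := env_term_act (repr u) m.

Lemma uactE s m : uact (env_pi s) m = env_term_act s m.
Proof. exact/env_term_act_eq/env_repr. Qed.

Lemma uact_inU x m : uact (inU x) m = lact x m.
Proof. exact: uactE. Qed.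

Lemma uactD u w m : uact (u + w) m = uact u m + uact w m.
Proof.
by elim/env_ind: u => s; elim/env_ind: w => t; rewrite -env_piD !uactE.
Qed.

Lemma uactM u w m : uact (u * w) m = uact u (uact w m).
Proof.
by elim/env_ind: u => s; elim/env_ind: w => t; rewrite -env_piM !uactE.
Qed.

Lemma uact_scal c m : uact c%:A m = c *: m.
Proof. by rewrite -env_piS uactE. Qed.

Lemma uact1 m : uact 1 m = m.
Proof. by rewrite -[1]scale1r uact_scal scale1r. Qed.

Lemma uactZ c u m : uact (c *: u) m = c *: uact u m.
Proof. by rewrite -[u]mul1r scalerAl uactM uact_scal mul1r. Qed.

Lemma uact_linearl m : linear (uact^~ m).
Proof. by move=> c u w; rewrite uactD uactZ. Qed.

Lemma uact_linear u : linear (uact u).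
Proof. exact: env_term_act_linear. Qed.

HB.instance Definition _ u :=
  GRing.isLinear.Build k M M *:%R (uact u) (uact_linear u).

End EnvelopingAction.
Arguments uact {k L} M u m.

(** Left multiplication by homogeneous elements of L generates: a variant of
    induction over U(L) in which only words have to be treated. *)
Lemma U_left_ind (k : fieldType) (L : lie_superalgebra k) (P : U L -> Prop) :
  P 1 -> (forall c u w, P u -> P w -> P (c *: u + w)) ->
  (forall a x u, homog a x -> P u -> P (inU x * u)) -> forall u, P u.
Proof.
move=> P1 Pl Pm u.
have P0 : P 0 by rewrite -(addNr (1 : U L)) -scaleN1r; exact: Pl.
have PD v w : P v -> P w -> P (v + w).
  by move=> pv pw; rewrite -[v]scale1r; exact: Pl.
have PZ c v : P v -> P (c *: v).
  by move=> pv; rewrite -[_ *: _]addr0; exact: Pl.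
suff: forall w, P w -> P (u * w) by move=> /(_ 1 P1); rewrite mulr1.
move: u; apply: U_ind => [x|c|u w hu hw|u w hu hw] v pv.
- rewrite -[x]part_sum raddfD /= mulrDl.
  by apply: PD; apply: Pm pv; exact: homog_part.
- by rewrite -scalerAl mul1r; exact: PZ.
- by rewrite mulrDl; apply: PD; [exact: hu|exact: hw].
- by rewrite -mulrA; apply: hu; exact: hw.
Qed.


(** * Ordered words in a basis of g modulo h *)

(** A homogeneous basis of g/h, lifted to g, together with its dual
    coordinates. *)
Record adapted_basis (k : fieldType) (g : lie_superalgebra k)
    (h : lie_subsuperalgebra g) := AdaptedBasis {
  rk : nat;
  bas : 'I_rk -> g;
  par : 'I_rk -> bool;
  coo : 'I_rk -> g -> k;
  bas_homog : forall i, homog (par i) (bas i);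
  coo_linear : forall i, linear (coo i : g -> k^o);
  coo_homog : forall i a y, homog a y -> a != par i -> coo i y = 0;
  coo_bas : forall i j, coo i (bas j) = (i == j)%:R;
  coo_mem : forall y, y \in lie_sub_mem h <-> forall i, coo i y = 0 }.
Arguments bas {k g h} _ i.
Arguments par {k g h} _ i.
Arguments coo {k g h} _ i y.

Section Words.
Variables (k : fieldType) (g : lie_superalgebra k) (h : lie_subsuperalgebra g).
Variable B : adapted_basis h.
Local Notation r := (rk B).
Local Notation x := (bas B).
Local Notation d := (par B).
Local Notation c := (coo B).
Implicit Types (y z : g) (s t : seq 'I_r).

Let coo_lin i : {linear g -> k^o} :=
  HB.pack_for {linear g -> k^o} (c i : g -> k^o)
    (GRing.isLinear.Build k g k^o *:%R (c i : g -> k^o) (@coo_linear _ _ _ B i)).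

Lemma cooP i e y z : c i (e *: y + z) = e * c i y + c i z.
Proof. exact: coo_linear. Qed.
Lemma cooB i y z : c i (y - z) = c i y - c i z.
Proof. exact: (linearB (coo_lin i)). Qed.
Lemma cooD i y z : c i (y + z) = c i y + c i z.
Proof. exact: (linearD (coo_lin i)). Qed.
Lemma cooN i y : c i (- y) = - c i y.
Proof. exact: (linearN (coo_lin i)). Qed.
Lemma cooZ i e y : c i (e *: y) = e * c i y.
Proof. exact: (linearZ_LR (coo_lin i)). Qed.

Lemma coo_twist i a y : c i (twist a y) = (-1) ^+ (a && d i) * c i y.
Proof.
move: y; apply: (@linear_homog_ext _ _ k^o (fun y => c i (twist a y))
  (fun y => (-1) ^+ (a && d i) * c i y)) => [e u v|e u v|b v hv].
- by rewrite linearP coo_linear.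
- by rewrite cooP mulrDr; congr (_ + _); exact: mulrCA.
rewrite (twist_homog a hv) cooZ.
by have [<-//|ne] := eqVneq b (d i); rewrite (coo_homog hv ne) !mulr0.
Qed.

Lemma coo_sub i (y : sub_lie h) : c i (val y) = 0.
Proof. exact: (proj1 (coo_mem B (val y)) (valP y)). Qed.

Lemma coo_sum i (P : pred 'I_r) (e : 'I_r -> k) :
  c i (\sum_(j | P j) e j *: x j) = if P i then e i else 0.
Proof.
rewrite [LHS](linear_sum (coo_lin i)) /=.
under eq_bigr => j _ do rewrite cooZ coo_bas.
case: ifP => Pi.
  rewrite (bigD1 i) //= eqxx mulr1 big1 ?addr0 // => j /andP[_ /negPf ne].
  by rewrite eq_sym ne mulr0.
rewrite big1 // => j Pj; case: eqP => [e'|]; last by rewrite mulr0.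
by rewrite -e' Pi in Pj.
Qed.

Lemma sub_part_mem y : y - \sum_i c i y *: x i \in lie_sub_mem h.
Proof.
apply/(coo_mem B) => i.
by rewrite cooB coo_sum subrr.
Qed.

Definition sub_part y : sub_lie h :=
  (Sub (y - \sum_i c i y *: x i) (sub_part_mem y) : sub_lie_sort h).

Lemma sub_part_linear : linear sub_part.
Proof.
move=> e y z; apply: val_inj => /=.
rewrite scalerBr scaler_sumr addrACA -opprD -big_split /=; congr (_ - _).
by apply: eq_bigr => i _; rewrite cooP scalerDl scalerA.
Qed.
HB.instance Definition _ :=
  GRing.isLinear.Build k g (sub_lie h) *:%R sub_part sub_part_linear.

Lemma sub_partE y : y = val (sub_part y) + \sum_i c i y *: x i.
Proof. by rewrite /= subrK. Qed.

Lemma sub_part_val (y : sub_lie h) : sub_part (val y) = y.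
Proof.
by apply: val_inj; rewrite /= big1 ?subr0 // => i _; rewrite coo_sub scale0r.
Qed.

Lemma sub_part_bas i : sub_part (x i) = 0.
Proof.
apply: val_inj; rewrite /= (bigD1 i) //= coo_bas eqxx scale1r big1 ?addr0 ?subrr //.
by move=> j /negPf ne; rewrite coo_bas ne scale0r.
Qed.

(** Membership in the span of h and of the basis vectors of index less than l. *)
Definition below l y := forall j : 'I_r, (l <= j)%N -> c j y = 0.

Definition lower l y := y - \sum_(j < r | (l <= j)%N) c j y *: x j.

Lemma lower_linear l : linear (lower l).
Proof.
move=> e y z; rewrite /lower.
rewrite scalerBr scaler_sumr addrACA -opprD -big_split /=; congr (_ - _).
by apply: eq_bigr => i _; rewrite cooP scalerDl scalerA.
Qed.
HB.instance Definition _ l :=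
  GRing.isLinear.Build k g g *:%R (lower l) (lower_linear l).

Lemma below_lower l y : below l (lower l y).
Proof.
move=> j lj; rewrite cooB coo_sum lj.
by rewrite subrr.
Qed.

Lemma lower_below l y : below l y -> lower l y = y.
Proof.
by move=> ly; rewrite /lower big1 ?subr0 // => j lj; rewrite ly ?scale0r.
Qed.

Lemma lower_bas l (i : 'I_r) : (l <= i)%N -> lower l (x i) = 0.
Proof.
move=> li; rewrite /lower (bigD1 i) //= coo_bas eqxx scale1r big1 ?addr0 ?subrr //.
by move=> j /andP[_ /negPf ne]; rewrite coo_bas ne scale0r.
Qed.

Lemma below_twist l a y : below l y -> below l (twist a y).
Proof. by move=> ly j lj; rewrite coo_twist ly // mulr0. Qed.

Lemma below_all y : below r y.
Proof. by move=> j; rewrite leqNgt ltn_ord. Qed.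

(** A word is written with its last letter first, so that multiplying on the
    right by a basis vector is a cons.  Ordered words are those whose letters
    do not decrease when read in the usual direction, odd letters not being
    repeated; l can be appended to the ordered word s when adm l s. *)
Definition adm l s : bool :=
  if s is j :: _ then (j < l)%N || ((j == l :> nat) && ~~ d j) else true.

Fixpoint ordered s : bool :=
  if s is l :: s' then adm l s' && ordered s' else true.

Lemma adm_all s : adm r s.
Proof. by case: s => //= j s; rewrite ltn_ord. Qed.

(** * The coinduced module in coordinates *)

Variable V : rep (sub_lie h).
Implicit Type f : seq 'I_r -> V.

(** Existence half of the Poincare-Birkhoff-Witt theorem, relative to h: every
    function f on ordered words has to extend to an element of the coinduced
    module, and the action of y on f takes at the word s the value of that
    extension at the product s y.  With s = s' x_l, this product is straightened
    by x_l y = +- y x_l + [x_l, y], and by x_l^2 = [x_l, x_l] / 2 for x_l odd,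
    except that a letter which can follow s is simply appended.  In the term
    (s' y) x_l, the ordered words of length at most |s'| occurring in s' y are
    multiplied by x_l recursively, while to those of length |s'| + 1 the letter
    x_l, being the largest, is appended.  The bound n on the length makes the
    recursion structural. *)
Fixpoint straighten n y f s : V :=
  if s is l :: s' then
    if n is n'.+1 then
      let f_l t := if (size t <= size s')%N then straighten n' (x l) f t
                   else f (l :: t) in
      straighten n' (twist (d l) (lower l y)) f_l s'
      + straighten n' (br (x l) (lower l y)) f s'
      + (if d l then (c l y / 2%:R) *: straighten n' (br (x l) (x l)) f s'
         else c l y *: f (l :: l :: s'))
      + \sum_(j < r | (l < j)%N) c j y *: f (j :: l :: s')
    else 0
  else act (sub_part y) (f [::]) + \sum_j c j y *: f [:: j].

(** Straightening s y, for s ordered with letters that l can follow and y below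
    l, only produces ordered words of length at most |s| + 1, and l can still
    follow those of maximal length. *)
Lemma straighten_local n n' l y f f' s :
  (size s <= n)%N -> (size s <= n')%N -> ordered s -> adm l s -> below l y ->
  (forall t, ordered t -> (size t <= size s)%N -> f t = f' t) ->
  (forall t, ordered t -> adm l t -> size t = (size s).+1 -> f t = f' t) ->
  straighten n y f s = straighten n' y f' s.
Proof.
elim: n n' l y f f' s => [|n IH] [|n'] l y f f' [|i s] //= sn sn' os ls ly ff ff'.
1-4: rewrite ff //; congr (_ + _); apply: eq_bigr => j _.
1-4: have [lj|jl] := leqP l j; first by rewrite ly ?scale0r.
1-4: by rewrite ff' //= jl.
have [is' os'] := andP os.
have ffr t : ordered t -> (size t <= (size s).+1)%N -> f t = f' t by exact: ff.
have all_n y' t : ordered t -> (size t <= size s)%N ->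
    straighten n y' f t = straighten n' y' f' t.
  move=> ot ts; apply: (IH n' r) => //.
  - exact: leq_trans ts _.
  - exact: leq_trans ts _.
  - exact: adm_all.
  - exact: below_all.
  - by move=> t' ot' t't; apply: ffr ot' _; apply: leqW; exact: leq_trans t't ts.
  - by move=> t' ot' _ t't; apply: ffr ot' _; rewrite t't.
congr (_ + _ + _ + _).
- apply: (IH n' i) => //.
  + exact/below_twist/below_lower.
  + by move=> t ot ts; rewrite ts; exact: all_n.
  + move=> t ot it ts; rewrite ts ltnn; apply: ff'; rewrite //= ?ts ?it //.
- exact: all_n.
- case: ifP => di; first by rewrite all_n.
  case/orP: ls => [il|/andP[/eqP il _]]; last by rewrite ly ?scale0r // il.
  by rewrite ff' //= ?eqxx ?di ?os ?il // orbT.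
- apply: eq_bigr => j ij; have [lj|jl] := leqP l j; first by rewrite ly ?scale0r.
  by rewrite ff' //= ?jl // ij is' os'.
Qed.

Lemma straighten_linearl n f s : linear (fun y => straighten n y f s).
Proof.
elim: n f s => [|n IH] f [|l s] e y z //=; do ?by rewrite scaler0 addr0.
1-2: rewrite linearP act_linearl scalerDr addrACA; congr (_ + _).
1-2: rewrite scaler_sumr -big_split; apply: eq_bigr => i _.
1-2: by rewrite cooP scalerDl scalerA.
rewrite [lower _ _]linearP [twist _ _]linearP [br _ (_ + _)]linearP !IH /=.
rewrite !scalerDr scaler_sumr.
rewrite [RHS](AC (4*4)%AC ((1*5)*(2*6)*(3*7)*(4*8))%AC) /=; congr (_ + _ + _ + _).
  case: ifP => _; rewrite cooP ?mulrDl scalerDl !scalerA //.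
  by rewrite -!mulrA.
rewrite -big_split; apply: eq_bigr => i _.
by rewrite cooP scalerDl scalerA.
Qed.

Let fctP e f f' s : (e *: f + f') s = e *: f s + f' s.
Proof. by []. Qed.

Lemma straighten_linearr n y s : linear (fun f => straighten n y f s).
Proof.
elim: n y s => [|n IH] y [|l s] e f f' //=; do ?by rewrite scaler0 addr0.
1-2: rewrite act_linearr scalerDr addrACA; congr (_ + _).
1-2: rewrite scaler_sumr -big_split; apply: eq_bigr => i _.
1-2: by rewrite (fctP e f f' [:: i]) scalerDr !scalerA mulrC.
rewrite !scalerDr scaler_sumr.
rewrite [RHS](AC (4*4)%AC ((1*5)*(2*6)*(3*7)*(4*8))%AC) /=; congr (_ + _ + _ + _).
- rewrite -IH; congr straighten; apply/funext => t.
  rewrite [RHS]/(e *: (if _ then _ else _) + (if _ then _ else _)).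
  by case: ifP => _; rewrite ?IH.
- exact: IH.
- case: ifP => _; rewrite ?IH.
    by rewrite scalerDr !scalerA mulrC.
  by congr (_ + _); rewrite [RHS]scalerA mulrC -scalerA.
rewrite -big_split; apply: eq_bigr => i _.
by rewrite (fctP e f f' [:: i, l & s]) scalerDr !scalerA mulrC.
Qed.

(** Off the ordered words, the value 0 makes the module axioms trivial. *)
Definition wact y f s : V := if ordered s then straighten (size s) y f s else 0.

Lemma wact_linearl f : linear (wact^~ f).
Proof.
move=> e y z; apply/funext => s; rewrite fctP /wact.
by case: ifP => _; [exact: straighten_linearl|rewrite scaler0 addr0].
Qed.

Lemma wact_linearr y : linear (wact y).
Proof.
move=> e f f'; apply/funext => s; rewrite fctP /wact.
by case: ifP => _; [exact: straighten_linearr|rewrite scaler0 addr0].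
Qed.

Lemma wact_nil y f :
  wact y f [::] = act (sub_part y) (f [::]) + \sum_j c j y *: f [:: j].
Proof. by []. Qed.

Lemma wact_local l y f f' s : ordered s -> adm l s -> below l y ->
  (forall t, ordered t -> (size t <= size s)%N -> f t = f' t) ->
  (forall t, ordered t -> adm l t -> size t = (size s).+1 -> f t = f' t) ->
  wact y f s = wact y f' s.
Proof.
by move=> os ls ly ff ff'; rewrite /wact os; exact: (straighten_local (l := l)).
Qed.

Lemma straighten0 n f s : straighten n 0 f s = 0.
Proof. exact: linear_fun0 (straighten_linearl n f s). Qed.

Lemma wact_bas (l : 'I_r) f s : ordered s -> adm l s -> wact (x l) f s = f (l :: s).
Proof.
move=> os ls; have cxl (P : pred 'I_r) (F : 'I_r -> V) : P l ->
    \sum_(j < r | P j) c j (x l) *: F j = F l.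
  move=> Pl; rewrite (bigD1 l) //= coo_bas eqxx scale1r big1 ?addr0 //.
  by move=> j /andP[_ /negPf ne]; rewrite coo_bas ne scale0r.
rewrite /wact os; case: s os ls => [_ _|i s /= /andP[is' os] ls].
  rewrite /= sub_part_bas (linear_fun0 (act_linearl _)) add0r; exact: cxl.
have il : (i <= l)%N by case/orP: ls => [/ltnW|/andP[/eqP-> _]].
rewrite lower_bas // !linear0 !straighten0 !add0r.
case/orP: ls => [ltil|/andP[/eqP /val_inj eil di]].
  have -> : c i (x l) = 0 by rewrite coo_bas; case: eqP ltil => // ->; rewrite ltnn.
  rewrite mul0r !scale0r cxl //; case: ifP; by rewrite add0r.
rewrite -eil (negPf di) coo_bas eqxx scale1r big1 ?addr0 // => j ij.
by rewrite coo_bas; case: eqP ij => [->|_]; rewrite ?ltnn ?scale0r.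
Qed.

Lemma wact_cons (l : 'I_r) y f s : ordered (l :: s) -> below l y ->
  wact y f (l :: s) =
    wact (twist (d l) y) (wact (x l) f) s + wact (br (x l) y) f s.
Proof.
move=> /= ols ly; have /andP[ls os] := ols; rewrite {1}/wact /= ols.
rewrite lower_below // ly // mul0r !scale0r if_same addr0.
rewrite big1 ?addr0 => [|j lj]; last by rewrite ly ?scale0r // ltnW.
rewrite /wact os; congr (_ + _).
apply: (straighten_local (l := l)) => //; first exact: below_twist.
  move=> t ot ts; rewrite ts ot; apply: (straighten_local (l := r)) => //.
  - exact: adm_all.
  - exact: below_all.
by move=> t ot lt ts; rewrite ts ltnn -[LHS](wact_bas f ot lt) /wact ot ts.
Qed.

Lemma wact_odd (l : 'I_r) f s : ordered (l :: s) -> d l ->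
  wact (x l) f (l :: s) = 2%:R^-1 *: wact (br (x l) (x l)) f s.
Proof.
move=> /= ols dl; have /andP[ls os] := ols; rewrite /wact /= ols os.
rewrite lower_bas // !linear0 !straighten0 !add0r dl coo_bas eqxx mul1r.
rewrite big1 ?addr0 // => j lj.
by rewrite coo_bas; case: eqP lj => [->|_]; rewrite ?ltnn ?scale0r.
Qed.

Hypothesis two_neq0 : (2%:R : k) != 0.

Lemma wactPl e y z f s : wact (e *: y + z) f s = e *: wact y f s + wact z f s.
Proof. by rewrite wact_linearl. Qed.
Lemma wactPr e y f f' s :
  wact y (e *: f + f') s = e *: wact y f s + wact y f' s.
Proof. by rewrite wact_linearr. Qed.
Lemma wactZl e y f s : wact (e *: y) f s = e *: wact y f s.
Proof.
by have := wactPl e y 0 f s; rewrite (linear_fun0 (wact_linearl f)) !addr0.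
Qed.
Lemma wactZr e y f s : wact y (e *: f) s = e *: wact y f s.
Proof.
by have := wactPr e y f 0 s; rewrite (linear_fun0 (wact_linearr y)) !addr0.
Qed.
Lemma wactDr y f f' s : wact y (f + f') s = wact y f s + wact y f' s.
Proof. by have := wactPr 1 y f f' s; rewrite !scale1r. Qed.
Lemma wactDl y z f s : wact (y + z) f s = wact y f s + wact z f s.
Proof. by have := wactPl 1 y z f s; rewrite !scale1r. Qed.
Lemma wactNl y f s : wact (- y) f s = - wact y f s.
Proof. by rewrite -scaleN1r wactZl scaleN1r. Qed.

(** The module axiom for the bracket of y, of parity a, and z, read off at
    the word s. *)
Definition commutes_at s a y z := forall f,
  wact y (wact z f) s = wact (twist a z) (wact y f) s + wact (br y z) f s.

Lemma commutes_atPl s a e y y' z :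
  commutes_at s a y z -> commutes_at s a y' z -> commutes_at s a (e *: y + y') z.
Proof.
by move=> R R' f; rewrite br_linearl !wactPl R R' wact_linearl wactPr scalerDr addrACA.
Qed.

Lemma commutes_atPr s a e y z z' :
  commutes_at s a y z -> commutes_at s a y z' -> commutes_at s a y (e *: z + z').
Proof.
move=> R R' f; rewrite wact_linearl wactPr R R' linearP br_linearr !wactPl.
by rewrite scalerDr addrACA.
Qed.

Lemma commutes_at_sym s a b y z : homog a y -> homog b z ->
  commutes_at s a y z -> commutes_at s b z y.
Proof.
move=> hy hz R f; rewrite (twist_homog b hy) wactZl R (twist_homog a hz) wactZl.
rewrite (br_anti y hz) (twist_homog b hy) brZl wactNl wactZl scalerDr scalerA.
by rewrite [b && a]andbC -expr2 sqrr_sign scale1r addrK.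
Qed.

Lemma commutes_at_xx s y : homog false y -> commutes_at s false y y.
Proof.
move=> hy f; rewrite (br_xx two_neq0 hy).
by rewrite -[wact 0 f s]/(wact 0 f s) -(scale0r (0 : g)) wactZl scale0r addr0.
Qed.

Lemma sub_part_below0 y : below 0 y -> val (sub_part y) = y.
Proof.
by move=> y0; rewrite /= big1 ?subr0 // => i _; rewrite y0 // scale0r.
Qed.

Lemma wact_sub_nil (y : sub_lie h) f : wact (val y) f [::] = act y (f [::]).
Proof.
rewrite wact_nil sub_part_val big1 ?addr0 // => i _.
by rewrite coo_sub scale0r.
Qed.

(** Words over h act at the empty word through V itself. *)
Lemma commutes_at_nil a b y z : below 0 y -> below 0 z ->
  homog a y -> homog b z -> commutes_at [::] a y z.
Proof.
move=> /sub_part_below0 <- /sub_part_below0 <-.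
move: (sub_part y) (sub_part z) => {}y {}z /sub_lie_homog hy /sub_lie_homog hz f.
have hz' := proj1 (sub_lie_homog _ _) hz.
rewrite (twist_homog a hz') wactZl.
rewrite -[br (val y) (val z)]/(val (br y z : sub_lie h)) !wact_sub_nil.
have ab := @act_br k (sub_lie h) V a b y z (f [::]) hy hz.
by rewrite ab addrC subrK.
Qed.

(** By bilinearity and antisymmetry, the basis vectors can be added one at a time in
    the order of their indices, above a level l below which the axiom is known. *)
Lemma commutes_at_all s l :
  (forall a b y z, below l y -> below l z -> homog a y -> homog b z ->
     commutes_at s a y z) ->
  (forall (i : 'I_r) b z, (l <= i)%N -> below i z -> homog b z ->
     commutes_at s (d i) (x i) z) ->
  (forall i : 'I_r, (l <= i)%N -> d i -> commutes_at s true (x i) (x i)) ->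
  forall a y z, homog a y -> commutes_at s a y z.
Proof.
move=> base step diag a y z hy.
suff H n : (l <= n)%N -> forall a b y z, below n y -> below n z ->
    homog a y -> homog b z -> commutes_at s a y z.
  have [rl|lr] := leqP r l.
    rewrite -[z]part_sum -[part false z]scale1r.
    have ab u : below l u by move=> j lj; have := ltn_ord j; rewrite ltnNge (leq_trans rl).
    by apply: commutes_atPr; apply: (base _ _ _ _ (ab _) (ab _) hy); exact: homog_part.
  rewrite -[z]part_sum -[part false z]scale1r.
  by apply: commutes_atPr;
     apply: (H r (ltnW lr) _ _ _ _ (@below_all y) (@below_all _) hy);
     exact: homog_part.
elim: n => [|n IH] ln {a y z hy} a b y z ny nz hy hz.
  by move: ln ny nz; rewrite leqn0 => /eqP <- ny nz; exact: base ny nz hy hz.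
have [ln'|nl] := leqP l n; last first.
  have el : l = n.+1 by apply/eqP; rewrite eqn_leq ln.
  by move: ny nz; rewrite -el => ny nz; exact: base ny nz hy hz.
have [rn|nr] := leqP r n.
  have ab u : below n u by move=> j lj; have := ltn_ord j; rewrite ltnNge (leq_trans rn).
  exact: IH hy hz.
pose i := Ordinal nr.
(* split off the components of y and z along the i-th basis vector *)
have split_i e u : homog e u -> below n.+1 u ->
    [/\ u = c i u *: x i + (u - c i u *: x i), below n (u - c i u *: x i),
        homog e (u - c i u *: x i) & c i u = 0 \/ d i = e].
  move=> hu nu; have hci : c i u = 0 \/ d i = e.
    by have [|ne] := eqVneq (d i) e; [right|left; rewrite (coo_homog hu) // eq_sym].
  split=> //.
  - by rewrite addrC subrK.
  - move=> j; rewrite leq_eqVlt => /orP[/eqP nj|nj].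
      have <- : i = j by exact/val_inj.
      by rewrite cooB cooZ coo_bas eqxx mulr1 subrr.
    have ji : (j == i) = false by apply/eqP => ji; move: nj; rewrite ji ltnn.
    by rewrite cooB cooZ coo_bas nu // ji mulr0 subrr.
  - apply: homogD hu _; apply: homogN; case: hci => [->|<-].
      by rewrite scale0r; exact: homog0.
    by apply: homogZ; exact: bas_homog.
have [] := split_i _ _ hy ny; move: (y - _) => y'; move: (c i y) => ey -> ny' hy' cy.
have [] := split_i _ _ hz nz; move: (z - _) => z'; move: (c i z) => ez -> nz' hz' cz.
have xz : commutes_at s (d i) (x i) z' by exact: (step i b z' ln' nz' hz').
have yx : commutes_at s a y' (x i).
  exact: (commutes_at_sym (bas_homog i) hy' (step i a y' ln' ny' hy')).
have xx : commutes_at s (d i) (x i) (x i).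
  case di : (d i); first by exact: diag.
  by apply: commutes_at_xx; rewrite -di; exact: bas_homog.
have yz : commutes_at s a y' z' by exact: (IH ln' a b).
case: cy => [->|ea].
  rewrite scale0r add0r; exact: commutes_atPr yx yz.
by subst a; apply: commutes_atPl; [exact: commutes_atPr xx xz|exact: commutes_atPr yx yz].
Qed.

Lemma wact_cons_comm (l : 'I_r) y f s : ordered (l :: s) ->
  commutes_at s (d l) (x l) y ->
  wact y f (l :: s) =
    wact (twist (d l) y) (wact (x l) f) s + wact (br (x l) y) f s.
Proof. by move=> /andP[ls os] <-; rewrite wact_bas. Qed.

Section InductionStep.
Variables (l : 'I_r) (s : seq 'I_r).
Hypothesis ols : ordered (l :: s).
Hypothesis IH : forall t, (size t <= size s)%N -> ordered t ->
  forall a y z, homog a y -> commutes_at t a y z.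
Let os : ordered s. Proof. by case/andP: ols. Qed.
Let IHs a y z : homog a y -> commutes_at s a y z.
Proof. exact: IH. Qed.
Let wcons y f : wact y f (l :: s) =
    wact (twist (d l) y) (wact (x l) f) s + wact (br (x l) y) f s.
Proof. by apply: wact_cons_comm => //; apply: IHs; exact: bas_homog. Qed.

(** x_l can be moved across z even under y, because the longest words which y
    produces from s only have letters that x_l can follow. *)
Let swap y z f : below l y -> below l z ->
  wact y (wact (x l) (wact z f)) s =
    wact y (wact (twist (d l) z) (wact (x l) f)) s + wact y (wact (br (x l) z) f) s.
Proof.
move=> ly lz; rewrite -wactDr; apply: (wact_local (l := l)) => //.
- by case/andP: ols.
- by move=> t ot ts; rewrite (IH ts ot _ (bas_homog l)).
- by move=> t ot lt ts; rewrite wact_bas // wact_cons //= lt.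
Qed.

(** The inductive case is the Jacobi identity for x_l, y and z. *)
Lemma commutes_at_cons a b y z : below l y -> below l z ->
  homog a y -> homog b z -> commutes_at (l :: s) a y z.
Proof.
move=> ly lz hy hz f; have hx := bas_homog l.
have hTy : homog a (twist (d l) y) by exact: homog_twist.
rewrite !wcons !swap //; do ?by do ?apply: below_twist.
rewrite (IHs _ hTy) (IHs _ hTy) (IHs _ (br_homog hx hy)).
rewrite br_twist (br_jacobi_twist _ _ hx) wactDl.
have -> : wact (twist a (br (x l) z)) (wact (twist (d l) y) f) s =
    wact (br (x l) (twist a z)) (wact y f) s.
  rewrite -br_twist (twist_homog a hx) (twist_homog (d l) hy).
  have -> : wact ((-1) ^+ (d l && a) *: y) f = (-1) ^+ (d l && a) *: wact y f.
    by have := wact_linearl f ((-1) ^+ (d l && a)) y 0;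
       rewrite (linear_fun0 (wact_linearl f)) !addr0.
  rewrite brZl wactZl wactZr scalerA.
  by rewrite [d l && a]andbC -expr2 sqrr_sign scale1r.
rewrite [twist a (twist _ _)]twist_add [twist (d l) (twist a _)]twist_add.
rewrite [a (+) d l]addbC.
rewrite [LHS](AC ((2*2)*2)%AC ((1*5)*(3*2)*(6*4))%AC) /=.
by rewrite !addrA.
Qed.

(** When the odd letter l is repeated, what is used is x_l^2 = [x_l, x_l] / 2 and
    [x_l, [x_l, z]] = [[x_l, x_l], z] / 2. *)
Lemma commutes_at_cons_odd b z : d l -> below l z -> homog b z ->
  commutes_at (l :: s) true (x l) z.
Proof.
move=> dl lz hz f; have hx : homog true (x l) by rewrite -dl; exact: bas_homog.
have hxx : homog false (br (x l) (x l)) by exact: (@br_homog _ _ true true).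
rewrite wact_odd // !wcons dl twistK (IHs _ hxx).
have -> : wact z (wact (x l) (wact (x l) f)) s =
    2%:R^-1 *: wact z (wact (br (x l) (x l)) f) s.
  rewrite -wactZr; apply: (wact_local (l := l)) => //.
  - by case/andP: ols.
  - move=> t ot ts; apply: (scalerI two_neq0).
    rewrite [RHS]scalerA divff // scale1r scaler_nat mulr2n {1}(IH ts ot _ hx).
    by rewrite (twist_homog true hx) wactZl scaleN1r addrAC addNr add0r.
  - by move=> t ot lt ts; rewrite wact_bas // wact_odd //= lt.
have -> : br (br (x l) (x l)) z = 2%:R *: br (x l) (br (x l) z).
  have := br_jacobi_twist (x l) z hx.
  rewrite (twist_homog true hx) brZl scaleN1r => J.
  by rewrite scaler_nat mulr2n {1}J subrK.
rewrite wactZl scalerDr scalerA mulVf // scale1r -!addrA; congr (_ + _).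
rewrite -br_twist (twist_homog true hx) brZl wactZl scaleN1r.
by rewrite addrA subrr add0r.
Qed.

(** The cube of x_l can be straightened in two ways; that they agree is the
    axiom [x, [x, x]] = 0, which the Jacobi identity gives up to a factor 3. *)
Lemma commutes_at_cons_xx : d l -> commutes_at (l :: s) true (x l) (x l).
Proof.
move=> dl f; have hx : homog true (x l) by rewrite -dl; exact: bas_homog.
have hxx : homog false (br (x l) (x l)) by exact: (@br_homog _ _ true true).
apply: (scalerI two_neq0); rewrite scalerDr (twist_homog true hx) wactZl scaleN1r.
rewrite !wact_odd // scalerN scalerA divff // scale1r wcons.
rewrite (twist_homog _ hxx) andbF scale1r (br_cube hx).
have -> : wact 0 f s = 0 by rewrite (linear_fun0 (wact_linearl f)).
by rewrite addr0 scaler_nat mulr2n addrA addNr add0r.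
Qed.
End InductionStep.

(** The letters larger than l, and l itself when even, can be appended to a word
    ending with l, so that the axiom holds there by construction. *)
Lemma commutes_at_ordered s : ordered s ->
  forall a y z, homog a y -> commutes_at s a y z.
Proof.
have [n] := ubnP (size s); elim: n s => // n IH s; rewrite ltnS => sn os.
have app (i : 'I_r) b z : adm i s -> below i z -> homog b z ->
    commutes_at s (d i) (x i) z.
  by move=> is' iz hz f; rewrite wact_bas // wact_cons //= is'.
have diag (i : 'I_r) : adm i s -> d i -> commutes_at s true (x i) (x i).
  move=> is' di f; have hx : homog true (x i) by rewrite -di; exact: bas_homog.
  rewrite (twist_homog true hx) wactZl scaleN1r wact_bas // wact_odd //= ?is' //.
  apply: (scalerI two_neq0); rewrite scalerDr scalerN scalerA divff // scale1r.
  by rewrite scaler_nat mulr2n addrA addNr add0r.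
case: s sn os app diag => [|l s] sn os app diag.
  apply: (commutes_at_all (l := 0)) => [a b y z y0 z0 hy hz|i b z _|i _].
  - exact: commutes_at_nil y0 z0 hy hz.
  - exact: app.
  - exact: diag.
have IHs t : (size t <= size s)%N -> ordered t ->
    forall a y z, homog a y -> commutes_at t a y z.
  by move=> ts ot; apply: IH ot; exact: leq_ltn_trans ts _.
apply: (commutes_at_all (l := l)) => [a b y z ly lz hy hz|i b z li iz hz|i li di].
- exact: (commutes_at_cons os IHs ly lz hy hz).
- have [il|ne] := boolP (adm i (l :: s)); first exact: app il iz hz.
  have [eli dl] : l = i /\ d l.
    move: ne; rewrite /= ltn_neqAle li andbT.
    by case: (eqVneq (l : nat) i) => [/val_inj -> /=|]//; rewrite negbK.
  by rewrite -eli dl in iz *; exact: (commutes_at_cons_odd os IHs dl iz hz).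
- have [il|ne] := boolP (adm i (l :: s)); first exact: diag il di.
  have eli : l = i.
    move: ne; rewrite /= ltn_neqAle li andbT.
    by case: (eqVneq (l : nat) i) => [/val_inj -> /=|].
  by rewrite -eli in di *; exact: (commutes_at_cons_xx os IHs di).
Qed.

Definition word_module : lie_module g.
Proof.
apply: (@LieModule k g (seq 'I_r -> V) wact wact_linearl wact_linearr).
move=> a y z f hy; apply/funext => s.
have [os|nos] := boolP (ordered s); first exact: commutes_at_ordered.
rewrite /wact (negPf nos).
have -> (u w : seq 'I_r -> V) : (u + w) s = u s + w s by [].
by rewrite (negPf nos) addr0.
Defined.
End Words.

(** * The filtration by degree modulo h *)

Section RepModule.
Variables (k : fieldType) (L : lie_superalgebra k) (W : rep L).

Lemma act_twist_comm a x y (v : W) : homog a x ->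
  act x (act y v) = act (twist a y) (act x v) + act (br x y) v.
Proof.
have lin0 (z : L) (e : k) (u : W) : act (e *: z) u = e *: act z u.
  have := act_linearl u e z 0.
  by rewrite (linear_fun0 (act_linearl u)) !addr0.
move=> hx; move: y; apply: linear_homog_ext => [e y z|e y z|b y hy].
- by rewrite act_linearl act_linearr.
- by rewrite linearP br_linearr !act_linearl scalerDr addrACA.
by rewrite (act_br _ hx hy) (twist_homog a hy) lin0 addrC subrK.
Qed.

Lemma act_twist a (y : L) (v : W) :
  act (twist a y) (twist a v) = twist a (act y v).
Proof.
move: y; apply: linear_homog_ext => [c y z|c y z|b y hy].
- by rewrite linearP act_linearl.
- by rewrite act_linearl linearP.
move: v; apply: linear_homog_ext => [c u v|c u v|c v hv].
- by rewrite linearP [LHS]linearP.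
- by rewrite act_linearr linearP.
rewrite (twist_homog a hy) (twist_homog a hv) (twist_homog a (act_homog hy hv)).
have -> e (w : W) : act (e *: y) w = e *: act y w.
  have := act_linearl w e y 0.
  by rewrite (linear_fun0 (act_linearl w)) !addr0.
rewrite linearZ scalerA -signr_addb; congr (_ ^+ nat_of_bool _ *: _).
by case: a b c {hy hv} => [] [] [].
Qed.

Definition rep_module : lie_module L :=
  LieModule (@act_linearl k L W) (@act_linearr k L W) act_twist_comm.
End RepModule.

(** W tensored with e times the character chi, with the action twisted m
    times by the parity involution of h. *)
Section ShiftedModule.
Variables (k : fieldType) (L : lie_superalgebra k) (W : rep L).
Variables (chi : lie_character L) (e : k) (m : bool).

Lemma character_twist a y : chi (twist a y) = chi y.
Proof.
have l c u v : chi (c *: u + v) = c * chi u + chi v.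
  exact: (character_linear chi c u v).
have D u v : chi (u + v) = chi u + chi v by have := l 1 u v; rewrite scale1r mul1r.
have odd0 : chi (part true y) = 0 by apply: character_odd; exact: homog_part.
case: a; rewrite // /twist -[in RHS](part_sum y) -scaleN1r addrC l D odd0.
by rewrite mulr0 add0r addr0.
Qed.

Definition shifted_act (y : L) (w : W) : W :=
  act (twist m y) w + (e * chi y) *: w.

Lemma shifted_act_linearl w : linear (shifted_act^~ w).
Proof.
move=> c y z; rewrite /shifted_act linearP act_linearl.
have -> : chi (c *: y + z) = c * chi y + chi z.
  exact: (character_linear chi c y z).
by rewrite mulrDr scalerDl mulrCA scalerDr scalerA addrACA.
Qed.

Lemma shifted_act_linearr y : linear (shifted_act y).
Proof.
move=> c u w; rewrite /shifted_act act_linearr !scalerDr !scalerA.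
by rewrite [_ * c]mulrC addrACA.
Qed.

Lemma shifted_act_br a y z w : homog a y ->
  shifted_act y (shifted_act z w) =
    shifted_act (twist a z) (shifted_act y w) + shifted_act (br y z) w.
Proof.
move=> hy; rewrite /shifted_act character_br mulr0 scale0r addr0 character_twist.
have aD u v v' : act u (v + v') = act u v + act u v' :> W by rewrite linearD.
have aZ u c v : act u (c *: v) = c *: act u v :> W by rewrite linearZ.
rewrite !aD !aZ !scalerDr (act_twist_comm _ _ (homog_twist m hy)) br_twist.
rewrite [twist a (twist m z)]twistC.
have -> : (e * chi y) *: act (twist m (twist a z)) w =
    (e * chi y) *: act (twist m z) w.
  by case: a hy => // /(character_odd chi) ->; rewrite mulr0 !scale0r.
rewrite !scalerA [e * chi z * _]mulrC.
by rewrite [LHS](AC (3*2)%AC ((1*4)*(3*5)*2)%AC).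
Qed.

Definition shifted_module : lie_module L :=
  LieModule shifted_act_linearl shifted_act_linearr shifted_act_br.
End ShiftedModule.

Section Subalgebra.
Variables (k : fieldType) (g : lie_superalgebra k) (h : lie_subsuperalgebra g).

Lemma val_twist a (y : sub_lie h) : val (twist a y) = twist a (val y).
Proof. by case: a. Qed.

Definition left_module : lie_module (sub_lie h).
Proof.
apply: (@LieModule k (sub_lie h) (U g) (fun y u => inU (val y) * u)).
- move=> u e y z; rewrite -[val (e *: y + z)]/(e *: val y + val z).
  by rewrite inU_linear mulrDl -scalerAl.
- by move=> y e u w; rewrite mulrDr -scalerAr.
move=> a y z u /sub_lie_homog hy.
by rewrite !mulrA (inU_comm _ hy) -mulrDl val_twist.
Defined.

Definition iota (e : U (sub_lie h)) : U g := uact left_module e 1.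

Lemma uact_left e (u : U g) : uact left_module e u = iota e * u.
Proof.
move: u; elim/U_left_ind: e => [|c e e' he he'|a y e hy he] u.
- by rewrite /iota !uact1 mul1r.
- by rewrite /iota !uactD !uactZ he he' mulrDl scalerAl.
- by rewrite /iota !uactM he !uact_inU /= mulrA.
Qed.

Lemma iotaM e e' : iota (e * e') = iota e * iota e'.
Proof. by rewrite {1}/iota uactM uact_left. Qed.
Lemma iota_inU y : iota (inU y) = inU (val y).
Proof. by rewrite /iota uact_inU /= mulr1. Qed.
Lemma iota1 : iota 1 = 1.
Proof. by rewrite /iota uact1. Qed.
Lemma iota_linear : linear iota.
Proof. exact: (@uact_linearl _ _ left_module 1). Qed.
HB.instance Definition _ :=
  GRing.isLinear.Build k (U (sub_lie h)) (U g) *:%R iota iota_linear.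

Lemma coind_iota (W : rep (sub_lie h)) (mu : U g -> W) e u :
  coind mu -> mu (iota e * u) = uact (rep_module W) e (mu u).
Proof.
move=> [lin eqv]; move: u.
elim/U_left_ind: e => [|c e e' he he'|a y e hy he] u.
- by rewrite iota1 mul1r uact1.
- by rewrite iota_linear mulrDl -scalerAl lin he he' uactD uactZ.
- by rewrite iotaM iota_inU -mulrA eqv he uactM uact_inU.
Qed.

(** Spanned by the products of elements of g in which at most n factors lie
    outside h. *)
Inductive fil : nat -> U g -> Prop :=
  | fil_scal n c : fil n c%:A
  | fil_add n u w : fil n u -> fil n w -> fil n (u + w)
  | fil_sub n (y : sub_lie h) u : fil n u -> fil n (u * inU (val y))
  | fil_gen n y u : fil n u -> fil n.+1 (u * inU y).

Lemma fil0 n : fil n 0.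
Proof. by rewrite -(scale0r 1); exact: fil_scal. Qed.

Lemma fil1 n : fil n 1.
Proof. by rewrite -[1]scale1r; exact: fil_scal. Qed.

Lemma filZ n c u : fil n u -> fil n (c *: u).
Proof.
elim=> {n u} [n e|n u w _ hu _ hw|n y u _ hu|n y u _ hu].
- by rewrite scalerA; exact: fil_scal.
- by rewrite scalerDr; exact: fil_add.
- by rewrite scalerAl; exact: fil_sub.
- by rewrite scalerAl; exact: fil_gen.
Qed.

Lemma fil_leq m n u : (m <= n)%N -> fil m u -> fil n u.
Proof.
move=> mn mu; elim: mu n mn => {m u} [m e|m u w _ hu _ hw|m y u _ hu|m y u _ hu] n mn.
- exact: fil_scal.
- by apply: fil_add; [exact: hu|exact: hw].
- by apply: fil_sub; exact: hu.
- by case: n mn => // n mn; apply: fil_gen; exact: hu.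
Qed.

Lemma fil_mul m n u w : fil m u -> fil n w -> fil (m + n) (u * w).
Proof.
move=> mu; elim=> {n w} [n e|n w w' _ hw _ hw'|n y w _ hw|n y w _ hw].
- by rewrite -scalerAr mulr1; apply: filZ; apply: fil_leq mu; exact: leq_addr.
- by rewrite mulrDr; exact: fil_add.
- by rewrite mulrA; exact: fil_sub.
- by rewrite mulrA addnS; exact: fil_gen.
Qed.

Lemma fil_inU y : fil 1 (inU y).
Proof. by rewrite -[inU y]mul1r; apply: fil_gen; exact: fil1. Qed.

Lemma fil_exists u : exists n, fil n u.
Proof.
move: u; apply: U_ind => [y|c|u w [m hu] [n hw]|u w [m hu] [n hw]].
- by exists 1%N; exact: fil_inU.
- by exists 0%N; exact: fil_scal.
- exists (maxn m n); apply: fil_add.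
    by apply: fil_leq hu; exact: leq_maxl.
  by apply: fil_leq hw; exact: leq_maxr.
- by exists (m + n)%N; exact: fil_mul.
Qed.

(** Degree less than n; the case n = 0 only leaves 0, which keeps the empty word
    within the general pattern. *)
Definition fil_lt n u := if n is n'.+1 then fil n' u else u = 0.

Lemma fil_lt0 n : fil_lt n 0.
Proof. by case: n => // n; exact: fil0. Qed.

Lemma fil_ltD n u w : fil_lt n u -> fil_lt n w -> fil_lt n (u + w).
Proof. by case: n => [-> ->|n]; [exact: addr0|exact: fil_add]. Qed.

Lemma fil_ltZ n c u : fil_lt n u -> fil_lt n (c *: u).
Proof. by case: n => [->|n]; [exact: scaler0|exact: filZ]. Qed.

Lemma fil_lt_mul m n p u w : fil_lt m u -> fil n w -> (m + n)%N = p ->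
  fil_lt p (u * w).
Proof.
move=> hu hw <-; case: m hu => [->|m hu]; first by rewrite mul0r; exact: fil_lt0.
exact: fil_mul hu hw.
Qed.

Lemma fil_mul_lt m n p u w : fil m u -> fil_lt n w -> (m + n)%N = p ->
  fil_lt p (u * w).
Proof.
move=> hu hw <-; case: n hw => [->|n hw]; first by rewrite mulr0; exact: fil_lt0.
by rewrite addnS; exact: fil_mul hu hw.
Qed.
End Subalgebra.
Arguments iota1 {k g} h.

Section Monomials.
Variables (k : fieldType) (g : lie_superalgebra k) (h : lie_subsuperalgebra g).
Variable B : adapted_basis h.
Local Notation r := (rk B).
Local Notation x := (bas B).
Local Notation d := (par B).
Local Notation c := (coo B).
Local Notation fil := (fil h).
Local Notation fil_lt := (fil_lt h).
Implicit Types (y z : g) (s t : seq 'I_r).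

Fixpoint mon s : U g := if s is l :: s' then mon s' * inU (x l) else 1.

Lemma mon_cat s t : mon (s ++ t) = mon t * mon s.
Proof. by elim: s => [|l s IH] /=; rewrite ?mulr1 // IH mulrA. Qed.

Lemma fil_mon s : fil (size s) (mon s).
Proof. by elim: s => [|l s IH] /=; [exact: fil1|exact: fil_gen]. Qed.

Lemma inU_sub_part y :
  inU y = inU (val (sub_part B y)) + \sum_i c i y *: inU (x i) :> U g.
Proof.
rewrite {1}(sub_partE B y) raddfD raddf_sum /=; congr (_ + _).
by apply: eq_bigr => i _; rewrite linearZ.
Qed.

Lemma bas_comm i l : exists b : bool,
  inU (x i) * inU (x l) =
    (-1) ^+ b *: (inU (x l) * inU (x i)) + inU (br (x i) (x l)).
Proof.
exists (d i && d l); rewrite (inU_comm _ (bas_homog i)).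
by rewrite (twist_homog _ (bas_homog l)) linearZ scalerAl.
Qed.

Lemma bas_odd_sq l : (2%:R : k) != 0 -> d l ->
  inU (x l) * inU (x l) = 2%:R^-1 *: inU (br (x l) (x l)) :> U g.
Proof.
move=> k2 dl; have := inU_comm (x l) (bas_homog l).
rewrite (twist_homog _ (bas_homog l)) dl scaleN1r raddfN mulNr => e.
apply: (scalerI k2); rewrite scalerA divff // scale1r scaler_nat mulr2n {1}e.
by rewrite addrAC addNr add0r.
Qed.

(** Up to sign, the associated graded algebra is commutative. *)
Lemma bas_mon i s : exists b : bool,
  fil_lt (size s).+1 (inU (x i) * mon s - (-1) ^+ b *: (mon s * inU (x i))).
Proof.
elim: s => [|l s [b IH]] /=.
  by exists false; rewrite scale1r mulr1 mul1r subrr; exact: fil0.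
have [b' e] := bas_comm i l; exists (b (+) b').
have -> : inU (x i) * (mon s * inU (x l)) -
    (-1) ^+ (b (+) b') *: (mon s * inU (x l) * inU (x i)) =
  (inU (x i) * mon s - (-1) ^+ b *: (mon s * inU (x i))) * inU (x l) +
    (-1) ^+ b *: (mon s * inU (br (x i) (x l))).
  rewrite mulrBl -scalerAl -[mon s * _ * inU (x l)]mulrA e mulrDr scalerDr.
  rewrite -scalerAr scalerA -signr_addb !mulrA opprD.
  by rewrite [in RHS]addrA subrK.
apply: fil_add; first exact: fil_gen.
by apply/filZ/fil_gen/fil_mon.
Qed.

Lemma mon_catC s t : exists b : bool,
  fil_lt (size s + size t) (mon s * mon t - (-1) ^+ b *: (mon t * mon s)).
Proof.
elim: t => [|l t [b IH]] /=.
  exists false; rewrite scale1r mulr1 mul1r subrr; exact: fil_lt0.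
have [b' hb'] := bas_mon l s; exists (b (+) b').
have -> : mon s * (mon t * inU (x l)) -
    (-1) ^+ (b (+) b') *: (mon t * inU (x l) * mon s) =
  (mon s * mon t - (-1) ^+ b *: (mon t * mon s)) * inU (x l) +
    - (-1) ^+ (b (+) b') *: (mon t *
      (inU (x l) * mon s - (-1) ^+ b' *: (mon s * inU (x l)))).
  rewrite mulrBl mulrBr -scalerAl -scalerAr !mulrA scaleNr scalerBr scalerA.
  rewrite -signr_addb -addbA addbb addbF opprB.
  by rewrite addrA subrK.
apply: fil_ltD; first by apply: fil_lt_mul IH (fil_inU _ _) _; rewrite addn1 addnS.
apply: fil_ltZ; apply: fil_mul_lt (fil_mon t) hb' _.
by rewrite addnS addnC addnS.
Qed.

Lemma mon_perm s t : perm_eq s t -> exists b : bool,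
  fil_lt (size s) (mon s - (-1) ^+ b *: mon t).
Proof.
move=> st; pose P t := (exists b : bool,
  fil_lt (size s) (mon s - (-1) ^+ b *: mon t)) /\ size t = size s.
suff: P t by case.
apply: (catCA_perm_ind (P := P) _ st); last first.
  by split=> //; exists false; rewrite scale1r subrr; exact: fil_lt0.
move=> s1 s2 s3 [[b hb] sz']; split; last first.
  by rewrite -sz' !size_cat addnCA.
have [b' hb'] := mon_catC s2 s1; exists (b (+) b').
rewrite -(subrKA ((-1) ^+ b *: mon (s1 ++ s2 ++ s3))); apply: (fil_ltD hb).
rewrite signr_addb -scalerA -scalerBr !mon_cat -!mulrA scalerAr -mulrBr.
apply: fil_ltZ; apply: fil_mul_lt (fil_mon s3) hb' _.
by rewrite -sz' !size_cat; lia.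
Qed.

(** As words are written backwards, sorting puts the largest letter first. *)
Let leT : rel 'I_r := fun i j => (j <= i)%N.

Lemma leT_total : total leT.
Proof. by move=> i j; rewrite /leT leq_total. Qed.
Lemma leT_trans : transitive leT.
Proof. by move=> i j l ij jl; exact: leq_trans jl ij. Qed.
Lemma leT_anti : antisymmetric leT.
Proof. by move=> i j; rewrite /leT -eqn_leq => /eqP/val_inj. Qed.

Lemma ordered_sorted s : ordered s -> sorted leT s.
Proof.
elim: s => //= l [//|i s] IH /andP[il os]; have /= -> := IH os; rewrite andbT /leT.
by case/orP: il => [/ltnW|/andP[/eqP-> _]].
Qed.

Lemma sorted_ordered s : sorted leT s ->
  ordered s \/ exists t1 l t2, s = t1 ++ [:: l, l & t2] /\ d l.
Proof.
elim: s => [|l s IH] ls; first by left.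
case: IH => [|os|[t1 [i [t2 [-> di]]]]]; first exact: path_sorted ls.
- case: s ls os => [_ _|i s /= /andP[il _] os]; first by left.
  have [eil|ne] := eqVneq i l.
    rewrite -eil; case di : (d i); first by right; exists [::], i, s.
    by left; rewrite /= eqxx ?di orbT.
  have lt_il : (i < l)%N by move: ne il; rewrite /leT -val_eqE /=; lia.
  by left; rewrite lt_il os.
by right; exists (l :: t1), i, t2.
Qed.

Lemma ordered_perm s t : ordered s -> ordered t -> perm_eq s t -> s = t.
Proof.
move=> /ordered_sorted os /ordered_sorted ot.
exact: (sorted_eq leT_trans leT_anti os ot).
Qed.

Lemma ordered_odd s l : ordered s -> d l -> (count_mem l s <= 1)%N.
Proof.
elim: s => //= i s IH /andP[is' os] dl.
have [eil|_] := eqVneq i l; last by rewrite add0n IH.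
rewrite add1n ltnS leqn0 eqn0Ngt -has_count; apply/hasPn => j js.
apply/negP => /eqP ejl; rewrite {}ejl -{}eil in js dl *.
case: s is' os js {IH} => // a s /= /orP[ai|/andP[/eqP/val_inj -> ]]; last by rewrite dl.
move=> os; have := ordered_sorted (os : ordered (a :: s)).
rewrite /= (path_sortedE (leT_trans)) => /andP[/allP H _].
rewrite inE => /orP[/eqP e|/H]; first by rewrite e ltnn in ai.
by rewrite /leT leqNgt ai.
Qed.

Lemma sorted_small_ordered s : sorted leT s ->
  (forall l, d l -> (count_mem l s <= 1)%N) -> ordered s.
Proof.
move=> ss odd1; have [//|[t1 [l [t2 [e dl]]]]] := sorted_ordered ss.
have := odd1 l dl; rewrite e.
by rewrite count_cat /= eqxx; lia.
Qed.

Lemma sorted_split s l : sorted leT s -> exists s1 s2,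
  s = s1 ++ nseq (count_mem l s) l ++ s2.
Proof.
suff H : sorted leT s -> exists s1 s2,
    s = s1 ++ nseq (count_mem l s) l ++ s2 /\ all (fun i : 'I_r => (l < i)%N) s1.
  by move=> /H[s1 [s2 [e _]]]; exists s1, s2.
elim: s => [_|i s IH] /=; first by exists [::], [::].
rewrite (path_sortedE (leT_trans)) => /andP[is' ss].
have [s1 [s2 [e a1]]] := IH ss.
have [il|ne] := eqVneq i l.
  exists [::], s2; split=> //; rewrite add1n /= il.
  congr (_ :: _); rewrite {1}e; case: s1 e a1 => // j s1 e /= /andP[lj _].
  by move: is'; rewrite e /= /leT il leqNgt lj.
have [li|il] := ltnP l i; first by exists (i :: s1), s2; rewrite /= li add0n -e.
exists [::], (i :: s); split=> //.
have -> : count_mem l s = 0%N; last by rewrite ?add0n.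
apply/eqP; rewrite eqn0Ngt -has_count; apply/hasPn => j js /=.
apply: contraTneq (allP is' _ js) => ->; rewrite -ltnNge.
by rewrite ltn_neqAle il andbT.
Qed.

Lemma mon_nseq m l : mon (nseq m l) = inU (x l) ^+ m.
Proof. by elim: m => //= m ->; rewrite exprSr. Qed.

Hypothesis two_neq0 : (2%:R : k) != 0.

Lemma mon_odd_dup t1 l t2 : d l ->
  fil_lt (size (t1 ++ [:: l, l & t2])) (mon (t1 ++ [:: l, l & t2])).
Proof.
move=> dl; rewrite mon_cat /= size_cat /= !addnS.
rewrite -[mon t2 * _ * _]mulrA (bas_odd_sq two_neq0 dl).
rewrite -scalerAr -scalerAl; apply: filZ.
rewrite addnC -addSn; apply: fil_mul (fil_mon t1).
by rewrite -addn1; exact: fil_mul (fil_mon t2) (fil_inU _ _).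
Qed.

Definition spanned n (u : U g) := exists e : seq 'I_r -> U (sub_lie h),
  u = \sum_(b : n.-bseq 'I_r | ordered b) iota (e b) * mon b.

Lemma spannedD n u w : spanned n u -> spanned n w -> spanned n (u + w).
Proof.
move=> [e ->] [e' ->]; exists (fun s => e s + e' s); rewrite -big_split.
by apply: eq_bigr => b _; rewrite raddfD mulrDl.
Qed.

Lemma spanned_mon n (e : U (sub_lie h)) s : ordered s -> (size s <= n)%N ->
  spanned n (iota e * mon s).
Proof.
move=> os sn; exists (fun t => if t == s then e else 0).
rewrite (bigD1 (Bseq sn)) //= eqxx big1 ?addr0 // => b /andP[_ ne].
case: eqP => [bs|_]; last by rewrite raddf0 mul0r.
by case/eqP: ne; exact: val_inj.
Qed.

Lemma spanned0 n : spanned n 0.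
Proof.
exists (fun=> 0); rewrite big1 // => b _; by rewrite raddf0 mul0r.
Qed.

Lemma spanned_ind n (P : U g -> Prop) : P 0 ->
  (forall u w, P u -> P w -> P (u + w)) ->
  (forall (e : U (sub_lie h)) s, ordered s -> (size s <= n)%N -> P (iota e * mon s)) ->
  forall u, spanned n u -> P u.
Proof.
move=> P0 PD Pm u [e ->]; apply: big_ind => // b ob; apply: Pm ob _.
exact: size_bseq.
Qed.

Lemma spanned_leq m n u : (m <= n)%N -> spanned m u -> spanned n u.
Proof.
move=> mn; apply: spanned_ind => [|u' w|e s os sm].
- exact: spanned0.
- exact: spannedD.
- by apply: spanned_mon os _; exact: leq_trans sm mn.
Qed.

Lemma spanned_iota n (e : U (sub_lie h)) u : spanned n u -> spanned n (iota e * u).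
Proof.
apply: (spanned_ind (P := fun w => spanned n (iota e * w))) => [|u' w hu hw|e' s os sn].
- by rewrite mulr0; exact: spanned0.
- by rewrite mulrDr; exact: spannedD.
- by rewrite mulrA -iotaM; exact: spanned_mon.
Qed.

Lemma spannedZ n c u : spanned n u -> spanned n (c *: u).
Proof.
move=> hu; rewrite -[u]mul1r scalerAl -(iota1 h) -linearZ; exact: spanned_iota.
Qed.

(** Spanning half of the Poincare-Birkhoff-Witt theorem.  By induction on n, a word
    can be sorted up to lower terms, and a repeated odd letter also lowers the
    degree. *)
Lemma fil_spanned n u : fil n u -> spanned n u.
Proof.
elim/ltn_ind: n u => n IH.
have low m w : (m <= n)%N -> fil_lt m w -> spanned n w.
  case: m => [_ ->|m mn hw]; first exact: spanned0.
  by apply: (spanned_leq (ltnW mn)); exact: IH hw.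
have words s : (size s <= n)%N -> spanned n (mon s).
  move=> sn; have ps : perm_eq s (sort leT s) by rewrite perm_sym perm_sort.
  have [b hb] := mon_perm ps.
  rewrite -(subrK ((-1) ^+ b *: mon (sort leT s)) (mon s)).
  apply: spannedD; first exact: low sn hb.
  apply: spannedZ.
  have [os|[t1 [l [t2 [e dl]]]]] := sorted_ordered (sort_sorted leT_total s).
    by rewrite -[mon _]mul1r -(iota1 h); apply: spanned_mon os _; rewrite size_sort.
  apply: (low (size (sort leT s))); first by rewrite size_sort.
  by rewrite e; exact: mon_odd_dup.
have gen m u y : (m < n)%N -> spanned m u -> spanned n (u * inU y).
  move=> mn.
  apply: (spanned_ind (P := fun w => spanned n (w * inU y))) => [|u' w hu hw|e s os sm].
  - by rewrite mul0r; exact: spanned0.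
  - by rewrite mulrDl; exact: spannedD.
  rewrite -mulrA; apply: spanned_iota; rewrite inU_sub_part mulrDr; apply: spannedD.
    apply: (spanned_leq (ltnW mn)); apply: IH mn _ _.
    by apply: fil_sub; apply: fil_leq sm _; exact: fil_mon.
  rewrite mulr_sumr; apply: big_ind => [|u' w|i _].
  - exact: spanned0.
  - exact: spannedD.
  rewrite -scalerAr; apply: spannedZ; apply: (words (i :: s)).
  exact: leq_ltn_trans sm mn.
have sub u (y : sub_lie h) : spanned n u -> spanned n (u * inU (val y)).
  apply: (spanned_ind (P := fun w => spanned n (w * inU (val y))))
    => [|u' w hu hw|e s os sn].
  - by rewrite mul0r; exact: spanned0.
  - by rewrite mulrDl; exact: spannedD.
  rewrite -mulrA; apply: spanned_iota; case: s os sn => [_ _|l s /= /andP[_ os] sn].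
    rewrite mul1r -iota_inU -[iota _]mulr1.
    exact: (@spanned_mon n (inU y) [::]).
  have hs : spanned (size s) (mon s) by apply: IH sn _ (fil_mon s).
  rewrite -mulrA (inU_comm _ (bas_homog l)) mulrDr; apply: spannedD.
    rewrite mulrA -val_twist; apply: (gen _ _ _ sn); apply: IH sn _ _.
    by apply: fil_sub; exact: fil_mon.
  exact: gen sn hs.
move=> u hu; elim: hu IH low words gen sub => {n u}
  [n e|n u w _ hu _ hw|n y u _ hu|n y u hu _] IH low words gen sub.
- by apply: spannedZ; exact: (words [::]).
- exact: spannedD (hu IH low words gen sub) (hw IH low words gen sub).
- exact/sub/(hu IH low words gen sub).
- by apply: (gen n); last exact: IH hu.
Qed.

Variable V : rep (sub_lie h).
Implicit Type f : seq 'I_r -> V.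

(** The element of the coinduced module with prescribed values on the
    monomials of the ordered words. *)
Definition extension f (u : U g) : V :=
  uact (word_module B V two_neq0) u f [::].

Lemma extension_coind f : coind (extension f).
Proof.
split=> [e u w|y u]; first by rewrite /extension uact_linearl.
by rewrite /extension uactM uact_inU /= wact_sub_nil.
Qed.

Lemma extension_mon f s : ordered s -> extension f (mon s) = f s.
Proof.
rewrite -[mon s]mulr1 => os.
suff H u : extension f (mon s * u) = uact (word_module B V two_neq0) u f s.
  by rewrite H uact1.
elim: s os u => [|l s IH] /= os u; first by rewrite mul1r.
have /andP[ls os'] := os.
by rewrite -mulrA IH // uactM uact_inU /= wact_bas.
Qed.
End Monomials.

(** * p-th powers *)

Section Frobenius.
Variables (k : fieldType) (p : nat) (char_p : p \in [pchar k]).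
Variable A : algType k.
Implicit Types u w : A.

Definition com u w := u * w - w * u.

(** Left multiplication by u is the sum of the commutator with u and of right
    multiplication by u, and the latter two commute. *)
Lemma expr_mul_com u w n :
  u ^+ n * w = \sum_(i < n.+1) ('C(n, i)%:R : k) *: (iter i (com u) w * u ^+ (n - i)).
Proof.
elim: n => [|n IH].
  by rewrite big_ord1 expr0 mul1r mulr1 bin0 scale1r.
rewrite exprS -mulrA IH mulr_sumr [RHS]big_ord_recl /= bin0 scale1r subn0.
pose a i := iter i (com u) w.
have E (i : nat) : u * (('C(n, i)%:R : k) *: (a i * u ^+ (n - i))) =
    ('C(n, i)%:R : k) *: (a i * u ^+ (n - i).+1) +
    ('C(n, i)%:R : k) *: (a i.+1 * u ^+ (n - i)).
  rewrite -scalerAr -scalerDr exprS !mulrA -mulrDl; congr (_ *: (_ * _)).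
  by rewrite [a i.+1]/(com u (a i)) /com addrC subrK.
under eq_bigr => i _ do rewrite E.
rewrite big_split /= big_ord_recl /= bin0 scale1r subn0 -addrA; congr (_ + _).
pose F i := ('C(n, bump 0 i)%:R : k) *: (a (bump 0 i) * u ^+ (n - bump 0 i).+1).
rewrite -(big_mkord xpredT F).
have -> : \sum_(0 <= i < n) F i =
    \sum_(i < n.+1) ('C(n, i.+1)%:R : k) *: (a i.+1 * u ^+ (n - i)).
  rewrite big_ord_recr /= bin_small // scale0r addr0 big_mkord.
  by apply: eq_bigr => i _; rewrite /F /bump /= add1n -subSn ?subSS.
rewrite -big_split /=; apply: eq_bigr => i _.
by rewrite /bump /= add1n binS natrD scalerDl subSS.
Qed.

Lemma com_expr_p u w : com (u ^+ p) w = iter p (com u) w.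
Proof.
have p_pr := pcharf_prime char_p; have p_gt0 := prime_gt0 p_pr.
rewrite /com expr_mul_com (bigD1 ord0) //= bin0 scale1r subn0 addrAC subrr add0r.
have max0 : @ord_max p != ord0 by rewrite -val_eqE /= -lt0n.
rewrite (bigD1 ord_max) //= binn scale1r subnn mulr1 big1 ?addr0 // => i /andP[i0 im].
suff -> : ('C(p, i)%:R : k) = 0 by rewrite scale0r.
apply/eqP; rewrite -(dvdn_pcharf char_p) prime_dvd_bin // lt0n.
have := ltn_ord i; rewrite ltnS leq_eqVlt => /orP[/eqP ip|->]; last by rewrite andbT.
by case/eqP: im; exact: val_inj.
Qed.

Lemma com_expr_pX n u w : com (u ^+ (p ^ n)) w = iter (p ^ n) (com u) w.
Proof.
elim: n u w => [|n IH] u w; first by rewrite expr1.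
rewrite expnSr exprM com_expr_p mulnC iterM.
by apply: eq_iter => v; exact: IH.
Qed.
End Frobenius.

(** * The top monomial *)

Section Top.
Variables (k : fieldType) (p : nat) (char_p : p \in [pchar k]).
Hypothesis two_neq0 : (2%:R : k) != 0.
Variables (g : lie_superalgebra k) (h : lie_subsuperalgebra g).
Variable B : adapted_basis h.
Variable n : nat.
Local Notation r := (rk B).
Local Notation x := (bas B).
Local Notation d := (par B).
Local Notation c := (coo B).
Local Notation fil := (fil h).
Local Notation fil_lt := (fil_lt h).
Local Notation mon := (mon (B := B)).
Local Notation leT := (fun i j : 'I_r => j <= i)%N.
Local Notation q := (p ^ n)%N.
Implicit Types (y z : g) (s t : seq 'I_r).

Let q_gt0 : (0 < q)%N.
Proof. by rewrite expn_gt0 prime_gt0 // (pcharf_prime char_p). Qed.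

Lemma inU_com (l : 'I_r) y : ~~ d l -> com (inU (x l)) (inU y) = inU (br (x l) y) :> U g.
Proof.
by move=> dl; rewrite /com (inU_comm _ (bas_homog l)) (negPf dl) addrC addKr.
Qed.

(** The q-th power of an even basis vector almost commutes with g: the
    commutator is in g, although the power has degree q. *)
Lemma pow_com_fil (l : 'I_r) j u : ~~ d l -> fil j u ->
  fil j.+1 (inU (x l) ^+ q * u - u * inU (x l) ^+ q).
Proof.
move=> dl; have comE y : com (inU (x l) ^+ q) (inU y) = inU (iter q (br (x l)) y) :> U g.
  rewrite (com_expr_pX char_p); move: q => m.
  by elim: m => //= m ->; rewrite inU_com.
have E (a b : U g) : inU (x l) ^+ q * (a * b) - a * b * inU (x l) ^+ q =
    (inU (x l) ^+ q * a - a * inU (x l) ^+ q) * b + a * com (inU (x l) ^+ q) b.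
  by rewrite /com mulrBl mulrBr !mulrA addrA subrK.
elim=> {j u} [j e|j a a' _ ha _ ha'|j y a fa ha|j y a fa ha].
- by rewrite -scalerAr -scalerAl mulr1 mul1r subrr; exact: fil0.
- rewrite mulrDl mulrDr opprD addrACA; exact: fil_add.
- rewrite E comE; apply: fil_add; first exact: fil_sub.
  exact: fil_gen.
- rewrite E comE; apply: fil_add; first exact: fil_gen.
  by apply: fil_leq (fil_gen _ fa); exact: leqnSn.
Qed.

Definition cap (i : 'I_r) : nat := if d i then 1 else q.-1.

(** The highest word whose even letters have exponents less than q; its
    exponents are those of the monomial of highest degree in the quotient of the
    symmetric superalgebra of g/h by the q-th powers of even elements. *)
Definition top : seq 'I_r :=
  sort leT (flatten [seq nseq (cap i) i | i <- enum 'I_r]).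

Lemma count_top i : count_mem i top = cap i.
Proof.
rewrite (permP (permEl (perm_sort leT _))) count_flatten -map_comp sumnE.
rewrite big_map big_enum /= (bigD1 i) //= count_nseq /= eqxx mul1n.
rewrite big1 ?addn0 // => j ji; rewrite count_nseq /=.
by rewrite (negPf ji) mul0n.
Qed.

Lemma top_sorted : sorted leT top.
Proof. by apply: sort_sorted => i j; exact: leq_total. Qed.

Lemma top_ordered : ordered top.
Proof.
by apply: sorted_small_ordered top_sorted _ => l dl; rewrite count_top /cap dl.
Qed.

Variable V : rep (sub_lie h).
Implicit Type v : V.

Definition top_fun v s : V := if s == top then v else 0.
(** The coefficient in U(h) of the top monomial, applied to v. *)
Definition top_coef v : U g -> V := extension two_neq0 (top_fun v).

Lemma top_coefP v : coind (top_coef v).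
Proof. exact: extension_coind. Qed.
Lemma top_coefD v u w : top_coef v (u + w) = top_coef v u + top_coef v w.
Proof. by have := proj1 (top_coefP v) 1 u w; rewrite !scale1r. Qed.
Lemma top_coef0 v : top_coef v 0 = 0.
Proof. exact: linear_fun0 (proj1 (top_coefP v)). Qed.
Lemma top_coefZ v e u : top_coef v (e *: u) = e *: top_coef v u.
Proof. by have := proj1 (top_coefP v) e u 0; rewrite top_coef0 !addr0. Qed.

Lemma top_coefPl e v w u :
  top_coef (e *: v + w) u = e *: top_coef v u + top_coef w u.
Proof.
rewrite /top_coef /extension.
have -> : top_fun (e *: v + w) = e *: top_fun v + top_fun w.
  apply/funext => s.
  have -> : (e *: top_fun v + top_fun w) s = e *: top_fun v s + top_fun w s by [].
  by rewrite /top_fun; case: eqP; rewrite // scaler0 addr0.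
by rewrite uact_linear.
Qed.

Lemma top_coef0l u : top_coef 0 u = 0.
Proof.
have := top_coefPl (-1) 0 0 u.
by rewrite scaleN1r oppr0 addr0 scaleN1r addNr.
Qed.

Lemma top_coef_ordered v s : ordered s ->
  top_coef v (mon s) = if s == top then v else 0.
Proof. exact: extension_mon. Qed.

Lemma top_coef_lt v u : fil_lt (size top) u -> top_coef v u = 0.
Proof.
case E : (size top) => [|m] /=; first by move=> ->; exact: top_coef0.
move/(fil_spanned B two_neq0).
move: u; apply: spanned_ind => [|u w hu hw|e s os sm].
- exact: top_coef0.
- by rewrite top_coefD hu hw addr0.
rewrite (coind_iota _ _ (top_coefP v)) top_coef_ordered //.
by case: eqP sm => [->|_]; rewrite ?E ?ltnn ?linear0.
Qed.

Lemma top_coef_perm s t : perm_eq s t -> (size s <= size top)%N ->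
  exists b : bool, forall v, top_coef v (mon s) = (-1) ^+ b *: top_coef v (mon t).
Proof.
move=> st sm; have [b hb] := mon_perm st; exists b => w.
rewrite -(subrK ((-1) ^+ b *: mon t) (mon s)) top_coefD top_coefZ.
rewrite top_coef_lt ?add0r //; move: sm hb; rewrite leq_eqVlt => /orP[/eqP-> //|].
case: (size top) => // m; rewrite ltnS => sm hb; case: (size s) sm hb => [_ ->|i im hb].
  exact: fil0.
by apply: fil_leq hb; exact: ltnW.
Qed.

Lemma fil_lt_leq m m' u : (m <= m')%N -> fil_lt m u -> fil_lt m' u.
Proof.
case: m => [_ /= ->|m]; first exact: fil_lt0.
by case: m' => // m' mm' /=; exact: fil_leq.
Qed.

Lemma top_coef_word v s : (size s <= size top)%N -> ~~ perm_eq s top ->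
  top_coef v (mon s) = 0.
Proof.
move=> sm ntop; have ps : perm_eq s (sort leT s) by rewrite perm_sym perm_sort.
have [b ->] := top_coef_perm ps sm.
have ss : sorted leT (sort leT s) by apply: sort_sorted => i j; exact: leq_total.
have [os|[t1 [l [t2 [e dl]]]]] := sorted_ordered ss.
  rewrite top_coef_ordered //; case: eqP => [e|_]; last exact: scaler0.
  by rewrite -e ps in ntop.
rewrite top_coef_lt ?scaler0 //; apply: (@fil_lt_leq (size (sort leT s))).
  by rewrite size_sort.
by rewrite e; exact: mon_odd_dup.
Qed.

(** The q-th powers of the even basis vectors act as zero on degrees which
    may exceed that of the top monomial by almost q: the power can be carried
    next to the other factors x_l, which produces a word of exponent at least q,
    and the commutators on the way have degree less than that of the top. *)
Lemma top_coef_pow v (l : 'I_r) i j u w : ~~ d l -> fil i u -> fil j w ->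
  (i + j + 2 <= size top)%N -> top_coef v (u * inU (x l) ^+ q * w) = 0.
Proof.
move=> dl; set X := inU (x l) ^+ q.
have low m (u' w' : U g) i' j' : fil i' u' -> fil j' w' -> (i' + j' + 2 <= m)%N ->
    fil_lt m (u' * X * w' - u' * w' * X).
  move=> hu hw ijm; rewrite -!mulrA -mulrBr.
  apply: (@fil_lt_leq (i' + j' + 2)) => //.
  rewrite -[(_ + _ + 2)%N]/((i' + j' + 2)%N) addn2 /= -addnS.
  by apply: fil_mul hu _; exact: pow_com_fil.
have ord s : ordered s -> (size s + 2 <= size top)%N -> top_coef v (mon s * X) = 0.
  move=> os sm.
  pose t := sort leT (nseq q l ++ s).
  have pt : perm_eq t (nseq q l ++ s) by exact/permEl/perm_sort.
  have st : sorted leT t by apply: sort_sorted => a b; exact: leq_total.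
  have ct e : count_mem e t = ((l == e) * q + count_mem e s)%N.
    by rewrite (permP pt) count_cat count_nseq.
  have ot : ordered t.
    apply: sorted_small_ordered st _ => e de; rewrite ct.
    case: eqVneq => [ele|_]; first by rewrite ele de in dl.
    by rewrite mul0n add0n ordered_odd.
  have [s1 [s2 et]] := sorted_split l st.
  pose m := count_mem l s.
  have cl : count_mem l t = (q + m)%N by rewrite ct eqxx mul1n.
  pose s' := s1 ++ nseq m l ++ s2.
  have es : s = s'.
    apply: ordered_perm os _ _.
      apply: sorted_small_ordered.
        apply: subseq_sorted st; first exact: leT_trans.
        rewrite et cl; apply: cat_subseq (subseq_refl _) _.
        apply: cat_subseq (subseq_refl _); rewrite addnC nseqD.
        exact: prefix_subseq.
      move=> e de; apply: leq_trans (ordered_odd ot de).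
      by rewrite et !count_cat !count_nseq cl; nia.
    rewrite -(perm_cat2l (nseq q l)) -(permPl pt) et cl nseqD.
    by apply/permP => a; rewrite /s' !count_cat [RHS]addnCA -!addnA.
  rewrite -[mon s * X](subrK (mon t)) top_coefD top_coef_ordered //.
  have -> : (t == top) = false.
    apply/eqP => tt; have := count_top l; rewrite -tt cl /cap (negPf dl).
    by have := q_gt0; lia.
  rewrite addr0 top_coef_lt //.
  have -> : mon t = mon (nseq m l ++ s2) * X * mon s1.
    by rewrite et cl addnC !mon_cat !mon_nseq exprD !mulrA.
  rewrite es /s' mon_cat -opprB; move: sm; rewrite es /s' !size_cat => sm.
  rewrite -[- _]scaleN1r; apply: fil_ltZ.
  apply: (low _ _ _ _ _ (fil_mon _) (fil_mon _)).
  by rewrite size_cat; lia.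
move=> dl_u hw ijm.
rewrite -(subrK (u * w * X) (u * X * w)) top_coefD top_coef_lt ?add0r; last first.
  exact: (low _ _ _ _ _ dl_u hw ijm).
have := fil_spanned B two_neq0 (fil_mul dl_u hw).
apply: (spanned_ind (P := fun w => top_coef v (w * X) = 0)) => [|a b ha hb|e s os sm].
- by rewrite mul0r top_coef0.
- by rewrite mulrDl top_coefD ha hb addr0.
rewrite -mulrA (coind_iota _ _ (top_coefP v)) ord ?linear0 //.
by apply: leq_trans ijm; rewrite leq_add2r.
Qed.

Lemma top_coef_big v s l (y : sub_lie h) : ~~ d l -> ordered s ->
  (q <= count_mem l s)%N -> (size s + 2 <= size top + q)%N ->
  top_coef v (mon s * inU (val y)) = 0.
Proof.
move=> dl /ordered_sorted os qs sm; have [s1 [s2 es]] := sorted_split l os.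
have e : mon s * inU (val y) =
    mon (nseq (count_mem l s - q) l ++ s2) * inU (x l) ^+ q * (mon s1 * inU (val y)).
  rewrite {1}es !mon_cat !mon_nseq -[in LHS](subnK qs) exprD.
  by rewrite !mulrA.
rewrite e; apply: (top_coef_pow v dl (fil_mon _) (fil_sub _ (fil_mon s1))).
by move: sm; rewrite {1}es !size_cat !size_nseq; lia.
Qed.

(** The factor y put in place of a letter of the top word contributes through
    its component along that letter alone. *)
Lemma top_coef_subst v w1 l w2 y : top = w1 ++ l :: w2 ->
  top_coef v (mon w2 * inU y * mon w1) = c l y *: v.
Proof.
move=> et; rewrite (inU_sub_part B) mulrDr mulrDl top_coefD top_coef_lt ?add0r; last first.
  have -> : size top = (size w2 + size w1).+1 by rewrite et size_cat /= addnS addnC.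
  exact: fil_mul (fil_sub _ (fil_mon w2)) (fil_mon w1).
have word i : mon w2 * inU (x i) * mon w1 = mon (w1 ++ i :: w2) by rewrite mon_cat.
rewrite mulr_sumr mulr_suml (big_morph _ (top_coefD v) (top_coef0 v)).
rewrite (bigD1 l) //= -scalerAr -scalerAl top_coefZ word -et.
rewrite top_coef_ordered ?top_ordered // eqxx big1 ?addr0 // => i il.
rewrite -scalerAr -scalerAl top_coefZ word top_coef_word ?scaler0 //.
  by rewrite et !size_cat.
rewrite et perm_cat2l; apply/negP => /permP /(_ (pred1 i)) /=.
by rewrite eqxx [l == i]eq_sym (negPf il); lia.
Qed.

Definition word_par s : bool := foldr (fun l => addb (d l)) false s.

Definition top_char y : k := \sum_(l <- top) c l (br (x l) y).

Lemma coo_br_twist a l y : c l (br (x l) (twist a y)) = c l (br (x l) y).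
Proof.
have br0 : c l (br (x l) (part true y)) = 0.
  apply: (coo_homog (br_homog (bas_homog l) (homog_part true y))).
  by case: (d l).
case: a; rewrite // /twist -[in RHS](part_sum y) linearB linearD cooB cooD br0.
by rewrite subr0 addr0.
Qed.

Lemma top_coef_top v (y : sub_lie h) :
  top_coef v (mon top * inU (val y)) =
    act (twist (word_par top) y) v + top_char (val y) *: v.
Proof.
suff H w2 w1 (z : sub_lie h) : top = w1 ++ w2 ->
    top_coef v (mon w2 * inU (val z) * mon w1) =
    act (twist (word_par w2) z) v +
    (\sum_(l <- w2) c l (br (x l) (val z))) *: v.
  by have := H top [::] y erefl; rewrite mulr1.
elim: w2 w1 z => [|l w2 IH] w1 z et.
  rewrite big_nil scale0r addr0 mul1r.
  have [_ eqv] := top_coefP v; rewrite eqv.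
  by rewrite cats0 in et; rewrite -et top_coef_ordered ?top_ordered ?eqxx.
have -> : mon (l :: w2) * inU (val z) * mon w1 =
    mon w2 * inU (val (twist (d l) z)) * mon (rcons w1 l) +
    mon w2 * inU (br (x l) (val z)) * mon w1.
  rewrite -cats1 mon_cat /= mul1r -[mon w2 * _ * inU _]mulrA.
  rewrite (inU_comm _ (bas_homog l)) mulrDr mulrDl val_twist.
  by rewrite !mulrA.
rewrite top_coefD IH ?cat_rcons // (top_coef_subst _ _ et) big_cons twist_add.
rewrite /= [d l (+) _]addbC -addrA; congr (_ + _).
rewrite addrC scalerDl; congr (_ + _ *: _).
by apply: eq_bigr => i _; rewrite val_twist coo_br_twist.
Qed.

(** * The annihilator of the coinduced module *)

Variables (chi : lie_character (sub_lie h)) (e0 : k).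
Hypothesis top_charE : forall y : sub_lie h, top_char (val y) = e0 * chi y.

Definition top_module : lie_module (sub_lie h) :=
  shifted_module V chi e0 (word_par top).

(** In the degrees considered, an ordered word either has an even exponent at least
    q, and does not contribute, or divides the top word; it is then the top word,
    where the trace appears, or of smaller degree, where both sides vanish. *)
Lemma top_coef_sub v w (y : sub_lie h) N : (N + 2 <= q)%N ->
  fil (size top + N) w ->
  top_coef v (w * inU (val y)) = top_coef (lact (l := top_module) y v) w.
Proof.
move=> Nq /(fil_spanned B two_neq0).
apply: (spanned_ind (P := fun w => top_coef v (w * inU (val y)) =
  top_coef (lact (l := top_module) y v) w)) => [|a b ha hb|e s os sm].
- by rewrite mul0r !top_coef0.
- by rewrite mulrDl !top_coefD ha hb.
rewrite -mulrA !(coind_iota _ _ (top_coefP _)).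
suff -> : top_coef v (mon s * inU (val y)) =
    top_coef (lact (l := top_module) y v) (mon s) by [].
rewrite top_coef_ordered //; case: eqP => [->|/eqP stop].
  by rewrite top_coef_top top_charE.
have [/existsP[l /andP[dl ql]]|big] :=
    boolP [exists l, ~~ d l && (q <= count_mem l s)%N].
  by apply: top_coef_big dl os ql _; lia.
have fits l : (count_mem l s <= count_mem l top)%N.
  rewrite count_top /cap; case: ifP => dl; first exact: ordered_odd os dl.
  move: big; rewrite negb_exists => /forallP /(_ l); rewrite dl /= -ltnNge.
  by rewrite -{1}(prednK q_gt0) ltnS.
have ss : (size s < size top)%N.
  have [t st pt] := proj1 (count_subseqP s top) fits.
  rewrite (perm_size pt) ltn_neqAle size_subseq // andbT.
  apply: contraNneq stop => et; apply/eqP; apply: ordered_perm os top_ordered _.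
  by have /eqP <- : t == top by rewrite -(size_subseq_leqif st) et.
apply: top_coef_lt; apply: (fil_lt_leq ss).
exact: fil_sub (fil_mon s).
Qed.

Lemma top_coef_iota v w e N : (N + 2 <= q)%N -> fil (size top + N) w ->
  top_coef v (w * iota e) = top_coef (uact top_module e v) w.
Proof.
move=> Nq; elim/U_left_ind: e w v => [|a e e' he he'|a y e hy he] w v hw.
- by rewrite iota1 mulr1 uact1.
- rewrite iota_linear mulrDr -scalerAr top_coefD top_coefZ he // he' //.
  by rewrite uactD uactZ top_coefPl.
rewrite iotaM iota_inU mulrA he; last exact: fil_sub.
by rewrite (top_coef_sub _ _ Nq hw) uactM uact_inU.
Qed.

Lemma top_complement N s : (N < q)%N -> ordered s -> (size s <= N)%N ->
  exists t, perm_eq (s ++ t) top.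
Proof.
move=> Nq os sN.
have [|t st pt] := proj1 (count_subseqP s top).
  move=> l; rewrite count_top /cap; case: ifP => dl; first exact: ordered_odd.
  rewrite -ltnS (prednK q_gt0).
  exact: leq_ltn_trans (count_size _ _) (leq_ltn_trans sN Nq).
have [t' ptt'] := perm_to_subseq st; exists t'.
by rewrite perm_sym; apply: perm_trans ptt' _; rewrite perm_cat2r perm_sym.
Qed.

(** An element of the annihilator of the coinduced module, written with its
    coefficients on the right, has all of them in the kernel of the twist of V:
    the coefficient of s is isolated by multiplying on the left by the
    monomial complementary to s and taking the coefficient of the top.  The longer
    words, for which this is already known, do not contribute; the shorter
    ones do not reach the degree of the top. *)
Lemma coind_ker_coef N (e : seq 'I_r -> U (sub_lie h)) : (N + 2 <= q)%N ->
  coind_ker V (\sum_(b : N.-bseq 'I_r | ordered b) mon (rev b) * iota (e b)) ->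
  forall s, ordered s -> (size s <= N)%N -> forall v, uact top_module (e s) v = 0.
Proof.
move=> Nq ker s os sN; have [j] := ubnP (N - size s)%N.
elim: j s os sN => // j IH s os sN; rewrite ltnS => sj v.
have [|t pt] := top_complement _ os sN; first by lia.
have pst : perm_eq (rev s ++ t) top.
  by apply: perm_trans pt; rewrite perm_cat2r perm_rev.
have szt : (size s + size t)%N = size top by rewrite -(perm_size pt) size_cat.
have := congr1 (fun f => f (mon t)) (ker _ (top_coefP v)); rewrite /coind_act /=.
rewrite [X in _ = X]/(0 : V) mulr_sumr (big_morph _ (top_coefD v) (top_coef0 v)).
have term (b : N.-bseq 'I_r) : top_coef v (mon t * (mon (rev b) * iota (e b))) =
    top_coef (uact top_module (e b) v) (mon (rev b ++ t)).
  rewrite mulrA -mon_cat (top_coef_iota _ _ Nq) //.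
  apply: fil_leq (fil_mon _); rewrite size_cat size_rev addnC.
  by apply: leq_add (size_bseq b); rewrite -szt leq_addl.
rewrite (bigD1 (Bseq sN)) //= [X in X + _](term (Bseq sN)).
rewrite big1 => [|b /andP[ob bs]]; last first.
  rewrite term; have [lt_bs|lt_sb|eq_bs] := ltngtP (size b) (size s).
  - rewrite top_coef_word // ?size_cat ?size_rev -?szt ?leq_add2r ?(ltnW lt_bs) //.
    apply/negP => /perm_size; rewrite size_cat size_rev -szt => /addIn e1.
    by rewrite e1 ltnn in lt_bs.
  - rewrite IH ?top_coef0l ?size_bseq //; apply: leq_trans sj.
    by apply: ltn_sub2l (leq_trans lt_sb (size_bseq b)) lt_sb.
  rewrite top_coef_word // ?size_cat ?size_rev -?szt ?eq_bs //.
  apply: contra bs => pb; apply/eqP/val_inj => /=; apply: ordered_perm ob os _.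
  rewrite -(perm_cat2r t) perm_sym; apply: perm_trans pt _; rewrite perm_sym.
  by apply: perm_trans pb; rewrite perm_cat2r perm_sym perm_rev.
have [|a ha] := top_coef_perm pst; first by rewrite size_cat size_rev szt.
rewrite addr0 /=.
rewrite ha top_coef_ordered ?top_ordered // eqxx => /eqP.
by rewrite scaler_eq0 signr_eq0 /= => /eqP.
Qed.
End Top.

(** * The antipode *)

Section AntipodeTheory.
Variables (k : fieldType) (L : lie_superalgebra k).
Local Notation UL := (U_space L).
Implicit Types (u w : U L) (a b : bool).

Definition utwist a u : U L := @twist k UL a u.

Lemma utwist_linear a : linear (utwist a).
Proof. exact: (@twist_linear k UL a). Qed.
HB.instance Definition _ a :=
  GRing.isLinear.Build k (U L) (U L) *:%R (utwist a) (utwist_linear a).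

Lemma utwist_add a b u : utwist a (utwist b u) = utwist (a (+) b) u.
Proof. exact: (@twist_add k UL). Qed.

Lemma utwist_homog a b u : @homog k UL b u -> utwist a u = (-1) ^+ (a && b) *: u.
Proof. exact: (@twist_homog k UL). Qed.

Lemma utwistM a u w : utwist a (u * w) = utwist a u * utwist a w.
Proof.
move: u; apply: (@linear_homog_ext k UL) => [c u u'|c u u'|b u hu].
- by rewrite mulrDl -scalerAl [LHS]linearP.
- by rewrite utwist_linear mulrDl -scalerAl.
move: w; apply: (@linear_homog_ext k UL) => [c w w'|c w w'|b' w hw].
- by rewrite mulrDr -scalerAr [LHS]linearP.
- by rewrite utwist_linear mulrDr -scalerAr.
rewrite (utwist_homog a hu) (utwist_homog a hw) (utwist_homog a (U_homogM hu hw)).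
rewrite -scalerAl -scalerAr scalerA -signr_addb.
by case: a b b' {hu hw} => [] [] [].
Qed.

Lemma utwist_inU a x : utwist a (inU x) = inU (twist a x).
Proof.
move: x; apply: linear_homog_ext => [c x y|c x y|b x hx].
- by rewrite linearP [LHS]linearP.
- by rewrite twist_linear [LHS]linearP.
by rewrite (utwist_homog a (inU_homog hx)) (twist_homog a hx) linearZ.
Qed.

Lemma utwist1 a : utwist a 1 = 1.
Proof.
have h1 : @homog k UL false (1 : U L) by rewrite -[1]scale1r; exact: U_homog1.
by rewrite (utwist_homog a h1) andbF scale1r.
Qed.

Lemma antipode_homog a u : @homog k UL a u -> @homog k UL a (antipode u).
Proof. by move=> hu; rewrite /homog [LHS]antipode_part [env_part _ _]hu. Qed.

Lemma antipode_twist a u : antipode (utwist a u) = utwist a (antipode u).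
Proof.
exact: (linear_twist (V := UL) (W := UL) (@antipode_linear k L) antipode_homog).
Qed.

Lemma antipode_mull a u w : @homog k UL a u ->
  antipode (u * w) = utwist a (antipode w) * antipode u.
Proof.
move=> hu; move: w; apply: (@linear_homog_ext k UL) => [c w w'|c w w'|b w hw].
- by rewrite mulrDr -scalerAr antipode_linear.
- by rewrite antipode_linear utwist_linear mulrDl -scalerAl.
by rewrite (antipodeM hu hw) (utwist_homog a (antipode_homog hw)) scalerAl.
Qed.

Lemma antipode_mulr b u w : @homog k UL b w ->
  antipode (u * w) = antipode w * utwist b (antipode u).
Proof.
move=> hw; move: u; apply: (@linear_homog_ext k UL) => [c u u'|c u u'|a u hu].
- by rewrite mulrDl -scalerAl antipode_linear.
- by rewrite antipode_linear utwist_linear mulrDr -scalerAr.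
rewrite (antipodeM hu hw) (utwist_homog b (antipode_homog hu)) scalerAr.
by rewrite andbC.
Qed.

Lemma env_part1 a : env_part a (1 : U L) = if a then 0 else 1.
Proof. by have := env_part_scal L a 1; rewrite scale1r. Qed.

Lemma antipode1 : antipode (1 : U L) = 1.
Proof. by rewrite -[1]scale1r antipode_scal. Qed.

Lemma antipodeK : involutive (@antipode k L).
Proof.
move=> u; elim/U_left_ind: u => [|c u w hu hw|a x u hx hu].
- by rewrite !antipode1.
- by rewrite !antipode_linear hu hw.
have hx' := antipode_homog (inU_homog hx).
rewrite (antipode_mull _ (inU_homog hx)) (antipode_mulr _ hx').
rewrite antipode_twist utwist_add addbb [utwist false _]/= hu.
rewrite antipode_inU -scaleN1r -[_ *: _]addr0 antipode_linear.
rewrite (linear_fun0 (@antipode_linear k L)) antipode_inU addr0 scaleN1r opprK.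
by [].
Qed.
End AntipodeTheory.

Section AntipodeSub.
Variables (k : fieldType) (g : lie_superalgebra k) (h : lie_subsuperalgebra g).
Local Notation UL := (U_space (sub_lie h)).
Local Notation Ug := (U_space g).

Lemma env_part_iota a (e : U (sub_lie h)) :
  env_part a (iota e) = iota (env_part a e).
Proof.
elim/U_left_ind: e a => [|c e e' he he'|b y e hy he] a.
- by rewrite iota1 !env_part1; case: a; rewrite ?linear0 ?iota1.
- by rewrite iota_linear !env_part_linear iota_linear he he'.
rewrite iotaM iota_inU !env_partM !big_bool !env_part_inU raddfD /= !iotaM.
by rewrite !iota_inU !he.
Qed.

Lemma iota_homog a (e : U (sub_lie h)) : @homog k UL a e -> @homog k Ug a (iota e).
Proof. by move=> he; rewrite /homog [LHS]env_part_iota [env_part _ _]he. Qed.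

Lemma iota_twist a (e : U (sub_lie h)) : iota (utwist a e) = utwist a (iota e).
Proof.
exact: (linear_twist (V := UL) (W := Ug) (@iota_linear k g h) iota_homog).
Qed.

Lemma antipode_iota (e : U (sub_lie h)) : antipode (iota e) = iota (antipode e).
Proof.
elim/U_left_ind: e => [|c e e' he he'|b y e hy he].
- by rewrite iota1 !antipode1 iota1.
- by rewrite iota_linear !antipode_linear iota_linear he he'.
have hy' := proj1 (sub_lie_homog _ _) hy.
rewrite iotaM iota_inU (antipode_mull _ (inU_homog hy')) he.
rewrite (antipode_mull _ (inU_homog hy)) iotaM iota_twist !antipode_inU.
by rewrite raddfN /= iota_inU.
Qed.

Lemma mon_homog (B : adapted_basis h) (s : seq 'I_(rk B)) :
  exists a, @homog k Ug a (mon s).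
Proof.
elim: s => [|i t [a ha]].
  by exists false; rewrite -[mon _]scale1r; exact: U_homog1.
by exists (a (+) par B i); exact: U_homogM ha (inU_homog (bas_homog i)).
Qed.

Lemma antipode_mon (B : adapted_basis h) (s : seq 'I_(rk B)) :
  exists b : bool, antipode (mon s) = (-1) ^+ b *: mon (rev s).
Proof.
elim: s => [|l s [b IH]]; first by exists false; rewrite antipode1 scale1r.
have [a ha] := mon_homog (rev s).
exists (true (+) (par B l && a) (+) b).
rewrite /= (antipode_mulr _ (inU_homog (bas_homog l))) IH linearZ /=.
rewrite (utwist_homog _ ha) antipode_inU rev_cons -cats1 mon_cat /= mul1r.
rewrite -!scalerAr mulNr -scaleN1r !scalerA; congr (_ *: _).
by case: (b); case: (_ && _); rewrite /= ?expr0 ?expr1; ring.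
Qed.

Section CoindTwist.
Variable V : rep (sub_lie h).

(** Conjugation by the parity involutions preserves the coinduced module, so that
    its annihilator is graded. *)
Lemma coind_ker_twist a u : coind_ker V u -> coind_ker V (utwist a u).
Proof.
move=> ker mu [lin eqv]; apply/funext => w; rewrite /coind_act.
pose nu u := twist a (mu (utwist a u)).
have cnu : coind nu.
  split=> [c u1 u2|y u1]; rewrite /nu; first by rewrite utwist_linear lin linearP.
  rewrite utwistM utwist_inU -val_twist eqv -act_twist twistK.
  by [].
have := congr1 (fun f => f (utwist a w)) (ker nu cnu).
rewrite /coind_act /nu utwistM utwist_add addbb [utwist false w]/=.
move=> /(congr1 (twist a)); rewrite twistK => ->.
by rewrite [X in twist a X]/(0 : V) linear0.
Qed.

Lemma coind_ker_mulr u w : coind_ker V u -> coind_ker V (u * w).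
Proof.
move=> ker mu cmu; have := ker _ (coind_act_coind w cmu).
move=> H; apply/funext => z; have := congr1 (fun f => f z) H.
by rewrite /coind_act mulrA.
Qed.
End CoindTwist.

(** Since the annihilator is graded and a right ideal, it contains, with u, the
    elements whose antipodes are the products w * antipode u. *)
Lemma antipode_coind_ker (V W : rep (sub_lie h)) :
  (forall u nu, coind_ker V u -> coind (V := W) nu -> nu (antipode u) = 0) ->
  forall u, coind_ker V u -> coind_ker W (antipode u).
Proof.
move=> H u ker nu cnu; apply/funext => w; rewrite /coind_act.
have [lin _] := cnu.
suff: (fun w => nu (w * antipode u)) =1 (fun=> 0) by move/(_ w).
apply: (@linear_homog_ext k Ug W) => [c v v'|c v v'|b v hv].
- by rewrite mulrDl -scalerAl lin.
- by rewrite scaler0 addr0.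
have -> : v * antipode u = antipode (utwist b u * antipode v).
  rewrite (antipode_mulr _ (antipode_homog hv)) antipodeK antipode_twist.
  by rewrite utwist_add addbb.
by apply: H cnu; apply: coind_ker_mulr; exact: coind_ker_twist.
Qed.
End AntipodeSub.

(** * Duality *)

Section ShiftedTheory.
Variables (k : fieldType) (L : lie_superalgebra k) (W : rep L).
Variables (chi : lie_character L).

Lemma uact_shifted0 u (w : W) :
  uact (shifted_module W chi 0 false) u w = uact (rep_module W) u w.
Proof.
elim/U_left_ind: u w => [|c u u' hu hu'|a y u hy hu] w.
- by rewrite !uact1.
- by rewrite !uactD !uactZ hu hu'.
- by rewrite !uactM !uact_inU hu /= /shifted_act /= mul0r scale0r addr0.
Qed.

Variables (e : k) (m : bool).

Lemma shifted_act_homog a b y (w : W) : homog a y -> homog b w ->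
  homog (a (+) b) (shifted_act chi e m y w).
Proof.
move=> hy hw; apply: homogD; first exact: act_homog (homog_twist m hy) hw.
case: a hy => hy; last exact: homogZ.
by rewrite (character_odd chi hy) mulr0 scale0r; exact: homog0.
Qed.

Lemma uact_shifted_twist a u (w : W) :
  uact (shifted_module W chi e m) (utwist a u) (twist a w) =
    twist a (uact (shifted_module W chi e m) u w).
Proof.
elim/U_left_ind: u w => [|c u u' hu hu'|b y u hy hu] w.
- by rewrite utwist1 !uact1.
- rewrite utwist_linear !uactD !uactZ hu hu' [RHS]raddfD /=.
  by rewrite [twist a (_ *: _)]linearZ.
rewrite utwistM utwist_inU !uactM !uact_inU hu /= /shifted_act.
by rewrite character_twist twistC act_twist linearD linearZ.
Qed.

Lemma uact_shifted_ker a u : (forall w, uact (shifted_module W chi e m) u w = 0) ->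
  forall w, uact (shifted_module W chi e m) (utwist a u) w = 0.
Proof.
move=> ker w; rewrite -[w](twistK a) uact_shifted_twist ker; exact: linear0.
Qed.
End ShiftedTheory.

(** Algebraic Hahn-Banach: linear forms separate the vectors of any vector
    space.  A subspace maximal among those avoiding v is a complement of the
    line of v. *)
Lemma separating_form (k : fieldType) (V : lmodType k) (v : V) : v <> 0 ->
  exists2 f : V -> k^o, linear f & f v = 1.
Proof.
move=> v0; pose sub (X : set V) := (exists2 x, X x & True) ->
  (forall (c : k) x y, X x -> X y -> X (c *: x + y)) /\ ~ X v.
have [A [subA maxA]] : exists A : set V, sub A /\ forall B, A `<` B -> ~ sub B.
  apply: Zorn_bigcup => F Fsub tot [x [X FX Xx] _]; split.
    move=> c y z [Y FY Yy] [Z FZ Zz].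
    have [YZ|ZY] := tot _ _ FY FZ.
      have [cl _]  := Fsub _ FZ (ex_intro2 _ _ _ Zz I).
      by exists Z => //; apply: cl => //; exact: YZ.
    have [cl _]  := Fsub _ FY (ex_intro2 _ _ _ Yy I).
    by exists Y => //; apply: cl => //; exact: ZY.
  by move=> [Y FY Yv]; have [_ nYv] := Fsub _ FY (ex_intro2 _ _ _ Yv I).
have A0 : A 0.
  apply: contrapT => nA0; apply: (maxA [set 0]).
    split=> [x Ax|sAx]; last by apply: nA0; exact: sAx.
    case: nA0; have [cl _] := subA (ex_intro2 _ _ _ Ax I).
    by rewrite -(addNr x) -scaleN1r; exact: cl.
  move=> _; split=> [c x y -> ->|e]; first by rewrite /= scaler0 addr0.
  by apply: v0.
have [cl nAv] := subA (ex_intro2 _ _ _ A0 I).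
have clZ c x : A x -> A (c *: x).
  by move=> Ax; rewrite -[_ *: _]addr0; exact: cl.
have clD x y : A x -> A y -> A (x + y).
  by move=> Ax Ay; rewrite -[x]scale1r; exact: cl.
have cover x : exists c : k, A (x - c *: v).
  have [Ax|nAx] := pselect (A x); first by exists 0; rewrite scale0r subr0.
  pose X := [set y | exists c, A (y - c *: x)].
  have [c Ayc] : X v.
    apply: contrapT => nXv; apply: (maxA X); last first.
      move=> _; split=> // c y z [c1 Ay] [c2 Az]; exists (c * c1 + c2).
      have -> : c *: y + z - (c * c1 + c2) *: x = c *: (y - c1 *: x) + (z - c2 *: x).
        by rewrite scalerBr scalerA scalerDl opprD addrACA.
      exact: cl.
    split=> [y Ay|XA]; first by exists 0; rewrite scale0r subr0.
    by apply/nAx/XA; exists 1; rewrite scale1r subrr.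
  have c0 : c != 0.
    by apply/eqP => c0; move: Ayc; rewrite c0 scale0r subr0.
  exists c^-1; have -> : x - c^-1 *: v = (- c^-1) *: (v - c *: x).
    by rewrite scalerBr scalerA mulNr mulVf // scaleN1r opprK addrC scaleNr.
  exact: clZ.
have uniq x c c' : A (x - c *: v) -> A (x - c' *: v) -> c = c'.
  move=> Ac Ac'; apply/eqP; apply: contrapT => /negP ne; apply: nAv.
  have -> : v = (c' - c)^-1 *: (x - c *: v + (-1) *: (x - c' *: v)).
    rewrite scaleN1r opprB [X in _ *: X]addrC addrA subrK -scalerBl scalerA mulVf ?scale1r //.
    by rewrite subr_eq0 eq_sym.
  exact/clZ/clD/clZ.
exists (fun x => sval (cid (cover x))).
  move=> a x y; case: (cid (cover (a *: x + y))) => c Ac /=.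
  case: (cid (cover x)) => cx Ax /=; case: (cid (cover y)) => cy Ay /=.
  apply: (uniq _ _ _ Ac).
  have -> : a *: x + y - (a * cx + cy) *: v = a *: (x - cx *: v) + (y - cy *: v).
    by rewrite scalerBr scalerA scalerDl opprD addrACA.
  exact: cl.
case: (cid (cover v)) => c Ac /=; apply: (uniq _ _ _ Ac).
by rewrite scale1r subrr.
Qed.

Section Duality.
Variables (k : fieldType) (L : lie_superalgebra k) (V W : rep L).
Variable chi : lie_character L.

(** W plays the role of a line of unspecified parity on which L acts by chi. *)
Hypothesis act_chi : forall y (w : W), act y w = chi y *: w.
Local Notation T := (tensor (contragredient V) W).
Local Notation Vd := (dual_space V).
Local Notation ev f := (dual_fun (f : dual_sort V)).

Variables (e1 e2 : k) (m1 m2 : bool).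
Hypothesis e12 : e1 + e2 = -1.
Local Notation A := (shifted_module V chi e1 m1).
Local Notation B := (shifted_module T chi e2 m2).

Definition transpose (u : U L) (f : Vd) : Vd :=
  dual_precomp (V := V) (phi := uact A u) (@uact_linear k L A u) f.

Lemma transposeE u f v : ev (transpose u f) v = ev f (uact A u v).
Proof. by []. Qed.

Lemma transposeM u w f : transpose (u * w) f = transpose w (transpose u f).
Proof. by apply: dual_eqP => v; rewrite !transposeE uactM. Qed.

Lemma transpose_homog a c y f : homog a y -> homog c f ->
  homog (c (+) a) (transpose (inU y) f).
Proof.
move=> hy hf; apply/dual_homogP => b v hv ne; rewrite transposeE uact_inU.
apply: (proj1 (dual_homogP _ _) hf (a (+) b)).
  exact: shifted_act_homog.
by apply: contraNneq ne => ->; rewrite addbC addbA addbb.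
Qed.

Lemma pureZ c (f : Vd) (w : W) : pure (c *: f) w = c *: pure f w.
Proof.
have := pure_linearl w c f 0.
by rewrite (linear_fun0 (pure_linearl w)) !addr0.
Qed.

Lemma pureZr c (f : Vd) (w : W) : pure f (c *: w) = c *: pure f w.
Proof.
have := pure_linearr f c w 0.
by rewrite (linear_fun0 (pure_linearr f)) !addr0.
Qed.

(** The sign of the contragredient action on f amounts to a twist by the parity of
    f, and the shifts of the two sides by chi make up for the action on w. *)
Lemma lact_dual a c y (f : Vd) (w : W) : homog a y -> homog c f ->
  lact (l := B) y (pure f w) =
    - pure (transpose (inU (twist (c (+) (m1 (+) m2)) y)) f) w.
Proof.
move=> hy hf; rewrite -[LHS]/(shifted_act (W := T) chi e2 m2 y (pure f w)).
rewrite /shifted_act.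
have EP : act (twist m2 y) (pure f w : T) =
    pure (dual_act (twist m2 y) f) w + (-1) ^+ (a && c) *: pure f (act (twist m2 y) w).
  exact: (@tensor_act_pure k L (contragredient V) W a c _ f w (homog_twist m2 hy) hf).
rewrite EP.
rewrite act_chi pureZr character_twist -!pureZ -scaleN1r -pureZ.
have pureD (f1 f2 : Vd) : pure f1 w + pure f2 w = pure (f1 + f2) w.
  by have := pure_linearl w 1 f1 f2; rewrite !scale1r.
rewrite !pureD; congr (pure _ w); apply: dual_eqP => v.
rewrite [LHS]/(ev (dual_act (twist m2 y) f) v
  + (-1) ^+ (a && c) * (chi y * ev f v) + (e2 * chi y) * ev f v).
rewrite [RHS]/(-1 * ev f (uact A (inU (twist (c (+) (m1 (+) m2)) y)) v)).
rewrite uact_inU /= /shifted_act character_twist twist_add.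
have -> : m1 (+) (c (+) (m1 (+) m2)) = c (+) m2 by case: m1 m2 (c) => [] [] [].
rewrite [ev (dual_act _ _) v](dual_actE _ (homog_twist m2 hy) hf).
rewrite -twist_add (twist_homog c (homog_twist m2 hy)).
have -> : act ((-1) ^+ (c && a) *: twist m2 y) v =
    (-1) ^+ (c && a) *: act (twist m2 y) v.
  have := act_linearl v ((-1) ^+ (c && a)) (twist m2 y) 0.
  by rewrite (linear_fun0 (act_linearl v)) !addr0.
rewrite linearD !linearZ /= [c && a]andbC.
have -> : (-1) ^+ (a && c) * (chi y * ev f v) = chi y * ev f v :> k.
  by case: a hy {EP} => [/(character_odd chi) ->|_]; rewrite ?mul0r ?mulr0 // mul1r.
have -> : e2 = -1 - e1 by rewrite -e12 addrAC subrr add0r.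
move: (ev f _) (ev f _) => s t.
suff S (b s' t' : k) : - b * t' + chi y * s' + (-1 - e1) * chi y * s' =
    -1 * (b * t' + (e1 * chi y) * s') by exact: S.
by ring.
Qed.

(** The antipode corresponds to transposition. *)
Lemma uact_dual c u (f : Vd) (w : W) : homog c f ->
  uact B (antipode u) (pure f w) =
    pure (transpose (utwist (c (+) (m1 (+) m2)) u) f) w.
Proof.
move=> hf; rewrite -[u in LHS](utwist_add false false u) /=.
suff: forall a, uact B (antipode (utwist a u)) (pure f w) =
    pure (transpose (utwist (a (+) (c (+) (m1 (+) m2))) u) f) w.
  by move=> /(_ false).
elim/U_left_ind: u c f hf => [|b u u' hu hu'|b y u hy hu] c f hf a.
- rewrite !utwist1 antipode1 uact1; congr (pure _ w); apply: dual_eqP => v.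
  by rewrite transposeE uact1.
- rewrite !utwist_linear antipode_linear uactD uactZ (hu _ _ hf) (hu' _ _ hf).
  rewrite -pure_linearl; congr (pure _ w); apply: dual_eqP => v.
  rewrite [LHS]/(b *: ev f (uact A _ v) + ev f (uact A _ v)).
  by rewrite transposeE uactD uactZ linearP.
rewrite !utwistM !utwist_inU (antipode_mull _ (inU_homog (homog_twist a hy))).
rewrite antipode_inU uactM -scaleN1r uactZ uact_inU.
rewrite (lact_dual w (homog_twist a hy) hf) scaleN1r opprK -antipode_twist.
have ht := transpose_homog (homog_twist (c (+) (m1 (+) m2)) (homog_twist a hy)) hf.
rewrite utwist_add (hu _ _ ht).
rewrite transposeM twist_add.
congr (pure (transpose (utwist _ u) (transpose (inU (twist _ y)) f)) w).
  by case: (a); case: (b); case: (c); case: (m1); case: (m2).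
exact: addbC.
Qed.

Lemma dual_part_sumE (f : Vd) : f = part false f + part true f.
Proof. by rewrite part_sum. Qed.

Lemma uact_dual_ker u : (forall v, uact A u v = 0) ->
  forall t, uact B (antipode u) t = 0.
Proof.
move=> ker t; have ker' := uact_shifted_ker _ ker.
suff: uact B (antipode u) =1 (fun=> 0) by apply.
apply: tensor_ext => [|a s s'|f w]; first exact: (@uact_linear k L B).
  by rewrite scaler0 addr0.
move: f; apply: (@linear_homog_ext k Vd T) => [c f f'|c f f'|c f hf].
- by rewrite pure_linearl (@uact_linear k L B).
- by rewrite scaler0 addr0.
rewrite (uact_dual _ _ hf); have -> : transpose (utwist (c (+) (m1 (+) m2)) u) f = 0.
  by apply: dual_eqP => v; rewrite transposeE ker' linear0.
exact: linear_fun0 (pure_linearl w).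
Qed.

(** Linear forms separate the vectors of V. *)
Lemma dual_uact_ker (w0 : W) u : w0 <> 0 -> (forall t, uact B u t = 0) ->
  forall v, uact A (antipode u) v = 0.
Proof.
move=> /separating_form[phi linphi phi0] ker v.
apply: contrapT => /separating_form[f0 linf0 f01].
pose f : Vd := (Sub f0 (introT (is_linear_formP f0) linf0) : dual_sort V).
have pure_inj (f1 : Vd) : pure f1 w0 = 0 -> f1 = 0.
  pose F (f : Vd) (w : W) : Vd := phi w *: f.
  have Fl w : linear (F^~ w).
    by move=> c f1' f2; rewrite /F scalerDr !scalerA mulrC.
  have Fr f1' : linear (F f1').
    by move=> c w w'; rewrite /F linphi scalerDl -scalerA.
  move=> /(congr1 (tensor_lift F)); rewrite (tensor_lift_pure Fl Fr).
  by rewrite (linear_fun0 (tensor_lift_linear Fl Fr)) /F phi0 scale1r.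
have H c : ev (part c f) (uact A (antipode u) v) = 0.
  have hf := homog_part c f; set n := c (+) (m1 (+) m2).
  have := uact_dual (utwist n (antipode u)) w0 hf.
  rewrite antipode_twist antipodeK utwist_add addbb.
  rewrite (uact_shifted_ker _ ker).
  by move=> /esym/pure_inj/(congr1 (fun f => ev f v)).
have E X : ev f X = ev (part false f) X + ev (part true f) X.
  by rewrite {1}(dual_part_sumE f).
have : ev f (uact A (antipode u) v) = 0 by rewrite E !H addr0.
by rewrite [LHS]f01 => /eqP; rewrite oner_eq0.
Qed.
End Duality.

(** * Comparison of two annihilators *)

(** The normal form is taken for the antipode of u, with the coefficients e on the
    left; then u has the antipodes of these as its coefficients on the right.
    When u annihilates the module coinduced from V, they act as zero on the twist
    of V, so that the e act as zero on W by hypothesis. *)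
Lemma coind_ker_antipode (k : fieldType) (p : nat) (char_p : p \in [pchar k])
    (two_neq0 : (2%:R : k) != 0) (g : lie_superalgebra k)
    (h : lie_subsuperalgebra g) (B : adapted_basis h)
    (chi : lie_character (sub_lie h)) (V W : rep (sub_lie h)) :
  (forall n (y : sub_lie h), top_char p B n.+1 (val y) = -1 * chi y) ->
  (forall m u, (forall v, uact (shifted_module V chi (-1) m) u v = 0) ->
     forall w, uact (rep_module W) (antipode u) w = 0) ->
  forall u, coind_ker V u -> coind_ker W (antipode u).
Proof.
move=> chiE kerVW; apply: antipode_coind_ker => u nu ker cnu.
have [N /(fil_spanned B two_neq0)[e eu]] := fil_exists h (antipode u).
have Nq : (N + 2 <= p ^ N.+2)%N.
  by rewrite addn2; apply/ltnW/ltn_expl; rewrite prime_gt1 // (pcharf_prime char_p).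
pose sgn s := sval (cid (antipode_mon (s : seq 'I_(rk B)))).
have sgnE s : antipode (mon s) = (-1) ^+ sgn s *: mon (rev s).
  by rewrite /sgn; case: cid.
pose sig s := sval (cid (mon_homog (s : seq 'I_(rk B)))).
have sigE s : @homog k (U_space g) (sig s) (mon s) by rewrite /sig; case: cid.
pose e' s := (-1) ^+ sgn s *: utwist (sig s) (antipode (e s)).
have eu' : u = \sum_(b : N.-bseq 'I_(rk B) | ordered b) mon (rev b) * iota (e' b).
  rewrite -[u]antipodeK eu.
  have aD : {morph @antipode k g : x y / x + y}.
    by move=> x y; have := antipode_linear 1 x y; rewrite !scale1r.
  rewrite (big_morph _ aD (linear_fun0 (@antipode_linear k g))).
  apply: eq_bigr => b _; rewrite (antipode_mulr _ (sigE b)) sgnE antipode_iota.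
  by rewrite /e' linearZ /= iota_twist -scalerAl -scalerAr.
rewrite eu' in ker.
have kill s : ordered s -> (size s <= N)%N -> forall w, uact (rep_module W) (e s) w = 0.
  move=> os sN w.
  have ker1 v := coind_ker_coef char_p two_neq0 (chiE N.+1) Nq ker os sN v.
  have ker2 v : uact (top_module p B N.+2 V chi (-1)) (antipode (e s)) v = 0.
    rewrite -[antipode _]/(utwist false _) -(addbb (sig s)) -utwist_add.
    apply: uact_shifted_ker => w'; apply/eqP; move/eqP: (ker1 w').
    by rewrite /e' uactZ scaler_eq0 signr_eq0.
  by rewrite -[e s]antipodeK; exact: kerVW ker2 w.
rewrite eu; have [lin _] := cnu.
have nuD : {morph nu : x y / x + y}.
  by move=> x y; have := lin 1 x y; rewrite !scale1r.
rewrite (big_morph _ nuD (linear_fun0 lin)) big1 // => b ob.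
by rewrite (coind_iota _ _ cnu) kill // size_bseq.
Qed.

(** * The supertrace in coordinates *)

Lemma trace_dual_basis (k : fieldType) (W : lmodType k) (r : nat)
    (w : 'I_r -> W) (phi : 'I_r -> W -> k^o) (f : W -> W) :
  finite_dim W -> (forall i, linear (phi i)) ->
  (forall v, v = \sum_i phi i v *: w i) -> linear f ->
  trace f = \sum_i phi i (f (w i)).
Proof.
move=> [n [ax]] lphi span lf; rewrite /trace; case: pselect => [ex|nex]; last first.
  by case: nex; exists (existT _ n ax).
rewrite /trace_in; move: (sval (cid ex)) => c; move: (cid _) => [r2v /= [K1 K2]].
case: c r2v K1 K2 => n' [v2r lv bij] /= r2v K1 K2.
have lr : linear r2v by move=> c u v; rewrite -[u in LHS]K2 -[v in LHS]K2 -lv K1.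
pose mk (U1 U2 : lmodType k) (F : U1 -> U2) (lF : linear F) : {linear U1 -> U2} :=
  HB.pack_for {linear U1 -> U2} F (GRing.isLinear.Build k U1 U2 *:%R F lF).
have sumE (U1 U2 : lmodType k) (F : U1 -> U2) (lF : linear F) (I : finType)
    (a : I -> k) (u : I -> U1) : F (\sum_i a i *: u i) = \sum_i a i *: F (u i).
  rewrite -[F]/(mk _ _ F lF : _ -> _) linear_sum.
  by apply: eq_bigr => i _; rewrite linearZ.
rewrite /mxtrace.
under [LHS]eq_bigr => j _.
  rewrite !mxE /= [r2v _]span (sumE _ _ _ lf) (sumE _ _ _ lv) summxE.
  under eq_bigr => i _ do rewrite mxE.
  over.
rewrite exchange_big; apply: eq_bigr => i _ /=.
rewrite -[RHS](congr1 (phi i) (K1 (f (w i)))).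
rewrite [v2r (f (w i)) in RHS]row_sum_delta (sumE _ _ _ lr) (sumE _ _ _ (lphi i)).
by apply: eq_bigr => j _; rewrite mulrC.
Qed.

Section Strad.
Variables (k : fieldType) (g : lie_superalgebra k) (h : lie_subsuperalgebra g).
Variable B : adapted_basis h.
Hypothesis fin_dim : finite_dim (lie_quot h).

(** The quotient map identifies coo B with the coordinates of g/h. *)
Lemma trace_ad (y : sub_lie h) (a : bool) :
  trace (part a \o @act k _ (ad_quot h) y) =
    \sum_(i | par B i == a) coo B i (br (val y) (bas B i)).
Proof.
pose phi i (u : lie_quot h) : k^o := coo B i (repr u).
have phiE i z : phi i (lie_quot_pi h z) = coo B i z.
  have /(coo_mem B)/(_ i) : repr (lie_quot_pi h z) - z \in lie_sub_mem h.
    by apply/lie_quot_eqP; exact: reprK.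
  by rewrite cooB => /eqP; rewrite subr_eq0 => /eqP.
rewrite (trace_dual_basis (w := fun i => lie_quot_pi h (bas B i)) (phi := phi)) //.
- rewrite [RHS]big_mkcond; apply: eq_bigr => i _.
  have -> : (part a \o @act k _ (ad_quot h) y) (lie_quot_pi h (bas B i)) =
      lie_quot_pi h (part a (br (val y) (bas B i))).
    by rewrite /= ad_quot_actE; exact: lie_quot_partE.
  rewrite phiE eq_sym; move: (br _ _) => z; case: eqVneq => [->|ne].
    rewrite -[z in RHS]part_sum cooD; case: (par B i) (@coo_homog _ _ _ B i) => H.
      by rewrite (H false _ (homog_part _ _)) // add0r.
    by rewrite (H true _ (homog_part _ _)) // addr0.
  by rewrite (coo_homog (homog_part a z)).
- move=> i c; elim/lie_quot_ind=> u; elim/lie_quot_ind=> v.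
  by rewrite -lie_quot_pi_linear !phiE cooP.
- elim/lie_quot_ind=> z; under eq_bigr => i _ do rewrite phiE -linearZ.
  rewrite -linear_sum; apply/lie_quot_eqP; exact: sub_part_mem.
- move=> c u v; have l := @act_linearr k _ (ad_quot h) y c u v.
  by rewrite -[LHS]/(part a (@act k _ (ad_quot h) y (c *: u + v))) l part_linear.
Qed.

(** An even letter occurs q - 1 times in the top word, which is -1 in k, and an odd
    one once: this is where the supertrace comes from. *)
Lemma top_char_strad p n (y : sub_lie h) : p \in [pchar k] ->
  top_char p B n.+1 (val y) = -1 * neg_strad h y.
Proof.
move=> char_p; rewrite [neg_strad h y]/(- rep_str (ad_quot h) y) mulrNN mul1r.
rewrite /rep_str /supertrace !trace_ad /top_char.
have E i : coo B i (br (bas B i) (val y)) = - coo B i (br (val y) (bas B i)).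
  by rewrite -(coo_br_twist (par B i)) (br_anti _ (bas_homog i)) twistK cooN.
under eq_bigr => i _ do rewrite E.
have capE i : (cap p n.+1 i)%:R = (-1) ^+ (~~ par B i) :> k.
  rewrite /cap; case: (par B i) => //=.
  have q_gt0 : (0 < p ^ n.+1)%N by rewrite expn_gt0 prime_gt0 // (pcharf_prime char_p).
  have : (p ^ n.+1)%:R = 0 :> k.
    by apply/eqP; rewrite -(dvdn_pcharf char_p) expnS dvdn_mulr.
  by rewrite -{1}(prednK q_gt0) -addn1 natrD => /eqP; rewrite addr_eq0 => /eqP->.
have -> (F : 'I_(rk B) -> k) : \sum_(l <- top p B n.+1) F l =
    \sum_l (cap p n.+1 l)%:R * F l.
  rewrite (partition_big id xpredT) //=; apply: eq_bigr => l _.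
  rewrite (eq_bigr (fun=> F l)) => [|i /eqP -> //].
  by rewrite big_const_seq iter_addr_0 -(count_top p n.+1) mulr_natl.
rewrite [LHS](bigID (fun l => par B l == false)) /=; congr (_ + _).
  by apply: eq_bigr => i /eqP pi; rewrite capE pi mulrNN mul1r.
rewrite -sumrN; apply: eq_big => i; first by case: (par B i).
by case pi : (par B i) => // _; rewrite capE pi mul1r.
Qed.
End Strad.

(** * Existence of a homogeneous basis *)

Section BasisExistence.
Variables (k : fieldType) (g : lie_superalgebra k) (h : lie_subsuperalgebra g).
Variable n : nat.
Variables (v2r : lie_quot h -> 'rV[k]_n) (r2v : 'rV[k]_n -> lie_quot h).
Hypothesis lv : linear v2r.
Hypotheses (vK : cancel v2r r2v) (rK : cancel r2v v2r).

Let lr : linear r2v.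
Proof. by move=> c u v; rewrite -[u in LHS]rK -[v in LHS]rK -lv vK. Qed.

(** The matrices of the two projections; a homogeneous basis consists of bases
    of their row spaces. *)
Let proj (a : bool) : 'M[k]_n := lin1_mx (v2r \o part a \o r2v).

Let projE a u : u *m proj a = v2r (part a (r2v u)).
Proof.
rewrite mul_rV_linear // => c u1 u2.
by rewrite -[LHS]/(v2r (part a (r2v (c *: u1 + u2)))) lr part_linear lv.
Qed.

Let proj_proj a b : proj a *m proj b = if a == b then proj b else 0.
Proof.
apply/row_matrixP => i; rewrite !rowE mulmxA !projE vK part_part eq_sym.
by case: eqP => [->|_]; rewrite ?projE // mulmx0 (linear_fun0 lv).
Qed.

Let proj_sum : proj false + proj true = 1%:M.
Proof.
apply/row_matrixP => i; rewrite !rowE mulmxDr !projE mulmx1.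
have lD u v : v2r u + v2r v = v2r (u + v) by have := lv 1 u v; rewrite !scale1r.
by rewrite lD part_sum rK.
Qed.

Local Notation rows a := (row_base (proj a)).

Let rows_proj a b : rows a *m proj b = if a == b then rows a else 0.
Proof.
have /submxP[D e] : (rows a <= proj a)%MS by rewrite eq_row_base.
rewrite {1}e -mulmxA proj_proj; case: ifP => [/eqP ab|_]; last exact: mulmx0.
by rewrite -ab -e.
Qed.

Let lift_ex a (j : 'I_(\rank (proj a))) :
  exists x, homog a x /\ lie_quot_pi h x = r2v (row j (rows a)).
Proof.
have /lie_quot_homogP[x hx e] : homog a (r2v (row j (rows a))).
  by rewrite /homog -[LHS]vK -projE -row_mul rows_proj eqxx.
by exists x.
Qed.

Let lift a j : g := sval (cid (@lift_ex a j)).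
Let lift_homog a j : homog a (@lift a j).
Proof. by rewrite /lift; case: cid => x []. Qed.
Let lift_pi a j : lie_quot_pi h (@lift a j) = r2v (row j (rows a)).
Proof. by rewrite /lift; case: cid => x []. Qed.

Let coord a (y : g) : 'rV[k]_(\rank (proj a)) :=
  v2r (lie_quot_pi h y) *m proj a *m pinvmx (rows a).

Let coord_linear a : linear (coord a).
Proof.
by move=> c y z; rewrite /coord lie_quot_pi_linear lv !mulmxDl -!scalemxAl.
Qed.

Let coord_same a (j i : 'I_(\rank (proj a))) : coord a (lift j) 0 i = (j == i)%:R.
Proof.
rewrite /coord lift_pi rK -!row_mul rows_proj eqxx mulmxVp ?row_base_free //.
by rewrite !mxE.
Qed.

Let coord_diff a b (j : 'I_(\rank (proj b))) : b != a -> coord a (lift j) = 0.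
Proof.
move=> /negPf ba; rewrite /coord lift_pi rK -row_mul rows_proj.
by rewrite ba row0 mul0mx.
Qed.

Let coord_homog a b y : homog b y -> b != a -> coord a y = 0.
Proof.
move=> hy /negPf ba; rewrite /coord projE vK.
have -> : part a (lie_quot_pi h y : lie_quot h) = 0.
  by rewrite [LHS]lie_quot_partE (part_homog a hy) eq_sym ba linear0.
by rewrite (linear_fun0 lv) mul0mx.
Qed.

Let coord_mem y : y \in lie_sub_mem h <-> forall a, coord a y = 0.
Proof.
have pi0 : lie_quot_pi h y = 0 <-> y \in lie_sub_mem h.
  by rewrite -(linear0 (lie_quot_pi h)) lie_quot_eqP subr0.
rewrite -pi0; split=> [y0 a|c0].
  by rewrite /coord y0 (linear_fun0 lv) !mul0mx.
rewrite -[LHS]vK -[v2r _]mulmx1 -proj_sum mulmxDr.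
have z a : v2r (lie_quot_pi h y) *m proj a = 0.
  have <- : coord a y *m rows a = v2r (lie_quot_pi h y) *m proj a.
    by rewrite /coord mulmxKpV // eq_row_base submxMl.
  by rewrite c0 mul0mx.
by rewrite !z addr0; exact: linear_fun0 lr.
Qed.

Lemma adapted_basis_of_coordinates : inhabited (adapted_basis h).
Proof.
pose r a : nat := \rank (proj a).
pose x (i : 'I_(r false + r true)) : g :=
  match fintype.split i with inl j => lift j | inr j => lift j end.
pose d (i : 'I_(r false + r true)) := if fintype.split i is inl _ then false else true.
pose c (i : 'I_(r false + r true)) (y : g) : k :=
  match fintype.split i with inl j => coord false y 0 j | inr j => coord true y 0 j end.
split; apply: (@AdaptedBasis k g h _ x d c).
- by move=> i; rewrite /x /d; case: (fintype.split i) => j; exact: lift_homog.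
- by move=> i e y z; rewrite /c; case: (fintype.split i) => j; rewrite coord_linear !mxE.
- move=> i a y hy; rewrite /c /d; case: (fintype.split i) => j ad.
    by rewrite (coord_homog hy ad) mxE.
  by rewrite (coord_homog hy ad) mxE.
- move=> i j; rewrite -(inj_eq (can_inj (@fintype.splitK _ _))) /c /x.
  case: (fintype.split i) => i'; case: (fintype.split j) => j'.
  + by rewrite coord_same eq_sym.
  + by rewrite coord_diff // mxE.
  + by rewrite coord_diff // mxE.
  + by rewrite coord_same eq_sym.
move=> y; rewrite coord_mem; split=> [c0 i|c0 a].
  by rewrite /c; case: (fintype.split i) => j; rewrite c0 mxE.
apply/rowP => j; rewrite [RHS]mxE; case: a j => j.
  by have := c0 (unsplit (inr j)); rewrite /c fintype.unsplitK.
by have := c0 (unsplit (inl j)); rewrite /c fintype.unsplitK.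
Qed.
End BasisExistence.

Lemma adapted_basis_exists (k : fieldType) (g : lie_superalgebra k)
  (h : lie_subsuperalgebra g) : finite_dim (lie_quot h) -> inhabited (adapted_basis h).
Proof.
move=> [n [[v2r lv [r2v vK rK]]]]; exact: (adapted_basis_of_coordinates lv vK rK).
Qed.

(** * Duality of the annihilators *)

Lemma iter_parity_act (k : fieldType) (L : lie_superalgebra k) (W : rep L)
    (chi : lie_character L) (m : nat) :
  (forall y (w : W), act y w = chi y *: w) ->
  forall y (w : iter m (@parity_rep k L) W), act y w = chi y *: w.
Proof. by move=> actW; elim: m. Qed.

Lemma iter_parity_neq0 (k : fieldType) (L : lie_superalgebra k) (W : rep L) (m : nat) :
  (exists w : W, w <> 0) -> exists w : iter m (@parity_rep k L) W, w <> 0.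
Proof. by move=> neqW; elim: m. Qed.

Section DualAnnihilator.
Variables (k : fieldType) (p : nat).
Hypotheses (char_p : p \in [pchar k]) (two_neq0 : (2%:R : k) != 0).
Variables (g : lie_superalgebra k) (h : lie_subsuperalgebra g).
Hypothesis fin_dim : finite_dim (lie_quot h).
Variables (V W : rep (sub_lie h)) (w0 : W).
Hypothesis w0_neq0 : w0 <> 0.
Hypothesis act_chi : forall y (w : W), act y w = neg_strad h y *: w.
Local Notation V' := (tensor (contragredient V) W).

(** Twisting by the supertrace once on either side makes the duality between V
    and V' exact, so that the comparison applies in both directions. *)
Lemma coind_ker_dual : coind_ker V = (@antipode k g) @` coind_ker V'.
Proof.
have [B] := adapted_basis_exists fin_dim.
have chiE n y := top_char_strad B fin_dim n y char_p.
have VV' : forall u, coind_ker V u -> coind_ker V' (antipode u).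
  apply: (coind_ker_antipode char_p two_neq0 chiE) => m u ker w.
  rewrite -(uact_shifted0 (neg_strad h)).
  exact: (uact_dual_ker act_chi (addr0 _) ker).
have V'V : forall u, coind_ker V' u -> coind_ker V (antipode u).
  apply: (coind_ker_antipode char_p two_neq0 chiE) => m u ker v.
  rewrite -(uact_shifted0 (neg_strad h)).
  exact: (dual_uact_ker act_chi (add0r _) w0_neq0 ker).
apply/seteqP; split=> u; first by exists (antipode u); [exact: VV'|exact: antipodeK].
by move=> [u' ker <-]; exact: V'V.
Qed.
End DualAnnihilator.

Theorem theorem6p6 (k : fieldType) (p : nat)
    (p_gt2 : (2 < p)%N) (char_k : p \in [pchar k])
    (g : lie_superalgebra k) (h : lie_subsuperalgebra g)
    (V : rep (sub_lie h)) (m : nat)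
    (fin_dim : finite_dim (lie_quot h))
    (odd_dim : has_dim (component (lie_quot h) true) m) :
  coind_ker V =
    (@antipode k g) @` coind_ker
      (tensor (contragredient V)
         (iter m (@parity_rep k (sub_lie h)) (character_rep (neg_strad h))))
  /\
  coind_ker V =
    (@antipode k g) @` coind_ker
      (tensor (contragredient V) (character_rep (neg_strad h))).
Proof.
have two_neq0 : (2%:R : k) != 0.
  by rewrite -(dvdn_pcharf char_k) gtnNdvd.
have act_chi y (w : character_rep (neg_strad h)) : act y w = neg_strad h y *: w by [].
have neq0 : exists w : character_rep (neg_strad h), w <> 0.
  by exists (1 : k^o); apply/eqP; exact: oner_neq0.
split; last by have [w w0] := neq0; exact: (coind_ker_dual char_k two_neq0 fin_dim V w0).
have [w w0] := iter_parity_neq0 m neq0.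
exact: (coind_ker_dual char_k two_neq0 fin_dim V w0 (iter_parity_act act_chi)).
Qed.
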